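(* Let $l,m\ge 0$ be integers, let $p\in\mathscr{P}_l$ and $q\in\mathscr{H}_{\kappa,m}$. If $l-m=2n$ is a non-negative even integer, then \[ \frac{1}{\omega_{\kappa,d}}\int_{S^{d-1}} q(y)\,p(y)\,h_\kappa^2(y)\,d\sigma(y)=\frac{1}{2^{m+2n}\,n!\,(\lambda_\kappa+1)_{m+n}}\;q(\mathscr{D})\Delta_\kappa^{n}p \] (the right-hand side being a constant since $q(\mathscr{D})\Delta_\kappa^n p$ is a polynomial of degree $0$). If $l-m$ is negative or odd, the integral on the left-hand side vanishes.
   Context: Let $d\ge1$, $\langle\cdot,\cdot\rangle$ the standard inner product on $\mathbb{R}^d$, $\|x\|=\langle x,x\rangle^{1/2}$. Let $R\subset\mathbb{R}^d$ be a reduced root system (not necessarily crystallographic) with a fixed positive system $R_+$, $r_\alpha$ the reflection in $\alpha^\perp$, and $G$ the finite reflection group generated by the $r_\alpha$. Let $\kappa:R\to\mathbb{R}_{\ge0}$, $\alpha\mapsto\kappa_\alpha$, be $G$-invariant (a multiplicity function). Put $\lambda_\kappa=\frac d2-1+\sum_{\alpha\in R_+}\kappa_\alpha$. For $\xi\in\mathbb{R}^d\setminus\{0\}$ the Dunkl operator is $\mathscr{D}_\xi f(x)=\partial_\xi f(x)+\sum_{\alpha\in R_+}\kappa_\alpha\langle\alpha,\xi\rangle\frac{f(x)-f(r_\alpha x)}{\langle\alpha,x\rangle}$, where $\partial_\xi$ is the directional derivative; these operators commute. With $e_1,\dots,e_d$ the standard basis, $\mathscr{D}_j=\mathscr{D}_{e_j}$,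 $\mathscr{D}=(\mathscr{D}_1,\dots,\mathscr{D}_d)$, and $\Delta_\kappa=\sum_j\mathscr{D}_j^2$ (Dunkl Laplacian). For a polynomial $q$, $q(\mathscr{D})$ is obtained by substituting $\mathscr{D}_j$ for $x_j$. $\mathscr{P}$ denotes real polynomials on $\mathbb{R}^d$, $\mathscr{P}_m$ the homogeneous ones of degree $m$, $\mathscr{H}_{\kappa,m}=\{p\in\mathscr{P}_m:\Delta_\kappa p=0\}$. The weight is $h_\kappa(x)=\prod_{\alpha\in R_+}|\langle\alpha,x\rangle|^{\kappa_\alpha}$, $d\sigma$ is surface measure on the unit sphere $S^{d-1}$, and $\omega_{\kappa,d}=\int_{S^{d-1}}h_\kappa^2\,d\sigma$. $(a)_0=1$, $(a)_n=a(a+1)\cdots(a+n-1)$. *)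

(* Defs.v *)
From HB Require Import structures.
From mathcomp Require Import all_boot all_order all_algebra.
From mathcomp Require Import all_classical all_reals all_analysis.
From mathcomp Require mpoly.
Import (canonicals, coercions) mpoly.
Set Implicit Arguments. Unset Strict Implicit. Unset Printing Implicit Defensive.
Import Order.TTheory GRing.Theory Num.Theory.
Import numFieldNormedType.Exports.
Local Open Scope ring_scope.

Section Dunkl.
Variables (R : realType) (d : nat).
Local Notation vec := 'rV[R]_d.

Definition dot (x y : vec) : R := \sum_(i < d) x 0 i * y 0 i.
Definition enorm (x : vec) : R := Num.sqrt (dot x x).
Definition ebasis (j : 'I_d) : vec := delta_mx 0 j.

Definition refl (a x : vec) : vec := x - ((2 * dot a x) / dot a a) *: a.

(* reduced root system (not necessarily crystallographic), as a duplicate-free list *)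
Definition root_system (Rs : seq vec) : Prop :=
  [/\ uniq Rs, (0 : vec) \notin Rs,
      (forall a b, a \in Rs -> b \in Rs -> refl a b \in Rs) &
      (forall a (c : R), a \in Rs -> (c *: a \in Rs <-> (c = 1 \/ c = -1)))].

Inductive in_refl_group (Rs : seq vec) : (vec -> vec) -> Prop :=
| refl_group_id : in_refl_group Rs id
| refl_group_comp a g : a \in Rs -> in_refl_group Rs g ->
    in_refl_group Rs (refl a \o g).

Definition multiplicity (Rs : seq vec) (kappa : vec -> R) : Prop :=
  (forall a, a \in Rs -> 0 <= kappa a) /\
  (forall g a, in_refl_group Rs g -> a \in Rs -> kappa (g a) = kappa a).

Definition regular (Rs : seq vec) (v : vec) : Prop :=
  forall a, a \in Rs -> dot a v != 0.
Definition pos_roots (Rs : seq vec) (v : vec) : seq vec :=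
  [seq a <- Rs | 0 < dot a v].

Definition lambda_k (Rp : seq vec) (kappa : vec -> R) : R :=
  d%:R / 2 - 1 + \sum_(a <- Rp) kappa a.

(* difference quotient (f(x) - f(r_a x)) / <a,x>, extended continuously to the
   hyperplane <a,x> = 0 by its limit (2/<a,a>) d_a f(x) *)
Definition diffq (a : vec) (f : vec -> R) (x : vec) : R :=
  if dot a x != 0 then (f x - f (refl a x)) / dot a x
  else (2 / dot a a) * derive f x a.

Definition dunkl (Rp : seq vec) (kappa : vec -> R) (xi : vec) (f : vec -> R)
  : vec -> R :=
  fun x => derive f x xi + \sum_(a <- Rp) kappa a * dot a xi * diffq a f x.

Definition dunklj Rp kappa (j : 'I_d) := dunkl Rp kappa (ebasis j).

Definition dunkl_lap Rp kappa (f : vec -> R) : vec -> R :=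
  fun x => \sum_(j < d) dunklj Rp kappa j (dunklj Rp kappa j f) x.

Definition peval (p : mpoly.mpoly d R) : vec -> R :=
  fun x => mpoly.meval (fun i => x 0 i) p.

Definition dunkl_mon Rp kappa (m : mpoly.multinom d) (f : vec -> R) : vec -> R :=
  foldr (fun j g => iter (mpoly.fun_of_multinom m j) (dunklj Rp kappa j) g) f (enum 'I_d).
Definition dunkl_poly Rp kappa (q : mpoly.mpoly d R) (f : vec -> R) : vec -> R :=
  fun x => \sum_(m <- mpoly.msupp q)
             mpoly.mcoeff m q * dunkl_mon Rp kappa m f x.

(* homogeneous of total degree l (the zero polynomial included) *)
Definition homog_deg (l : nat) (p : mpoly.mpoly d R) : Prop :=
  forall m : mpoly.multinom d, m \in mpoly.msupp p -> mpoly.mdeg m = l.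

Definition hk (Rp : seq vec) (kappa : vec -> R) (x : vec) : R :=
  \prod_(a <- Rp) (`| dot a x | `^ kappa a).

(* Lebesgue integral on R^n, nonnegative functions, by iterated integrals (Tonelli) *)
Fixpoint iint (n : nat) : (n.-tuple R -> \bar R) -> \bar R :=
  match n return (n.-tuple R -> \bar R) -> \bar R with
  | 0 => fun f => f [tuple]
  | n'.+1 => fun f =>
      (\int[@lebesgue_measure R]_x iint (fun t => f (cons_tuple x t)))%E
  end.

Definition row_of_tuple (t : d.-tuple R) : vec := \row_i tnth t i.

Definition leb_int (f : vec -> R) : R :=
  fine (iint (fun t => (Num.max (f (row_of_tuple t)) 0)%:E)) -
  fine (iint (fun t => (Num.max (- f (row_of_tuple t)) 0)%:E)).

(* integral over S^{d-1} w.r.t. surface measure, via the cone measure: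
   sigma(A) = d * vol{ x : |x| <= 1, x/|x| in A } *)
Definition sphere_int (f : vec -> R) : R :=
  d%:R * leb_int (fun x => if enorm x <= 1 then f ((enorm x)^-1 *: x) else 0).

Definition pochhammer (a : R) (n : nat) : R := \prod_(i < n) (a + i%:R).

End Dunkl.

(* Main.v *)
(* With [w = hk ^+ 2] and [L f] the integral of [f * w] over the sphere, one has
   [L (D_j f) = (deg f + 1 + 2 lambda) * L (x_j f)] for homogeneous [f]: integrate
   [d_j (f w (1 - |x|^2))] along lines of the unit ball, symmetrize the singular terms by the
   reflections, and convert ball integrals of homogeneous functions into sphere integrals.
   The product rule for [D_j] fails only by terms odd under a reflection, so this yields Green's
   formula [L (q Delta f) = (deg f - deg q) (deg f + deg q + 2 lambda) * L (q f)] for harmonic [q].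
   Hence [L (q f) = 0] when [deg f < deg q], and [L (q p)] reduces to the case [deg p = deg q = m].
   There, [ad(Delta)^m] of multiplication by [q] is [2^m m! q(D)], because [ [Delta, x_j] = 2 D_j ]
   commutes with [Delta]; in [L (ad(Delta)^m(q) p)] every term with [Delta] on the right of [q]
   vanishes by degree, and the remaining one is a multiple of [L (q p)]. *)

Require Import Defs.
From HB Require Import structures.
From mathcomp Require Import all_boot all_order all_algebra.
From mathcomp Require Import all_classical all_reals all_analysis.
From mathcomp Require Import measurable_realfun ring lra.
From mathcomp Require mpoly.
Import (canonicals, coercions) mpoly.
Import Order.TTheory GRing.Theory Num.Theory.
Import numFieldNormedType.Exports.
Local Open Scope ring_scope.
Set Implicit Arguments.
Unset Strict Implicit.
Unset Printing Implicit Defensive.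
Local Open Scope classical_set_scope.
Local Open Scope ring_scope.

(** * Iterated Lebesgue integrals as integrals for a measure on tuples *)

(** The surface integral is by definition an integral over the ball of a function constant along
    rays, and the ball integral is an iterated one. There is thus no divergence theorem at hand:
    boundary terms have to vanish on every line parallel to an axis, which is the purpose of the
    factor [1 - |x|^2]. For small multiplicities the weight is not differentiable on the walls
    [<a,x> = 0]. Each factor [|<a,x>|^(2 kappa)] is therefore replaced by [(<a,x>^2 + e)^kappa]. The
    symmetrization comes before the limit [e -> 0]: it trades [f / <a,x>] for a difference quotient,
    which is a polynomial, and only then is the integrand bounded uniformly in [e]. Algebraic
    identities are proved on polynomial functions, by induction on their construction from constants
    by multiplication with linear forms and addition. Each identity then reduces to the commutation
    of an operator with one linear form, and the values of the difference quotients on the walls are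
    covered by the same induction. *)

Local Notation pushforward_measure :=
  measure_function_pushforward__canonical__measure_function_Measure.

(** The scaled pushforward gives every half-open interval its length, and Lebesgue measure is the
    only measure that does so. *)
Lemma lebesgue_measure_affine (R : realType) (a b : R) (A : set R) : 0 < a ->
  measurable A ->
  (a%:E * lebesgue_measure ((fun x : R => a * x + b)%R @^-1` A) = lebesgue_measure A)%E.
Proof.
move=> a0 mA.
have mf : measurable_fun [set: measurableTypeR R] (fun x : R => (a * x + b)%R : measurableTypeR R).
  exact: measurable_funD.
pose nu : {measure set (measurableTypeR R) -> \bar R} :=
  mscale (NngNum (ltW a0)) (pushforward_measure lebesgue_measure mf).
rewrite -[LHS]/(nu A); symmetry; apply: (@lebesgue_measure_unique R nu) => //= _ [[p q]] _ <-.
rewrite /nu/= /mscale/= /pushforward.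
have -> : (fun x => a * x + b) @^-1` `]p, q]%classic = `](p - b)/a, (q - b)/a]%classic.
  apply/seteqP; split => x /=; rewrite !in_itv/= ltr_pdivrMr// ler_pdivlMr// ltrBlDr lerBrDr mulrC//.
rewrite !lebesgue_measure_itv/= !lte_fin ltr_pM2r ?invr_gt0// ltrD2r.
case: ifP => _; last by rewrite mule0.
rewrite -!EFinD -EFinM; congr (_%:E); field; lra.
Qed.

Lemma ge0_integral_affine (R : realType) (a b : R) (f : R -> \bar R) : a != 0 ->
  measurable_fun setT f -> (forall x, 0 <= f x)%E ->
  (`|a|%:E * \int[@lebesgue_measure R]_x f (a * x + b)%R = \int[@lebesgue_measure R]_x f x)%E.
Proof.
move=> a0 mf f0.
have pos (c : R) : 0 < c -> forall g : R -> \bar R, measurable_fun setT g -> (forall x, 0 <= g x)%E ->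
   (c%:E * \int[@lebesgue_measure R]_x g (c * x + b)%R = \int[@lebesgue_measure R]_x g x)%E.
  move=> c0 g mg g0.
  have mphi : measurable_fun [set: measurableTypeR R] (fun x : R => (c * x + b)%R : measurableTypeR R).
    exact: measurable_funD.
  have := ge0_integral_pushforward mphi lebesgue_measure measurableT mg (fun y _ => g0 y).
  rewrite preimage_setT /= => <-.
  rewrite -(ge0_integral_mscale (pushforward_measure lebesgue_measure mphi) measurableT (NngNum (ltW c0)) mg (fun y _ => g0 y)).
  apply: eq_measure_integral => A mA _.
  by rewrite /= /mscale/= /pushforward lebesgue_measure_affine.
(* A negative slope is a positive one composed with [x -> -x], which preserves Lebesgue measure. *)
have [a_lt|a_gt|a0'] := ltgtP a 0.
- rewrite -[RHS](pos (-a)) ?oppr_gt0//.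
  rewrite ltr0_norm//; congr (_ * _)%E.
  have mg : measurable_fun setT (fun x : R => f (a * x + b)).
    by apply: (measurableT_comp mf); exact: measurable_funD.
  have mN : measurable_fun [set: measurableTypeR R] (-%R : R -> measurableTypeR R) by exact: oppr_measurable.
  have := ge0_integral_pushforward mN lebesgue_measure measurableT mg (fun y _ => f0 _).
  rewrite preimage_setT /=.
  under [X in _ = X -> _]eq_integral do rewrite /= mulrN -mulNr.
  move=> <-; apply: eq_measure_integral => A mA _; exact/esym/lebesgue_measureN.
- by rewrite gtr0_norm//; exact: pos.
- by rewrite a0' eqxx in a0.
Qed.

Lemma measurable_cons_snd (R : realType) n (f : n.+1.-tuple R -> \bar R) (x : R) :
  measurable_fun setT f -> measurable_fun setT (fun t : n.-tuple R => f (cons_tuple x t)).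
Proof.
move=> mf; apply: (measurableT_comp mf).
have := @measurable_cons _ _ (n.-tuple R) R (fun=> x) n id.
by apply.
Qed.

Lemma measurable_cons_pair (R : realType) n :
  measurable_fun setT (fun xt : R * n.-tuple R => cons_tuple xt.1 xt.2).
Proof.
have := @measurable_cons _ _ (R * n.-tuple R)%type R fst n snd.
by apply.
Qed.

(** Cubes exhaust the space and have finite measure: they witness sigma-finiteness and later carry
    the dominating constants. *)
Definition cube (R : realType) n (k : R) : set (n.-tuple R) :=
  [set t | forall i, `|tnth t i| <= k].
Arguments cube {R} n k.

Lemma measurable_cube (R : realType) n (k : R) : measurable (cube n k).
Proof.
rewrite (_ : cube n k = \bigcap_(i in [set: 'I_n]) ((fun t => tnth t i) @^-1` `[-k, k]%classic)).
  apply: fin_bigcap_measurable => // i _.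
  by rewrite -[X in measurable X]setTI; apply: measurable_tnth.
apply/seteqP; split => t /= h i => [_|].
  by rewrite /= in_itv/= -ler_norml.
by have := h i I; rewrite /= in_itv/= -ler_norml.
Qed.

Lemma bigcup_cube (R : realType) n : \bigcup_i (cube n (i%:R : R)) = setT.
Proof.
apply/seteqP; split => // t _.
exists (Num.trunc (\sum_i `|tnth t i|)).+1 => // i.
apply/ltW/(le_lt_trans _ (truncnS_gt _)).
by rewrite (bigD1 i)//= lerDl sumr_ge0.
Qed.

(** [iint] is a bare recursion on integrands; Tonelli and dominated convergence require a measure
    behind it. That measure is the product of Lebesgue measure with the previous one, pushed forward
    by [cons_tuple]. Finiteness on cubes is carried through the induction because it yields the
    sigma-finiteness that Tonelli uses at the next step. *)
Lemma iint_measure (R : realType) n :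
  exists mu : {sigma_finite_measure set (n.-tuple R) -> \bar R},
    (forall f, measurable_fun setT f -> (forall t, 0 <= f t)%E ->
      iint f = (\int[mu]_t f t)%E) /\
    (forall k, mu (cube n k) < +oo)%E.
Proof.
elim: n => [|n [mu [IH fmu]]].
  exists (dirac ([tuple] : 0.-tuple R)); split => [f mf f0 /=|k].
    by rewrite integral_dirac// diracT mul1e.
  by rewrite (le_lt_trans (probability_le1 _ _)) ?ltry//; exact: measurable_cube.
pose phi := fun xt : R * n.-tuple R => cons_tuple xt.1 xt.2.
have mphi : measurable_fun setT phi := @measurable_cons_pair R n.
pose nu := pushforward_measure (@lebesgue_measure R \x mu)%E mphi.
have nuk k : (nu (cube n.+1 k) < +oo)%E.
  rewrite /nu/= /pushforward (_ : _ @^-1` _ = `[-k, k]%classic `*` cube n k).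
    rewrite product_measure1E//; last exact: measurable_cube.
    rewrite /= lebesgue_measure_itv/=; apply: lte_mul_pinfty => //.
    - by case: ifP => //; rewrite lte_fin -EFinD lee_fin => ?; lra.
    - by case: ifP.
  apply/seteqP; split => -[x t] /=.
    move=> h; split; first by have := h ord0; rewrite in_itv/= -ler_norml.
    by move=> i; have := h (lift ord0 i); rewrite tnthS.
  rewrite in_itv/= -ler_norml => -[xk tk] i.
  by case: (unliftP ord0 i) => [j ->|->]; rewrite ?tnthS.
have sf : sigma_finite setT nu.
  exists (fun i => cube n.+1 i%:R); first by rewrite bigcup_cube.
  by move=> i; split; [exact: measurable_cube|exact: nuk].
pose nu' := HB.pack_for {sigma_finite_measure set (n.+1.-tuple R) -> \bar R}
  (Measure.sort nu)
  (Measure.on nu) (Measure_isSigmaFinite.Build _ _ _ nu sf).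
exists nu'; split => // f mf f0.
have mfphi : measurable_fun setT (f \o phi) by exact: measurableT_comp.
have := @ge0_integral_pushforward _ _ (measurableTypeR R * n.-tuple R)%type _ R
  phi mphi (@lebesgue_measure R \x mu)%E _ f measurableT mf
  (fun t _ => f0 t).
rewrite preimage_setT => /= ->.
rewrite fubini_tonelli1//=; apply: eq_integral => x _.
by rewrite IH//; exact: measurable_cons_snd.
Qed.

Definition leb_tuple (R : realType) n : {sigma_finite_measure set (n.-tuple R) -> \bar R} :=
  sval (cid (@iint_measure R n)).

Lemma iintE (R : realType) n (f : n.-tuple R -> \bar R) :
  measurable_fun setT f -> (forall t, 0 <= f t)%E ->
  iint f = (\int[@leb_tuple R n]_t f t)%E.
Proof. by rewrite /leb_tuple; case: cid => mu /= [h _]; exact: h. Qed.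

Lemma leb_tuple_cube (R : realType) n k : (@leb_tuple R n (cube n k) < +oo)%E.
Proof. by rewrite /leb_tuple; case: cid => mu /= [_ h]; exact: h. Qed.

Definition upd (R : realType) n (s : n.-tuple R) (j : 'I_n) (x : R) : n.-tuple R :=
  [tuple if i == j then x else tnth s i | i < n].

Section line.
Variable R : realType.

Lemma measurable_upd d (T : measurableType d) n (s : T -> n.-tuple R) j (x : T -> R) :
  measurable_fun setT s -> measurable_fun setT x ->
  measurable_fun setT (fun t => upd (s t) j (x t)).
Proof.
move=> ms mx; apply/measurable_fun_tnthP => i.
rewrite (_ : _ \o _ = fun t => if i == j then x t else tnth (s t) i); last first.
  by apply/funext => t /=; rewrite tnth_mktuple.
case: (i == j) => //; exact: (measurableT_comp (measurable_tnth i) ms).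
Qed.

(** [iint] integrates the coordinates in a fixed order, so a comparison along direction [j] has to
    bring that coordinate innermost: by induction if [j] is not the first one, by Tonelli if it
    is. *)
Lemma iint_line n (j : 'I_n) (F G : n.-tuple R -> \bar R) :
  measurable_fun setT F -> measurable_fun setT G ->
  (forall t, 0 <= F t)%E -> (forall t, 0 <= G t)%E ->
  (forall s, \int[@lebesgue_measure R]_x F (upd s j x) =
             \int[@lebesgue_measure R]_x G (upd s j x))%E ->
  iint F = iint G.
Proof.
elim: n j F G => [[]//|n IH] j F G mF mG F0 G0 FG.
(* The outermost variable is exchanged with all the others at once. *)
have iintS (H : n.+1.-tuple R -> \bar R) : measurable_fun setT H -> (forall t, 0 <= H t)%E ->
    iint H = (\int[@leb_tuple R n]_t \int[@lebesgue_measure R]_x H (cons_tuple x t))%E.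
  move=> mH H0 /=.
  transitivity (\int[@lebesgue_measure R]_x \int[@leb_tuple R n]_t H (cons_tuple x t))%E.
    apply: eq_integral => x _; rewrite iintE//; exact: measurable_cons_snd.
  have := @fubini_tonelli _ _ _ _ _ (@lebesgue_measure R) (@leb_tuple R n)
    (fun xt => H (cons_tuple xt.1 xt.2)).
  apply => //; exact: (measurableT_comp mH (@measurable_cons_pair R n)).
case: (unliftP ord0 j) => [k jk|j0].
  apply: eq_integral => x _; apply: (IH k) => //; try exact: measurable_cons_snd.
  have E (H : n.+1.-tuple R -> \bar R) s : (\int[@lebesgue_measure R]_y H (cons_tuple x (upd s k y)) =
      \int[@lebesgue_measure R]_y H (upd (cons_tuple x s) j y))%E.
    apply: eq_integral => y _; congr H; apply: eq_from_tnth => i.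
    rewrite tnth_mktuple jk; case: (unliftP ord0 i) => [i' ->|->]; rewrite ?tnthS.
      by rewrite tnth_mktuple (inj_eq lift_inj).
    by rewrite (negbTE (neq_lift _ _)).
  by move=> s; rewrite !E.
rewrite !iintS//; apply: eq_integral => t _.
have E (H : n.+1.-tuple R -> \bar R) : (\int[@lebesgue_measure R]_y H (cons_tuple y t) =
      \int[@lebesgue_measure R]_y H (upd (cons_tuple 0%R t) j y))%E.
  apply: eq_integral => y _; congr H; apply: eq_from_tnth => i.
  rewrite tnth_mktuple j0; case: (unliftP ord0 i) => [i' ->|->]; rewrite ?tnthS ?eqxx ?tnth0//.
by rewrite !E.
Qed.

Local Notation mu n := (@leb_tuple R n).

Lemma ge0_integral_line n (j : 'I_n) (F G : n.-tuple R -> \bar R) :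
  measurable_fun setT F -> measurable_fun setT G ->
  (forall t, 0 <= F t)%E -> (forall t, 0 <= G t)%E ->
  (forall s, \int[@lebesgue_measure R]_x F (upd s j x) =
             \int[@lebesgue_measure R]_x G (upd s j x))%E ->
  (\int[mu n]_t F t = \int[mu n]_t G t)%E.
Proof. by move=> mF mG F0 G0 FG; rewrite -!iintE//; exact: iint_line FG. Qed.

Lemma updK n (s : n.-tuple R) j x y : upd (upd s j x) j y = upd s j y.
Proof. by apply: eq_from_tnth => i; rewrite !tnth_mktuple; case: eqP. Qed.

(** On each line in direction [j] the map is affine with the same slope [a], since [b] ignores that
    coordinate. These are the elementary transformations from which dilations and reflections are
    assembled. *)
Lemma ge0_integral_upd_affine n (j : 'I_n) (a : R) (b : n.-tuple R -> R)
    (F : n.-tuple R -> \bar R) : a != 0 ->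
  measurable_fun setT b -> (forall s x, b (upd s j x) = b s) ->
  measurable_fun setT F -> (forall t, 0 <= F t)%E ->
  (`|a|%:E * \int[mu n]_t F (upd t j (a * tnth t j + b t)%R) = \int[mu n]_t F t)%E.
Proof.
move=> a0 mb bj mF F0.
have mT : measurable_fun setT (fun t => F (upd t j (a * tnth t j + b t))).
  apply: (measurableT_comp mF); apply: measurable_upd => //.
  apply: measurable_funD => //; apply: measurable_funM => //; exact: measurable_tnth.
rewrite -ge0_integralZl//.
apply: (@ge0_integral_line _ j) => //.
- exact: measurable_funeM.
- by move=> t; rewrite mule_ge0.
move=> s.
have mFs : measurable_fun setT (fun x => F (upd s j x)).
  by apply: (measurableT_comp mF); exact: measurable_upd.
rewrite -[RHS](@ge0_integral_affine _ a (b s))// ge0_integralZl//.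
  by congr (_ * _)%E; apply: eq_integral => x _; rewrite updK bj tnth_mktuple eqxx.
apply: (measurableT_comp mT); exact: measurable_upd.
Qed.

(* [P] lists the coordinates allowed to change, so that each step leaves every [b i] unchanged *)
Lemma ge0_integral_affine_seq n (P : pred 'I_n) (l : seq 'I_n) (a : R) (b : 'I_n -> n.-tuple R -> R)
    (F : n.-tuple R -> \bar R) : a != 0 -> uniq l -> {subset l <= P} ->
  (forall i, measurable_fun setT (b i)) ->
  (forall i s t, (forall k, ~~ P k -> tnth s k = tnth t k) -> b i s = b i t) ->
  measurable_fun setT F -> (forall t, 0 <= F t)%E ->
  ((`|a| ^+ size l)%:E *
    \int[mu n]_t F [tuple if i \in l then (a * tnth t i + b i t)%R else tnth t i | i < n]
   = \int[mu n]_t F t)%E.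
Proof.
move=> a0 + + mb bP mF F0; elim: l => [|j l IH] /=.
  move=> _ _; rewrite mul1e; apply: eq_integral => t _; congr F.
  by apply: eq_from_tnth => i; rewrite tnth_mktuple.
move=> /andP[jl ul] lP.
rewrite -[RHS]IH//; last by move=> i il; apply: lP; rewrite inE il orbT.
rewrite exprSr EFinM -muleA; congr (_ * _)%E.
rewrite -[RHS](@ge0_integral_upd_affine _ j a (b j))//.
- congr (_ * _)%E; apply: eq_integral => t _; congr F.
  apply: eq_from_tnth => i; rewrite !tnth_mktuple inE.
  case: (i =P j) => [->|_] /=; first by rewrite (negbTE jl).
  case: ifP => // il; congr (_ + _); apply: bP => k Pk.
  rewrite tnth_mktuple; case: eqP => // kj; move: Pk; rewrite kj.
  by have -> : P j by apply: lP; rewrite inE eqxx.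
- move=> s x; apply: bP => k Pk; rewrite tnth_mktuple; case: eqP => // kj; move: Pk; rewrite kj.
  by have -> : P j by apply: lP; rewrite inE eqxx.
apply: (measurableT_comp mF); apply/measurable_fun_tnthP => i.
rewrite (_ : _ \o _ = fun t => if i \in l then (a * tnth t i + b i t)%R else tnth t i); last first.
  by apply/funext => t /=; rewrite tnth_mktuple.
case: (i \in l); last exact: measurable_tnth.
apply: measurable_funD => //; apply: measurable_funM => //; exact: measurable_tnth.
Qed.

Lemma ge0_integral_scale n (r : R) (F : n.-tuple R -> \bar R) : r != 0 ->
  measurable_fun setT F -> (forall t, 0 <= F t)%E ->
  ((`|r| ^+ n)%:E * \int[mu n]_t F [tuple (r * tnth t i)%R | i < n] = \int[mu n]_t F t)%E.
Proof.
move=> r0 mF F0.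
rewrite -[RHS](@ge0_integral_affine_seq n xpredT (enum 'I_n) r (fun _ _ => 0))//.
- rewrite size_enum_ord; congr (_ * _)%E; apply: eq_integral => t _; congr F.
  by apply: eq_from_tnth => i; rewrite !tnth_mktuple mem_enum addr0.
- exact: enum_uniq.
Qed.
End line.

(** * Inner product, reflections and measurability on row vectors *)

Section integration.
Variables (R : realType) (d : nat).
Local Notation vec := 'rV[R]_d.
Local Notation mu := (@leb_tuple R d).
Local Notation row := (@row_of_tuple R d).
Implicit Types (F G : vec -> R) (a x y : vec) (r s : R).

(** The measure lives on tuples, so functions of row vectors are made measurable through
    [row_of_tuple]. *)
Definition row_meas F := measurable_fun setT (F \o row).

Lemma dotC x y : dot x y = dot y x.
Proof. by apply: eq_bigr => i _; rewrite mulrC. Qed.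
Lemma dotDr a x y : dot a (x + y) = dot a x + dot a y.
Proof. by rewrite /dot -big_split; apply: eq_bigr => i _; rewrite !mxE mulrDr. Qed.
Lemma dotZr r a x : dot a (r *: x) = r * dot a x.
Proof. by rewrite /dot mulr_sumr; apply: eq_bigr => i _; rewrite !mxE mulrCA. Qed.
Lemma dotNr a x : dot a (- x) = - dot a x.
Proof. by rewrite -scaleN1r dotZr mulN1r. Qed.
Lemma dotDl a x y : dot (x + y) a = dot x a + dot y a.
Proof. by rewrite !(dotC _ a) dotDr. Qed.
Lemma dotZl r a x : dot (r *: x) a = r * dot x a.
Proof. by rewrite !(dotC _ a) dotZr. Qed.
Lemma dotNl a x : dot (- x) a = - dot x a.
Proof. by rewrite !(dotC _ a) dotNr. Qed.
Lemma dot_ge0 x : 0 <= dot x x.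
Proof. by apply: sumr_ge0 => i _; exact: sqr_ge0. Qed.
Lemma dot_eq0 x : (dot x x == 0) = (x == 0).
Proof.
rewrite psumr_eq0 => [|i _]; last exact: sqr_ge0.
apply/allP/eqP => [h|-> i _]; last by rewrite /= mxE mulr0 eqxx.
apply/rowP => i; rewrite mxE; have := h i (mem_index_enum _).
by rewrite /= mulf_eq0 orbb => /eqP.
Qed.
Lemma dot_ebasis x i : dot x (ebasis R i) = x 0 i.
Proof.
rewrite /dot (bigD1 i)//= big1 => [|j ji]; rewrite !mxE ?eqxx ?mulr1 ?addr0//=.
by rewrite (negbTE ji) mulr0.
Qed.
Lemma dot_refl a x y : a != 0 -> dot (refl a x) (refl a y) = dot x y.
Proof.
rewrite -dot_eq0 => a0; rewrite /refl !(dotDl, dotDr, dotNl, dotNr, dotZl, dotZr).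
rewrite (dotC x a); field; exact: a0.
Qed.
Lemma enorm_refl a x : a != 0 -> enorm (refl a x) = enorm x.
Proof. by move=> a0; rewrite /enorm dot_refl. Qed.
Lemma dot_refl_self a x : a != 0 -> dot a (refl a x) = - dot a x.
Proof. by rewrite -dot_eq0 => a0; rewrite /refl dotDr dotNr dotZr; field; exact: a0. Qed.
Lemma reflK a : a != 0 -> involutive (refl a).
Proof.
move=> a0 x; rewrite {1}/refl dot_refl_self// /refl -addrA -opprD -scalerDl.
by rewrite mulrN mulNr subrr scale0r subr0.
Qed.
Lemma reflZ a r x : refl a (r *: x) = r *: refl a x.
Proof. by rewrite /refl dotZr scalerBr scalerA mulrCA !mulrA. Qed.
Lemma dot_reflC a x y : dot (refl a x) y = dot x (refl a y).
Proof. by rewrite /refl !(dotDl, dotDr, dotNl, dotNr, dotZl, dotZr) (dotC x a); ring. Qed.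

Lemma enorm_ge0 x : 0 <= enorm x.
Proof. exact: sqrtr_ge0. Qed.
Lemma enorm_eq0 x : (enorm x == 0) = (x == 0).
Proof.
by rewrite /enorm sqrtr_eq0 -dot_eq0; have := dot_ge0 x; case: ltgtP.
Qed.
Lemma sqr_enorm x : enorm x ^+ 2 = dot x x.
Proof. by rewrite sqr_sqrtr ?dot_ge0. Qed.
Lemma enormZ r x : enorm (r *: x) = `|r| * enorm x.
Proof. by rewrite /enorm dotZl dotZr mulrA -expr2 sqrtrM ?sqr_ge0// sqrtr_sqr. Qed.
Lemma enorm0 : enorm (0 : vec) = 0.
Proof. by apply/eqP; rewrite enorm_eq0. Qed.
Lemma enorm_coord x i : `|x 0 i| <= enorm x.
Proof.
rewrite -sqrtr_sqr; apply: ler_wsqrtr; rewrite /dot (bigD1 i)//= -expr2 lerDl.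
by apply: sumr_ge0 => j _; exact: sqr_ge0.
Qed.

(** The radial projection onto the sphere. It sends 0 to 0 because [0^-1 = 0], whence the inequality
    in [enorm_unitv]. *)
Definition unitv x := (enorm x)^-1 *: x.

Lemma unitvK x : enorm x *: unitv x = x.
Proof.
have [->|x0] := eqVneq x 0; first by rewrite /unitv !scaler0.
by rewrite scalerA mulfV ?scale1r// enorm_eq0.
Qed.
Lemma enorm_unitv x : enorm (unitv x) <= 1.
Proof.
have [->|x0] := eqVneq x 0; first by rewrite /unitv scaler0 enorm0.
by rewrite enormZ ger0_norm ?invr_ge0 ?enorm_ge0// mulVf// enorm_eq0.
Qed.
Lemma unitvZ r x : 0 < r -> unitv (r *: x) = unitv x.
Proof.
move=> r0; rewrite /unitv enormZ gtr0_norm// scalerA invfM -mulrA.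
by rewrite (mulrC _ r) mulrA mulVf ?mul1r// gt_eqF.
Qed.
Lemma unitv_refl a x : a != 0 -> unitv (refl a x) = refl a (unitv x).
Proof. by move=> a0; rewrite /unitv enorm_refl// reflZ. Qed.
Lemma unitvN x : unitv (- x) = - unitv x.
Proof. by rewrite /unitv -scaleN1r enormZ normrN1 mul1r scalerA mulrC -scalerA scaleN1r. Qed.

Lemma row_meas_coord i : row_meas (fun x => x 0 i).
Proof.
rewrite /row_meas (_ : _ \o _ = fun t => tnth t i); first exact: measurable_tnth.
by apply/funext => t /=; rewrite mxE.
Qed.
Lemma row_meas_cst c : row_meas (fun _ => c).
Proof. exact: measurable_cst. Qed.
Lemma row_measD F G : row_meas F -> row_meas G -> row_meas (fun x => F x + G x).
Proof. exact: measurable_funD. Qed.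
Lemma row_measM F G : row_meas F -> row_meas G -> row_meas (fun x => F x * G x).
Proof. exact: measurable_funM. Qed.
Lemma row_measN F : row_meas F -> row_meas (fun x => - F x).
Proof. exact: measurable_funN. Qed.
Lemma row_meas_sum I (l : seq I) (P : pred I) (F : I -> vec -> R) : (forall i, row_meas (F i)) ->
  row_meas (fun x => \sum_(i <- l | P i) F i x).
Proof.
move=> mF; elim: l => [|i l IH].
  rewrite (_ : (fun x => _) = fun _ => 0); first exact: row_meas_cst.
  by apply/funext => x; rewrite big_nil.
case Pi : (P i).
  rewrite (_ : (fun x => _) = (fun x => F i x + \sum_(j <- l | P j) F j x)); first exact: row_measD.
  by apply/funext => x; rewrite big_cons Pi.
rewrite (_ : (fun x => _) = (fun x => \sum_(j <- l | P j) F j x))//.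
by apply/funext => x; rewrite big_cons Pi.
Qed.
Lemma row_meas_comp (f : R -> R) F : measurable_fun setT f -> row_meas F -> row_meas (f \o F).
Proof. by move=> mf mF; exact: (measurableT_comp mf mF). Qed.
Lemma row_meas_dot a : row_meas (dot a).
Proof. by apply: row_meas_sum => i; apply: row_measM; [exact: row_meas_cst|exact: row_meas_coord]. Qed.
Lemma row_meas_enorm : row_meas (@enorm R d).
Proof.
apply: (row_meas_comp (f := Num.sqrt)); first by apply: continuous_measurable_fun; exact: sqrt_continuous.
by apply: row_meas_sum => i; apply: row_measM; exact: row_meas_coord.
Qed.

Lemma measurable_row_comp dd (T : measurableType dd) (S : T -> vec) (H : vec -> \bar R) :
  (forall i, measurable_fun setT (fun t => S t 0 i)) ->
  measurable_fun setT (H \o row) -> measurable_fun setT (H \o S).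
Proof.
move=> mS mH; pose U t : d.-tuple R := [tuple S t 0 i | i < d].
rewrite (_ : H \o S = (H \o row) \o U).
  apply: (measurableT_comp mH); apply/measurable_fun_tnthP => i.
  by rewrite (_ : _ \o _ = fun t => S t 0 i)//; apply/funext => t /=; rewrite tnth_mktuple.
apply/funext => t /=; congr H; apply/rowP => i; by rewrite mxE tnth_mktuple.
Qed.

Lemma measurable_row_compr dd (T : measurableType dd) (S : T -> vec) F :
  (forall i, measurable_fun setT (fun t => S t 0 i)) ->
  row_meas F -> measurable_fun setT (F \o S).
Proof.
move=> mS mF; apply/measurable_EFinP.
by apply: (@measurable_row_comp _ _ S (EFin \o F)) => //; exact/measurable_EFinP.
Qed.

Lemma row_meas_comp_vec F (S : vec -> vec) : (forall i, row_meas (fun x => S x 0 i)) ->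
  row_meas F -> row_meas (F \o S).
Proof. by move=> mS mF; apply: (@measurable_row_compr _ _ (S \o row)). Qed.

Lemma row_meas_refl a F : row_meas F -> row_meas (F \o refl a).
Proof.
apply: row_meas_comp_vec => i; rewrite (_ : (fun x => _) =
  fun x => x 0 i + - ((2 * dot a x) / dot a a * a 0 i)); last first.
  by apply/funext => x; rewrite !mxE.
apply: row_measD; first exact: row_meas_coord.
apply: row_measN; apply: row_measM; last exact: row_meas_cst.
apply: row_measM; last exact: row_meas_cst.
apply: row_measM; [exact: row_meas_cst|exact: row_meas_dot].
Qed.

Lemma row_meas_unitv F : row_meas F -> row_meas (F \o unitv).
Proof.
apply: row_meas_comp_vec => i; rewrite (_ : (fun x => _) = fun x => (enorm x)^-1 * x 0 i).
  apply: row_measM; last exact: row_meas_coord.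
  (* The inverse is written as a real power, whose measurability is available; the two agree since
     norms are nonnegative. *)
  rewrite (_ : (fun x => _) = (@powR R ^~ (-1)) \o @enorm R d); last first.
    by apply/funext => x /=; rewrite powR_inv1// enorm_ge0.
  by apply: row_meas_comp; [exact: measurable_powR|exact: row_meas_enorm].
by apply/funext => x; rewrite mxE.
Qed.

Lemma row_meas_upd F (t : d.-tuple R) j : row_meas F ->
  measurable_fun setT (fun x : R => F (row (upd t j x))).
Proof.
move=> mF; pose S (x : R) := row (upd t j x).
suff: measurable_fun setT (F \o S) by []; apply: measurable_row_compr => // i; rewrite /S.
rewrite (_ : (fun u => _) = fun u : R => if i == j then u else tnth t i); last first.
  by apply/funext => u; rewrite mxE tnth_mktuple.
by case: (i == j).
Qed.

End integration.

(** * Integrals of powers and reflection invariance *)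

Section powers.
Variable R : realType.

Lemma integral_is_derive (F f : R -> R) (a b : R) : a < b ->
  (forall x, x \in `]a, b[ -> is_derive x 1 F (f x)) ->
  {within `[a, b], continuous F} -> {within `[a, b], continuous f} ->
  (\int[@lebesgue_measure R]_(x in `[a, b]) (f x)%:E = (F b - F a)%:E)%E.
Proof.
move=> ab dF cF cf; rewrite EFinB; apply: continuous_FTC2 => //.
- have [_ Fa Fb] := (continuous_within_itvP F ab).1 cF.
  by split=> // x xab; have [] := dF x xab.
- by move=> x xab; rewrite derive1E; have [_ ->] := dF x xab.
Qed.

Lemma continuous_powR (c r : R) : 0 < r -> {for r, continuous (@powR R ^~ c)}.
Proof.
move=> r0; apply: differentiable_continuous; apply/derivable1_diffP.
by apply: derivable_powR; rewrite in_itv/= r0.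
Qed.

Lemma continuous_within_powR (c a b : R) : 0 < a \/ 0 <= a /\ 0 < c ->
  a < b -> {within `[a, b], continuous (@powR R ^~ c)}.
Proof.
move=> ac ab; apply/continuous_within_itvP => //; split.
- move=> x; rewrite in_itv/= => /andP[ax xb]; apply: continuous_powR.
  by case: ac => [/lt_trans|[/le_lt_trans + _]]; apply.
- case: ac => [a0|[]]; first exact/cvg_at_right_filter/continuous_powR.
  rewrite le_eqVlt => /predU1P[<-|a0 _]; last exact/cvg_at_right_filter/continuous_powR.
  by move=> c0; rewrite powR0 ?gt_eqF//; exact: powR_cvg0.
- apply/cvg_at_left_filter/continuous_powR.
  by case: ac => [/lt_trans|[/le_lt_trans + _]]; apply.
Qed.

Lemma integral_powR_ge (t a : R) : 0 < t -> 0 < a -> a <= 1 ->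
  (\int[@lebesgue_measure R]_(r in `[a, 1%R]) (t * r `^ (t - 1))%:E = (1 - a `^ t)%:E)%E.
Proof.
move=> t0 a0; rewrite le_eqVlt => /predU1P[->|a1].
  by rewrite powR1 subrr set_itv1 integral_set1.
have dF (x : R) : x \in `]a, 1[ -> is_derive x 1 (@powR R ^~ t) (t * x `^ (t - 1)).
  by rewrite in_itv/= => /andP[ax _]; apply: is_derive1_powR; exact: lt_trans ax.
rewrite (integral_is_derive a1 dF) ?powR1//.
- by apply: continuous_within_powR => //; left.
- move=> /= x; apply: (@continuousM _ (subspace `[a, 1]) (fun=> t) (@powR R ^~ (t - 1))); first exact: cvg_cst.
  by apply: continuous_within_powR => //; left.
Qed.

(** The condition [1 <= c] keeps the integrand continuous up to 0. In [integral_powR_ge] the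
    exponent may be negative, and there the interval stays away from 0 instead. *)
Lemma integral_powR01 (c : R) : 1 <= c ->
  (\int[@lebesgue_measure R]_(r in `[0%R, 1%R]) (c * r `^ (c - 1))%:E = 1)%E.
Proof.
move=> c1; have c0 : 0 < c by lra.
have dF (x : R) : x \in `]0, 1[ -> is_derive x 1 (@powR R ^~ c) (c * x `^ (c - 1)).
  by rewrite in_itv/= => /andP[x0 _]; exact: is_derive1_powR.
rewrite (integral_is_derive ltr01 dF) ?powR1 ?powR0 ?gt_eqF ?subr0//.
- by apply: continuous_within_powR => //; right.
- move: c1; rewrite le_eqVlt => /predU1P[<-|c1].
    apply: continuous_subspaceT => x; rewrite subrr.
    rewrite (_ : (fun x => _) = cst 1); first exact: cvg_cst.
    by apply/funext => y; rewrite powRr0 mulr1.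
  move=> /= x; apply: (@continuousM _ (subspace `[(0 : R), 1]) (fun=> c) (@powR R ^~ (c - 1))); first exact: cvg_cst.
  by apply: continuous_within_powR => //; right; rewrite subr_gt0.
Qed.
End powers.

Section integral2.
Variables (R : realType) (d : nat).
Local Notation vec := 'rV[R]_d.
Local Notation mu := (@leb_tuple R d).
Local Notation row := (@row_of_tuple R d).
Implicit Types (F G : vec -> R) (a x y : vec) (r s : R).

(** Choose [j] with [a 0 j != 0] and take [s = <a,x>] as the [j]-th coordinate. In these coordinates
    the reflection is a shear of the other coordinates by multiples of [s] followed by [s -> -s],
    and both preserve the measure. The change of coordinates has Jacobian [a 0 j] on both sides. *)
Lemma ge0_integral_refl a (H : vec -> \bar R) : a != 0 ->
  measurable_fun setT (H \o row) -> (forall x, 0 <= H x)%E ->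
  (\int[mu]_t H (refl a (row t)) = \int[mu]_t H (row t))%E.
Proof.
move=> a0 mH H0.
have [j aj] : exists j, a 0 j != 0.
  apply/existsP; move: a0; apply: contraR => /existsPn h.
  by apply/eqP/rowP => i; rewrite mxE; apply/eqP/negPn/h.
have aa0 : dot a a != 0 by rewrite dot_eq0.
pose b (t : d.-tuple R) := dot a (row t) - a 0 j * tnth t j.
pose H' (t : d.-tuple R) := H (row (upd t j ((tnth t j - b t) / a 0 j))).
have bj (s : d.-tuple R) (x : R) : b (upd s j x) = b s.
  rewrite /b /dot (bigD1 j)//= [in RHS](bigD1 j)//= !mxE !tnth_mktuple eqxx.
  rewrite !(addrC (a 0 j * _)) !addrK; apply: eq_bigr => i ij.
  by rewrite !mxE tnth_mktuple (negbTE ij).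
have mb : measurable_fun setT b.
  apply: measurable_funB; first exact: row_meas_dot.
  by apply: measurable_funM => //; exact: measurable_tnth.
have mH' : measurable_fun setT H'.
  apply: (measurableT_comp mH); apply: measurable_upd => //.
  apply: measurable_funM => //; apply: measurable_funB => //; exact: measurable_tnth.
have H'0 t : (0 <= H' t)%E by exact: H0.
(* [S] replaces coordinate [j] by [<a,x>]; [H'] is [H] read in the new coordinates. *)
pose S t := upd t j (a 0 j * tnth t j + b t).
have SE t : S t = upd t j (dot a (row t)) by rewrite /S /b addrCA subrr addr0.
have HS t : H' (S t) = H (row t).
  rewrite /H' /S bj tnth_mktuple eqxx addrK mulrC mulfK// updK.
  by congr (H (row _)); apply: eq_from_tnth => i; rewrite tnth_mktuple; case: eqP => [->|].
pose c i := 2 * a 0 i / dot a a.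
pose P (t : d.-tuple R) := [tuple if i != j then 1 * tnth t i + - (c i * tnth t j) else tnth t i | i < d].
pose fl (t : d.-tuple R) := upd t j (- 1 * tnth t j + 0).
(* In the new coordinates the reflection is the shear [P] followed by the sign change [fl]. *)
have key t : H (refl a (row t)) = H' (fl (P (S t))).
  have -> : refl a (row t) = row [tuple (refl a (row t)) 0 i | i < d].
    by apply/rowP => i; rewrite [RHS]mxE tnth_mktuple.
  rewrite -HS; congr H'.
  rewrite SE.
  have -> : row [tuple (refl a (row t)) 0 i | i < d] = refl a (row t).
    by apply/rowP => i; rewrite [LHS]mxE tnth_mktuple.
  rewrite dot_refl_self//; apply: eq_from_tnth => i; rewrite SE !tnth_mktuple.
  case: (i =P j) => [_|ij] /=; first by rewrite ?tnth_mktuple !eqxx/= ?tnth_mktuple ?eqxx addr0 mulN1r.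
  rewrite eqxx !mxE mul1r /c; congr (_ - _); ring.
have mfl : measurable_fun setT fl.
  apply: measurable_upd => //; apply: measurable_funD => //.
  by apply: measurable_funM => //; exact: measurable_tnth.
have mP : measurable_fun setT P.
  apply/measurable_fun_tnthP => i.
  rewrite (_ : _ \o _ = fun t => if i != j then 1 * tnth t i + - (c i * tnth t j) else tnth t i).
    case: (i != j); last exact: measurable_tnth.
    apply: measurable_funD; first by apply: measurable_funM => //; exact: measurable_tnth.
    by apply/measurable_funN/measurable_funM => //; exact: measurable_tnth.
  by apply/funext => t /=; rewrite tnth_mktuple.
have mu_S (K : d.-tuple R -> \bar R) : measurable_fun setT K -> (forall t, 0 <= K t)%E ->
    (`|a 0 j|%:E * \int[mu]_t K (S t) = \int[mu]_t K t)%E.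
  by move=> mK K0; exact: ge0_integral_upd_affine.
have N0 : (`|a 0 j|%:E != 0)%E by rewrite eqe normr_eq0.
(* Both integrals are multiplied by the Jacobian so that [mu_S] can pass to the new coordinates on
   either side. *)
suff : (`|a 0 j|%:E * \int[mu]_t H (refl a (row t)) = `|a 0 j|%:E * \int[mu]_t H (row t))%E.
  move/(congr1 (fun z => `|a 0 j|^-1%:E * z)%E).
  by rewrite !muleA -!EFinM mulVf ?normr_eq0// !mul1e.
under eq_integral do rewrite key.
under [in RHS]eq_integral do rewrite -HS.
rewrite (mu_S (H' \o fl \o P)); first last.
- by move=> t; exact: H'0.
- exact: (measurableT_comp (measurableT_comp mH' mfl) mP).
rewrite (mu_S H')//.
have := @ge0_integral_affine_seq R d [pred i | i != j] (enum [pred i | i != j]) 1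
  (fun i t => - (c i * tnth t j)) (H' \o fl) (oner_neq0 _) (enum_uniq _).
rewrite normr1 expr1n mul1e => /= pP.
transitivity (\int[mu]_t H' (fl t))%E.
  rewrite -pP//.
  - by apply: eq_integral => t _; congr (H' (fl _)); apply: eq_from_tnth => i; rewrite !tnth_mktuple mem_enum.
  - by move=> i; rewrite mem_enum.
  - by move=> i; apply/measurable_funN/measurable_funM => //; exact: measurable_tnth.
  - by move=> i s t st; rewrite st// negbK.
  - exact: measurableT_comp.
have := @ge0_integral_upd_affine R d j (-1) (fun _ => 0) H'.
by rewrite oppr_eq0 oner_eq0 normrN1 mul1e; apply.
Qed.
End integral2.

(** * Integration over the unit ball *)

Section ball.
Variables (R : realType) (d : nat).
Local Notation vec := 'rV[R]_d.
Local Notation mu := (@leb_tuple R d).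
Local Notation row := (@row_of_tuple R d).
Implicit Types (F G : vec -> R) (a x y : vec) (r s : R).

(** Measurability is global but the bound concerns the ball alone, so every polynomial qualifies and
    all ball integrals below are finite. *)
Definition ball_bdd F := row_meas F /\ exists C, forall x, enorm x <= 1 -> `|F x| <= C.
Definition cut F x := if enorm x <= 1 then F x else 0.
Definition ball_int F : R := (\int[mu]_t cut F (row t))%R.

Lemma ball_bdd_cst c : ball_bdd (fun _ => c).
Proof. by split; [exact: row_meas_cst|exists `|c|]. Qed.
Lemma ball_bddD F G : ball_bdd F -> ball_bdd G -> ball_bdd (fun x => F x + G x).
Proof.
move=> [mF [C FC]] [mG [D GD]]; split; first exact: row_measD.
by exists (C + D) => x x1; rewrite (le_trans (ler_normD _ _))// lerD ?FC ?GD.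
Qed.
Lemma ball_bddM F G : ball_bdd F -> ball_bdd G -> ball_bdd (fun x => F x * G x).
Proof.
move=> [mF [C FC]] [mG [D GD]]; split; first exact: row_measM.
by exists (C * D) => x x1; rewrite normrM ler_pM ?FC ?GD.
Qed.
Lemma ball_bddZ c F : ball_bdd F -> ball_bdd (fun x => c * F x).
Proof. by apply: ball_bddM; exact: ball_bdd_cst. Qed.
Lemma ball_bdd_ext F G : F =1 G -> ball_bdd F -> ball_bdd G.
Proof. by move=> /funext ->. Qed.
Lemma ball_bddN F : ball_bdd F -> ball_bdd (fun x => - F x).
Proof. by move=> /(ball_bddZ (-1)); apply: ball_bdd_ext => x; rewrite mulN1r. Qed.
Lemma ball_bdd_sum I (l : seq I) (F : I -> vec -> R) : (forall i, ball_bdd (F i)) ->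
  ball_bdd (fun x => \sum_(i <- l) F i x).
Proof.
move=> bF; elim: l => [|i l IH].
  by apply: ball_bdd_ext (ball_bdd_cst 0) => x; rewrite big_nil.
by apply: ball_bdd_ext (ball_bddD (bF i) IH) => x; rewrite big_cons.
Qed.
Lemma ball_bdd_refl a F : a != 0 -> ball_bdd F -> ball_bdd (F \o refl a).
Proof.
move=> a0 [mF [C FC]]; split; first exact: row_meas_refl.
by exists C => x x1; apply: FC; rewrite enorm_refl.
Qed.
Lemma ball_bdd_unitv F : ball_bdd F -> ball_bdd (F \o @unitv R d).
Proof.
move=> [mF [C FC]]; split; first exact: row_meas_unitv.
by exists C => x x1; apply: FC; exact: enorm_unitv.
Qed.
Lemma ball_bdd_enorm : ball_bdd (@enorm R d).
Proof. by split; [exact: row_meas_enorm|exists 1 => x x1; rewrite ger0_norm ?enorm_ge0]. Qed.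
Lemma ball_bdd_powR_enorm s : 0 <= s -> ball_bdd (fun x => enorm x `^ s).
Proof.
move=> s0; split.
  by apply: (row_meas_comp (f := @powR R ^~ s)); [exact: measurable_powR|exact: row_meas_enorm].
exists 1 => x x1; rewrite ger0_norm ?powR_ge0//.
have /= := ge0_ler_powR s0 (x := enorm x) (y := 1).
by rewrite powR1; apply; rewrite ?nnegrE ?enorm_ge0.
Qed.
Lemma ball_bdd_coord i : ball_bdd (fun x => x 0 i).
Proof.
split; first exact: row_meas_coord.
by exists 1 => x; exact: (le_trans (enorm_coord _ _)).
Qed.
Lemma ball_bdd_dot a : ball_bdd (dot a).
Proof. by apply: ball_bdd_sum => i; apply: ball_bddM; [exact: ball_bdd_cst|exact: ball_bdd_coord]. Qed.

Lemma cut_out F x : 1 < enorm x -> cut F x = 0.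
Proof. by rewrite /cut leNgt => ->. Qed.

Lemma row_meas_cut F : row_meas F -> row_meas (cut F).
Proof.
move=> mF; apply: (@measurable_fun_ifT _ _ _ _ (F \o row) (fun=> 0) (fun t => enorm (row t) <= 1)) => //.
apply: measurable_fun_ler => //; exact: row_meas_enorm.
Qed.

Lemma cut_le F C : (forall x, enorm x <= 1 -> `|F x| <= C) -> forall x, `|cut F x| <= `|C|.
Proof.
move=> FC x; rewrite /cut; case: ifPn => [/FC /le_trans|_]; last by rewrite normr0.
by apply; exact: ler_norm.
Qed.

Lemma cut_cube F t : ~ cube d 1 t -> cut F (row t) = 0.
Proof.
move=> h; apply: cut_out; rewrite ltNge; apply/negP => t1; apply: h => i.
by apply: le_trans t1; have := enorm_coord (row t) i; rewrite mxE.
Qed.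

Lemma integrable_cst_cube c : mu.-integrable setT (EFin \o ((fun _ => c) \_ (cube d 1))).
Proof.
rewrite -restrict_EFin.
have mc : measurable (cube d (1 : R)) := @measurable_cube R d 1.
have [+ _] := @integrable_mkcond _ _ _ mu _ (EFin \o (fun _ => c)) mc; apply.
apply: measurable_bounded_integrable => //; [exact: leb_tuple_cube|exact: bounded_cst].
Qed.

Lemma ball_bdd_integrable F : ball_bdd F -> mu.-integrable setT (EFin \o (cut F \o row)).
Proof.
move=> [mF [C FC]].
apply: (le_integrable measurableT _ _ (integrable_cst_cube `|C|)).
  by apply/measurable_EFinP; exact: row_meas_cut.
move=> t _; rewrite /= lee_fin patchE; case: ifPn => [_|].
  by rewrite normr_id; exact: cut_le.
by rewrite notin_setE => tc; rewrite cut_cube.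
Qed.

Lemma ball_int_ext F G : (forall x, enorm x <= 1 -> F x = G x) -> ball_int F = ball_int G.
Proof.
move=> FG; rewrite /ball_int; congr Rintegral; apply/funext => t.
by rewrite /cut; case: ifP => // /FG.
Qed.

Lemma ball_intD F G : ball_bdd F -> ball_bdd G -> ball_int (fun x => F x + G x) = ball_int F + ball_int G.
Proof.
move=> bF bG; rewrite /ball_int -RintegralD//; [|exact: ball_bdd_integrable..].
by congr Rintegral; apply/funext => t; rewrite /cut; case: ifP; rewrite ?addr0.
Qed.
Lemma ball_intZ c F : ball_bdd F -> ball_int (fun x => c * F x) = c * ball_int F.
Proof.
move=> bF; rewrite /ball_int -RintegralZl//; last exact: ball_bdd_integrable.
by congr Rintegral; apply/funext => t; rewrite /cut; case: ifP; rewrite ?mulr0.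
Qed.
Lemma ball_int0 : ball_int (fun _ => 0) = 0.
Proof.
rewrite -[RHS](mul0r (ball_int (fun _ => 0))) -ball_intZ; last exact: ball_bdd_cst.
by apply: ball_int_ext => x _; rewrite mul0r.
Qed.
Lemma ball_intB F G : ball_bdd F -> ball_bdd G -> ball_int (fun x => F x - G x) = ball_int F - ball_int G.
Proof.
move=> bF bG; rewrite ball_intD//; last exact: ball_bddN.
rewrite -mulN1r -ball_intZ//; congr (_ + _); apply: ball_int_ext => x _; by rewrite mulN1r.
Qed.
Lemma ball_int_sum I (l : seq I) (F : I -> vec -> R) : (forall i, ball_bdd (F i)) ->
  ball_int (fun x => \sum_(i <- l) F i x) = \sum_(i <- l) ball_int (F i).
Proof.
move=> bF; elim: l => [|i l IH].
  by rewrite big_nil -[RHS]ball_int0; apply: ball_int_ext => x _; rewrite big_nil.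
rewrite big_cons -IH -ball_intD//; last exact: ball_bdd_sum.
by apply: ball_int_ext => x _; rewrite big_cons.
Qed.

Lemma ball_intE F : ball_int F = fine ((\int[mu]_t (Num.max (cut F (row t)) 0)%:E)
  - \int[mu]_t (Num.max (- cut F (row t)) 0)%:E)%E.
Proof.
rewrite /ball_int /Rintegral integralE; congr (fine (_ - _)); apply: eq_integral => t _.
  by rewrite funeposE -fine_max.
by rewrite funenegE -fine_max.
Qed.

Lemma cut_pos_measurable F : ball_bdd F ->
  measurable_fun setT ((fun x => (Num.max (cut F x) 0)%:E) \o row).
Proof.
move=> [mF _]; apply/measurable_EFinP; apply: measurable_maxr => //; exact: row_meas_cut.
Qed.

(** Invariance for nonnegative functions passes to signed ones through positive and negative parts;
    preservation of the norm lets [cut] commute with [T]. *)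
Lemma ball_int_map F (T : vec -> vec) : ball_bdd F ->
  (forall H : vec -> \bar R, measurable_fun setT (H \o row) -> (forall x, 0 <= H x)%E ->
     (\int[mu]_t H (T (row t)) = \int[mu]_t H (row t))%E) ->
  (forall x, enorm (T x) = enorm x) -> ball_int (F \o T) = ball_int F.
Proof.
move=> bF hT eT; rewrite !ball_intE; congr (fine (_ - _)).
- rewrite -(hT (fun x => (Num.max (cut F x) 0)%:E)).
  + by apply: eq_integral => t _; rewrite /cut eT.
  + exact: cut_pos_measurable.
  + by move=> x; rewrite lee_fin le_max lexx orbT.
- rewrite -(hT (fun x => (Num.max (- cut F x) 0)%:E)).
  + by apply: eq_integral => t _; rewrite /cut eT.
  + have := cut_pos_measurable (ball_bddN bF); congr measurable_fun; apply/funext => t /=.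
    by rewrite /cut; case: ifP; rewrite ?oppr0.
  + by move=> x; rewrite lee_fin le_max lexx orbT.
Qed.

Lemma ball_int_refl a F : a != 0 -> ball_bdd F -> ball_int (F \o refl a) = ball_int F.
Proof.
move=> a0 bF; apply: ball_int_map => //; first by move=> H mH H0; exact: ge0_integral_refl.
by move=> x; rewrite enorm_refl.
Qed.

Lemma ball_int_opp F : ball_bdd F -> ball_int (fun x => F (- x)) = ball_int F.
Proof.
move=> bF; apply: ball_int_map => //; last by move=> x; rewrite -scaleN1r enormZ normrN1 mul1r.
move=> H mH H0; have := @ge0_integral_scale R d (-1) (H \o row).
rewrite oppr_eq0 oner_eq0 normrN1 expr1n mul1e => /(_ isT mH (fun t => H0 _)) <-.
apply: eq_integral => t _ /=; congr H; apply/rowP => i.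
by rewrite !mxE tnth_mktuple mulN1r.
Qed.

(** A signed form of Fubini: on each line the positive and negative parts have equal integrals, so
    their total integrals agree by [ge0_integral_line], and both are finite. *)
Lemma ball_int_line0 F (j : 'I_d) : ball_bdd F ->
  (forall t, \int[@lebesgue_measure R]_x (cut F (row (upd t j x)))%:E = 0)%E -> ball_int F = 0.
Proof.
move=> bF F0; rewrite ball_intE.
have pos G : ball_bdd G -> measurable_fun setT (fun t => (Num.max (cut G (row t)) 0)%:E).
  exact: cut_pos_measurable.
have cutN x : - cut F x = cut (fun x => - F x) x.
  by rewrite /cut; case: ifP; rewrite ?oppr0.
under [X in (_ - X)%E]eq_integral do rewrite cutN.
rewrite (@ge0_integral_line _ _ j (fun t => (Num.max (cut F (row t)) 0)%:E)
   (fun t => (Num.max (cut (fun x => - F x) (row t)) 0)%:E)).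
- rewrite subee// ge0_fin_numE; last first.
    by apply: integral_ge0 => t _; rewrite lee_fin le_max lexx orbT.
  have /integrableP[_] := ball_bdd_integrable (ball_bddN bF); apply: le_lt_trans.
  apply: ge0_le_integral => //=.
  + by move=> t _; rewrite lee_fin le_max lexx orbT.
  + by apply: pos; exact: ball_bddN.
  + by have /integrable_abse/integrableP[] := ball_bdd_integrable (ball_bddN bF).
  + by move=> t _; rewrite lee_fin ge_max ler_norm normr_ge0.
- exact: pos.
- by apply: pos; exact: ball_bddN.
- by move=> t; rewrite lee_fin le_max lexx orbT.
- by move=> t; rewrite lee_fin le_max lexx orbT.
move=> t; have := F0 t; rewrite integralE.
set P := (X in (X - _)%E); set N := (X in (_ - X)%E).
have -> : P = (\int[@lebesgue_measure R]_x (Num.max (cut F (row (upd t j x))) 0)%:E)%E.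
  by apply: eq_integral => x _; rewrite funeposE -fine_max.
have -> : N = (\int[@lebesgue_measure R]_x (Num.max (cut (fun x => - F x) (row (upd t j x))) 0)%:E)%E.
  by apply: eq_integral => z _; rewrite -cutN funenegE -fine_max.
set P' := (X in (X - _)%E); set N' := (X in (_ - X)%E) => PN.
(* From [P' - N' = 0] in the extended reals one gets [P' = N'] only when [N'] is finite; it is,
   since the line meets the ball within [[-1, 1]]. *)
have Nfin : N' \is a fin_num.
  rewrite ge0_fin_numE; last by apply: integral_ge0 => x _; rewrite lee_fin le_max lexx orbT.
  have [mF [C FC]] := ball_bddN bF.
  have mFj : measurable_fun setT (fun u : R => Num.max (cut (fun x => - F x) (row (upd t j u))) 0).
    by apply: measurable_maxr => //; apply: row_meas_upd; exact: row_meas_cut.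
  apply: (@le_lt_trans _ _ (\int[@lebesgue_measure R]_(x in `[(-1)%R, 1%R]) (`|C|)%:E)%E); last first.
    rewrite integral_cst//= lebesgue_measure_itv/= lte_fin ifT; last lra.
    by rewrite -EFinD -EFinM ltry.
  rewrite [leRHS]integral_mkcond; apply: ge0_le_integral => //.
  + by move=> x _; rewrite lee_fin le_max lexx orbT.
  + exact/measurable_EFinP.
  + by apply/(measurable_restrictT _ _).1 => //; exact: measurable_cst.
  move=> x _; rewrite patchE; case: ifPn => [_|].
    rewrite lee_fin ge_max normr_ge0 andbT.
    exact: (le_trans (ler_norm _) (cut_le FC _)).
  rewrite notin_setE/= in_itv/= => /negP; rewrite -ler_norml -ltNge => x1.
  rewrite cut_out ?maxxx//; apply: lt_le_trans x1 _.
  by have := enorm_coord (row (upd t j x)) j; rewrite mxE tnth_mktuple eqxx.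
by rewrite -[LHS](@subeK _ _ N')// PN add0e.
Qed.

End ball.

(** * Sphere integrals, passage to the limit and null sets *)

Section ball2.
Variables (R : realType) (d : nat).
Local Notation vec := 'rV[R]_d.
Local Notation mu := (@leb_tuple R d).
Local Notation row := (@row_of_tuple R d).
Implicit Types (F G : vec -> R) (a : vec).

(** [leb_int] subtracts two values of [fine], whereas [ball_int] is [fine] of a difference; they
    agree because both parts are finite. *)
Lemma sphere_intE F : ball_bdd F -> sphere_int F = d%:R * ball_int (F \o @unitv R d).
Proof.
move=> bF; rewrite /sphere_int; congr (_ * _).
have bU := ball_bdd_unitv bF; pose U := F \o @unitv R d.
rewrite -[LHS]/(leb_int (cut U)) /leb_int ball_intE.
have cutN x : - cut U x = cut (fun x => - U x) x.
  by rewrite /cut; case: ifP; rewrite ?oppr0.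
have fin (G : vec -> R) : ball_bdd G -> (\int[mu]_t (Num.max (cut G (row t)) 0)%:E)%E \is a fin_num.
  move=> bG; rewrite ge0_fin_numE; last first.
    by apply: integral_ge0 => t _; rewrite lee_fin le_max lexx orbT.
  have /integrableP[_] := ball_bdd_integrable bG; apply: le_lt_trans.
  apply: ge0_le_integral => //=.
  + by move=> t _; rewrite lee_fin le_max lexx orbT.
  + exact: cut_pos_measurable.
  + by have /integrable_abse/integrableP[] := ball_bdd_integrable bG.
  + by move=> t _; rewrite lee_fin ge_max ler_norm normr_ge0.
have ge (G : vec -> R) t : (0%:E <= (Num.max (cut G (row t)) 0)%:E)%E.
  by rewrite lee_fin le_max lexx orbT.
rewrite fineB; first congr (fine _ - fine _).
- by rewrite iintE//; exact: cut_pos_measurable.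
- rewrite -[LHS]/(iint (fun t => (Num.max (- cut U (row t)) 0)%:E)).
  under eq_fun do rewrite cutN.
  by rewrite iintE//; apply: cut_pos_measurable; exact: ball_bddN.
- exact: fin.
- under eq_integral do rewrite cutN.
  by apply: fin; exact: ball_bddN.
Qed.

Lemma ball_int_lim0 (Fn : nat -> vec -> R) F (C : R) : (forall n, ball_bdd (Fn n)) -> ball_bdd F ->
  (forall n x, enorm x <= 1 -> `|Fn n x| <= C) ->
  (forall x, enorm x <= 1 -> Fn n x @[n --> \oo] --> F x) ->
  (forall n, ball_int (Fn n) = 0) -> ball_int F = 0.
Proof.
move=> bFn bF FnC FnF Fn0.
have mcut G : ball_bdd G -> measurable_fun setT (EFin \o (cut G \o row)).
  by move=> [mG _]; apply/measurable_EFinP; exact: (row_meas_cut mG).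
have cvgF t : setT t -> (EFin \o (cut (Fn n) \o row)) t @[n --> \oo] --> (EFin \o (cut F \o row)) t.
  move=> _ /=; apply: cvg_EFin; first exact: nearW.
  rewrite /cut /=; case: ifPn => [t1|_]; last exact: cvg_cst.
  exact: FnF.
have domF t n : setT t -> (`|(EFin \o (cut (Fn n) \o row)) t| <=
    (EFin \o ((fun _ => `|C|%R) \_ (cube d 1%R))) t)%E.
  move=> _ /=; rewrite lee_fin patchE; case: ifPn => [_|].
    by apply: cut_le => x; exact: FnC.
  by rewrite notin_setE => tc; rewrite cut_cube// normr0.
have [_ _] := @dominated_convergence _ _ _ mu setT measurableT
  (fun n => EFin \o (cut (Fn n) \o row)) (EFin \o (cut F \o row))
  (EFin \o ((fun _ => `|C|) \_ (cube d 1))) (fun n => mcut _ (bFn n)) (mcut _ bF)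
  (aeW _ cvgF) (integrable_cst_cube _ _) (aeW _ domF).
have Fn0' n : (\int[mu]_t (EFin \o (cut (Fn n) \o row)) t = 0)%E.
  rewrite -[LHS]fineK; first by rewrite -[fine _]/(ball_int (Fn n)) Fn0.
  exact: (integrable_fin_num measurableT (ball_bdd_integrable (bFn n))).
under eq_fun do rewrite Fn0'.
move=> /(cvg_unique (@ereal_hausdorff _)) /(_ (cvg_cst _)) h.
by rewrite /ball_int /Rintegral -[fine _]/(fine (\int[mu]_t (EFin \o (cut F \o row)) t)%E) h.
Qed.

Lemma ball_int_off0 F G : (0 < d)%N -> ball_bdd F -> ball_bdd G -> (forall x, x != 0 -> F x = G x) ->
  ball_int F = ball_int G.
Proof.
move=> d0 bF bG FG; apply/eqP; rewrite -subr_eq0 -ball_intB//; apply/eqP.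
apply: (@ball_int_line0 _ _ _ (Ordinal d0)); first by apply: ball_bddD => //; exact: ball_bddN.
move=> t; rewrite (_ : (fun u : R => _) =
  (fun u : R => (cut (fun x => F x - G x) (row (upd t (Ordinal d0) u)))%:E) \_ [set 0]).
  by rewrite -integral_mkcond integral_set1.
apply/funext => u; rewrite patchE; case: ifPn => //; rewrite notin_setE/= => u0.
rewrite /cut FG ?subrr ?if_same//; apply/eqP => /rowP /(_ (Ordinal d0)).
by rewrite !mxE tnth_mktuple eqxx.
Qed.

(** If [a 0 j != 0], each line in direction [j] meets the hyperplane in the single point [p]. *)
Lemma hyperplane_null a : a != 0 -> mu [set t | dot a (row t) = 0] = 0.
Proof.
move=> a0.
have [j aj] : exists j, a 0 j != 0.
  apply/existsP; move: a0; apply: contraR => /existsPn h.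
  by apply/eqP/rowP => i; rewrite mxE; apply/eqP/negPn/h.
set A := [set t | _].
have mA : measurable A.
  rewrite (_ : A = (dot a \o row) @^-1` [set 0])//.
  by rewrite -[X in measurable X]setTI; apply: row_meas_dot.
rewrite -(setIT A) -integral_indic//.
rewrite (@ge0_integral_line _ _ j _ (fun _ => 0%E))//; first by rewrite integral0_eq.
  by apply/measurable_EFinP; exact: measurable_indic.
move=> t; rewrite [RHS]integral0_eq//.
pose p := - (\sum_(i < d | i != j) a 0 i * tnth t i) / a 0 j.
rewrite (_ : (fun u : R => _) = (fun u : R => (\1_A (upd t j u))%:E) \_ [set p]).
  by rewrite -integral_mkcond integral_set1.
apply/funext => u; rewrite patchE; case: ifPn => //; rewrite notin_setE/= => u0.
rewrite indicE memNset// /A/= /dot (bigD1 j)//= mxE tnth_mktuple eqxx => /eqP.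
rewrite addr_eq0 => /eqP au; apply: u0; rewrite /p.
rewrite (eq_bigr (fun i => a 0 i * row (upd t j u) 0 i)); last first.
  by move=> i ij; rewrite mxE tnth_mktuple (negbTE ij).
by rewrite -au mulrC mulKf.
Qed.

Lemma iint1_neq0 n : (iint (fun _ : n.-tuple R => 1) != 0)%E.
Proof.
elim: n => [|n IH] /=; first by rewrite onee_eq0.
rewrite integral_cst//= -set_itvNyy lebesgue_measure_itv/= mule_eq0 negb_or.
by rewrite (negbTE IH).
Qed.

(** If the unit ball were null, so would be its dilates of every integer radius and hence the whole
    space, on which the iterated integral of 1 is nonzero. *)
Lemma leb_tuple_ball_neq0 : mu [set t | enorm (row t) <= 1] != 0.
Proof.
apply/eqP => B0; have := iint1_neq0 d; rewrite iintE//; move/eqP; apply.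
rewrite integral_cst// mul1e.
pose B (k : nat) := [set t | enorm (row t) <= k%:R].
have mB k : measurable (B k).
  rewrite (_ : B k = (@enorm R d \o row) @^-1` `]-oo, k%:R]%classic).
    by rewrite -[X in measurable X]setTI; apply: row_meas_enorm.
  by apply/seteqP; split => t /=; rewrite in_itv.
have B1 : mu (B 1%N) = 0 by exact: B0.
have Bk0 k : mu (B k) = 0.
  have [->|k0] := eqVneq k 0%N; last first.
    have kk0 : k%:R != 0 :> R by rewrite pnatr_eq0.
    rewrite -(setIT (B k)) -integral_indic//.
    rewrite -(@ge0_integral_scale _ _ (k%:R : R))//; last first.
      by apply/measurable_EFinP; exact: measurable_indic.
    under eq_integral => t _.
      have -> : \1_(B k) [tuple (k%:R * tnth t i)%R | i < d] = \1_(B 1%N) t :> R.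
        have rowE : row [tuple (k%:R * tnth t i)%R | i < d] = k%:R *: row t.
          by apply/rowP => i; rewrite !mxE tnth_mktuple.
        rewrite !indicE; congr (_%:R); congr nat_of_bool.
        by apply/idP/idP; rewrite !inE /B /= rowE enormZ ger0_norm// ger_pMr// ltr0n lt0n.
      over.
    by rewrite [X in (_ * X)%E](_ : _ = 0%E) ?mule0// integral_indic// setIT.
  apply: (@subset_measure0 _ _ _ mu _ (B 1%N)) => // t; rewrite /B /= => /le_trans; apply; exact: ler01.
rewrite (_ : setT = \bigcup_k B k).
  apply: measure_negligible; first exact: bigcup_measurable.
  by apply: negligible_bigcup => k; apply/(negligibleP _ (mB k))/Bk0.
apply/seteqP; split => // t _.
by exists (Num.trunc (enorm (row t))).+1 => //; apply/ltW; exact: truncnS_gt.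
Qed.

(** With a zero integral, [F] would vanish almost everywhere on the ball; its zeros lie on finitely
    many hyperplanes, so the ball would be null. This gives positivity of the total weight. *)
Lemma ball_int_gt0 F (l : seq vec) : ball_bdd F -> (forall x, 0 <= F x) -> (forall a, a \in l -> a != 0) ->
  (forall x, F x = 0 -> exists2 a, a \in l & dot a x = 0) -> 0 < ball_int F.
Proof.
move=> bF F0 l0 Fl.
have ge0 : 0 <= ball_int F.
  by apply: Rintegral_ge0 => t _; rewrite /cut; case: ifP.
rewrite lt_neqAle ge0 andbT eq_sym; apply/eqP => b0.
have I0 : (\int[mu]_t `|(EFin \o (cut F \o row)) t| = 0)%E.
  rewrite -[RHS]/(0%:E) -b0 /ball_int /Rintegral fineK.
    by apply: eq_integral => t _ /=; rewrite ger0_norm// /cut; case: ifP.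
  exact: (integrable_fin_num measurableT (ball_bdd_integrable bF)).
have [mF _] := bF.
have mcF : measurable_fun setT (EFin \o (cut F \o row)).
  by apply/measurable_EFinP; exact: (row_meas_cut mF).
have [N [mN N0 subN]] := (ae_eq_integral_abs mu measurableT mcF).1 I0.
have /eqP := leb_tuple_ball_neq0; apply.
have mH a : measurable [set t | dot a (row t) = 0].
  rewrite (_ : [set t | _] = (dot a \o row) @^-1` [set 0])//.
  by rewrite -[X in measurable X]setTI; apply: row_meas_dot.
pose H := \big[setU/set0]_(a <- l) [set t | dot a (row t) = 0].
have mHH : measurable H by apply: bigsetU_measurable.
have H0 : mu H = 0.
  rewrite /H; elim: (l) l0 => [|a l' IH] l0; first by rewrite big_nil measure0.
  have Ha : mu [set t | dot a (row t) = 0] = 0.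
    by rewrite hyperplane_null// l0// inE eqxx.
  have IHl : mu (\big[setU/set0]_(b <- l') [set t | dot b (row t) = 0]) = 0.
    by apply: IH => b bl; rewrite l0// inE bl orbT.
  rewrite big_cons; apply/eqP; rewrite eq_le measure_ge0 andbT.
  rewrite -[leRHS]adde0 -{1}Ha -IHl; apply: measureU2 => //.
  exact: bigsetU_measurable.
have NH0 : mu (N `|` H) = 0 by rewrite measureU0.
apply: (@subset_measure0 _ _ _ mu _ (N `|` H)).
- rewrite (_ : [set t | _] = (@enorm R d \o row) @^-1` `]-oo, 1]%classic).
    by rewrite -[X in measurable X]setTI; apply: row_meas_enorm.
  by apply/seteqP; split => t /=; rewrite in_itv.
- exact: measurableU.
- move=> t /= t1.
  have [Ft|/eqP Ft] := eqVneq (F (row t)) 0.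
    have [a al at0] := Fl _ Ft; right.
    by rewrite /H -bigcup_seq; exists a.
  by left; apply: subN => /(_ I) /=; rewrite /cut t1 => -[].
- exact: NH0.
Qed.

End ball2.

(** * Radial moments of functions constant along rays *)

Section moments.
Variables (R : realType) (d : nat).
Local Notation vec := 'rV[R]_d.
Local Notation mu := (@leb_tuple R d).
Local Notation row := (@row_of_tuple R d).
Implicit Types (F G : vec -> R) (a : vec).

Lemma integral_cutE F : ball_bdd F -> (\int[mu]_t (cut F (row t))%:E = (ball_int F)%:E)%E.
Proof.
by move=> bF; rewrite /ball_int /Rintegral fineK//; exact: (integrable_fin_num measurableT (ball_bdd_integrable bF)).
Qed.

(* Tonelli applied to [1 - |x|^tau = \int_|x|^1 tau r^(tau - 1) dr], using that the integral over the
   ball of radius [r] is [r^d] times the integral over the unit ball *)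
Lemma ge0_bint_moment G (tau : R) : (0 < d)%N -> 0 < tau -> ball_bdd G -> (forall x, 0 <= G x) ->
  G 0 = 0 -> (forall r x, 0 < r -> G (r *: x) = G x) ->
  (tau + d%:R) * ball_int (fun x => enorm x `^ tau * G x) = d%:R * ball_int G.
Proof.
move=> d0 tau0 bG G0 G00 Gr.
have d1 : 1 <= d%:R :> R by rewrite ler1n.
have [mG _] := bG.
pose K (tr : d.-tuple R * R) : \bar R :=
  (if (enorm (row tr.1) <= tr.2) && (tr.2 <= 1) then G (row tr.1) * (tau * tr.2 `^ (tau - 1)) else 0)%:E.
have mK : measurable_fun setT K.
  apply/measurable_EFinP.
  apply: (@measurable_fun_ifT _ _ _ _ (fun tr : d.-tuple R * R => G (row tr.1) * (tau * tr.2 `^ (tau - 1))) (fun _ => 0)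
    (fun tr : d.-tuple R * R => (enorm (row tr.1) <= tr.2) && (tr.2 <= 1))) => //.
  - apply: measurable_and; apply: measurable_fun_ler => //.
    exact: (measurableT_comp (@row_meas_enorm R d) measurable_fst).
  - apply: measurable_funM; first exact: (measurableT_comp mG measurable_fst).
    apply: measurable_funM => //.
    exact: (measurableT_comp (measurable_powR _) measurable_snd).
have K0 z : (0 <= K z)%E.
  rewrite /K lee_fin; case: ifP => // _; apply: mulr_ge0; first exact: G0.
  by apply: mulr_ge0; [exact: ltW|exact: powR_ge0].
have bt : ball_bdd (fun x : vec => 1 - enorm x `^ tau).
  by apply: ball_bddD; [exact: ball_bdd_cst|apply: ball_bddN; apply: ball_bdd_powR_enorm; exact: ltW].
have E1 t : (\int[@lebesgue_measure R]_r K (t, r) =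
    (cut (fun x => (1 - enorm x `^ tau) * G x) (row t))%:E)%E.
  rewrite /cut; case: ifPn => t1; last first.
    rewrite integral0_eq// => r _; rewrite /K /=; case: ifPn => // /andP[tr r1].
    by rewrite (le_trans tr r1) in t1.
  have [t0|t0] := eqVneq (row t) 0.
    by rewrite t0 G00 mulr0 integral0_eq// => r _; rewrite /K /= t0 G00 mul0r if_same.
  rewrite (_ : (fun r => K (t, r)) =
    (fun r : R => (G (row t))%:E * (tau * r `^ (tau - 1))%:E)%E \_ `[enorm (row t), 1]); last first.
    apply/funext => r; rewrite patchE /K /=; case: ifPn => [/andP[tr r1]|tr].
      by rewrite ifT ?EFinM// inE/= in_itv/= tr r1.
    by rewrite ifF//; apply: contraNF tr; rewrite inE/= in_itv.
  rewrite -integral_mkcond ge0_integralZl//.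
  - rewrite integral_powR_ge//; first by rewrite -EFinM mulrC.
    by rewrite lt_neqAle enorm_ge0 eq_sym enorm_eq0 t0.
  - apply/measurable_EFinP; apply: measurable_funTS; exact: measurable_funM.
  - by move=> r _; rewrite lee_fin mulr_ge0 ?powR_ge0 ?ltW.
  - by rewrite lee_fin.
pose c := tau + d%:R; have c0 : 0 < c by rewrite /c; lra.
have E2 (r : R) : (\int[mu]_t K (t, r) =
    ((fun r : R => (ball_int G * (tau / c))%:E * (c * r `^ (c - 1))%:E)%E \_ `[0%R, 1%R]) r)%E.
  rewrite patchE; case: ifPn => [|]; last first.
    rewrite notin_setE/= in_itv/= => rn; rewrite integral0_eq// => u _; rewrite /K /=.
    case: ifPn => // /andP[tr r1]; exfalso; apply: rn.
    by rewrite r1 andbT (le_trans (enorm_ge0 _) tr).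
  rewrite inE/= in_itv/= => /andP[]; rewrite le_eqVlt => /predU1P[<-{r} _|r0 r1].
    rewrite powR0 ?mulr0 ?mule0; last by rewrite /c; apply: lt0r_neq0; lra.
    rewrite integral0_eq// => u _; rewrite /K /=; case: ifPn => // /andP[u0 _].
    have : enorm (row u) == 0 by rewrite eq_le u0 enorm_ge0.
    by rewrite enorm_eq0 => /eqP ->; rewrite G00 mul0r.
  pose Hr u := (if enorm (row u) <= r then G (row u) else 0)%:E.
  have Hr0 u : (0 <= Hr u)%E by rewrite /Hr lee_fin; case: ifP.
  have mHr : measurable_fun setT Hr.
    apply/measurable_EFinP.
    apply: (@measurable_fun_ifT _ _ _ _ (G \o row) (fun=> 0) (fun u => enorm (row u) <= r)) => //.
    apply: measurable_fun_ler => //; exact: row_meas_enorm.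
  have VE : (\int[mu]_u Hr u = (r ^+ d * ball_int G)%:E)%E.
    rewrite -(@ge0_integral_scale _ _ r)// ?gt_eqF// gtr0_norm// EFinM -integral_cutE//.
    congr (_ * _)%E; apply: eq_integral => u _; rewrite /Hr /cut.
    have -> : row [tuple r * tnth u i | i < d] = r *: row u.
      by apply/rowP => i; rewrite !mxE tnth_mktuple.
    by rewrite enormZ gtr0_norm// Gr// ger_pMr.
  transitivity ((tau * r `^ (tau - 1))%:E * \int[mu]_u Hr u)%E.
    rewrite -ge0_integralZl//; last by rewrite lee_fin mulr_ge0 ?powR_ge0 ?ltW.
    by apply: eq_integral => u _; rewrite /K /Hr /= r1 andbT -EFinM; case: ifP; rewrite ?mulr0// mulrC.
  rewrite VE -!EFinM; congr (_%:E).
  rewrite (_ : c - 1 = (tau - 1) + d%:R); last by rewrite /c; ring.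
  rewrite [r `^ (tau - 1 + d%:R)]powRD; last by rewrite (gt_eqF r0) implybT.
  rewrite powR_mulrn ?ltW//; field; exact: lt0r_neq0.
have : ((ball_int (fun x => (1 - enorm x `^ tau) * G x))%:E =
  \int[@lebesgue_measure R]_(r in `[0%R, 1%R]) ((ball_int G * (tau / c))%:E * (c * r `^ (c - 1))%:E))%E.
  rewrite -integral_cutE; last exact: ball_bddM.
  rewrite [RHS]integral_mkcond.
  transitivity (\int[mu]_t \int[@lebesgue_measure R]_r K (t, r))%E.
    by apply: eq_integral => t _; rewrite E1.
  rewrite (@fubini_tonelli _ _ _ _ _ mu (@lebesgue_measure R) K mK K0).
  by apply: eq_integral => r _; exact: E2.
rewrite ge0_integralZl//; first last.
- rewrite lee_fin; apply: mulr_ge0; last by rewrite divr_ge0 ?ltW.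
  by apply: Rintegral_ge0 => u _; rewrite /cut; case: ifP.
- by move=> r _; rewrite lee_fin mulr_ge0 ?powR_ge0 ?ltW.
- apply/measurable_EFinP; apply: measurable_funTS; exact: measurable_funM.
rewrite integral_powR01 ?mule1; last by rewrite /c; lra.
move=> [].
rewrite (@ball_int_ext _ _ (fun x => (1 - enorm x `^ tau) * G x) (fun x => G x - enorm x `^ tau * G x)); last first.
  by move=> x _; ring.
rewrite ball_intB//; last by apply: ball_bddM => //; apply: ball_bdd_powR_enorm; exact: ltW.
rewrite -[ball_int (fun x => G x)]/(ball_int G).
set M := ball_int (fun x => enorm x `^ tau * G x); set V := ball_int G => /(congr1 (fun z => c * z)).
rewrite -/c (_ : c * (V * (tau / c)) = V * tau); last by field; exact: lt0r_neq0.
move=> h; rewrite -/c (_ : c * M = c * V - c * (V - M)); last by ring.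
by rewrite h /c; ring.
Qed.

(** [G] is split into its positive and negative parts, both reset to 0 at the origin. Being constant
    along rays leaves the value at 0 unconstrained, while the nonnegative case asks for 0 there; the
    origin is a null set. *)
Lemma ball_int_moment G (tau : R) : (0 < d)%N -> 0 <= tau -> ball_bdd G ->
  (forall r x, 0 < r -> G (r *: x) = G x) ->
  (tau + d%:R) * ball_int (fun x => enorm x `^ tau * G x) = d%:R * ball_int G.
Proof.
move=> d0; rewrite le_eqVlt => /predU1P[<-|tau0] bG Gr.
  by rewrite add0r; congr (_ * _); apply: ball_int_ext => x _; rewrite powRr0 mul1r.
pose Gs s x := if x == 0 then 0 else Num.max (s * G x) 0.
have bGs s : ball_bdd (Gs s).
  have [mG [C GC]] := bG; split.
    rewrite /row_meas -[_ \o _]/(fun t => if row t == 0 then 0 else Num.max (s * G (row t)) 0).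
    apply: (@measurable_fun_ifT _ _ _ _ (fun=> 0 : R) (fun t : d.-tuple R => Num.max (s * G (row t)) 0) (fun t : d.-tuple R => row t == 0)) => //.
      rewrite (_ : (fun t => _) = (fun t => enorm (row t) == 0)); last first.
        by apply/funext => t; rewrite enorm_eq0.
      by apply: measurable_fun_eqr => //; exact: row_meas_enorm.
    by apply: measurable_maxr => //; apply: measurable_funM.
  exists (`|s| * C) => x x1; rewrite /Gs; case: ifP => _.
    by rewrite normr0 mulr_ge0// (le_trans _ (GC x x1)).
  have h : `|s * G x| <= `|s| * C by rewrite normrM ler_wpM2l ?GC.
  by rewrite /Num.max; case: ifP => _ //; rewrite normr0 (le_trans _ h).
have mom s : (tau + d%:R) * ball_int (fun x => enorm x `^ tau * Gs s x) = d%:R * ball_int (Gs s).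
  apply: ge0_bint_moment => //.
  - by move=> x; rewrite /Gs; case: ifP => // _; rewrite le_max lexx orbT.
  - by rewrite /Gs eqxx.
  - move=> r x r0; rewrite /Gs scaler_eq0 gt_eqF//=; case: ifP => // _.
    by rewrite Gr.
have GE x : x != 0 -> G x = Gs 1 x - Gs (-1) x.
  move=> x0; rewrite /Gs (negbTE x0) mul1r mulN1r /Num.max; case: ifPn; case: ifPn; rewrite -?leNgt; lra.
have bp := @ball_bdd_powR_enorm R d tau (ltW tau0).
rewrite (ball_int_off0 d0 bG (ball_bddD (bGs 1) (ball_bddN (bGs (-1)))) GE) ball_intB//.
rewrite (@ball_int_off0 _ _ (fun x => enorm x `^ tau * G x)
   (fun x => enorm x `^ tau * Gs 1 x - enorm x `^ tau * Gs (-1) x))//.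
- rewrite ball_intB ?mulrBr ?mom//; exact: ball_bddM.
- exact: ball_bddM.
- by apply: ball_bddD; [exact: ball_bddM|apply: ball_bddN; exact: ball_bddM].
- by move=> x x0; rewrite GE// mulrBr.
Qed.

End moments.

(** * Polynomial functions *)

Section algebra.
Variables (R : realType) (d : nat).
Local Notation vec := 'rV[R]_d.
Implicit Types (f g : vec -> R) (a b u v x y xi eta : vec).

Lemma is_derive_dot v x xi : is_derive x xi (dot v) (dot v xi).
Proof.
have cv : (fun h => h^-1 *: ((dot v \o shift x) (h *: xi) - dot v x)) @ (0 : R)^' --> dot v xi.
  apply: cvg_near_cst; near=> h.
  rewrite /= dotDr dotZr addrK /GRing.scale/= mulKf//.
  by near: h; exact: nbhs_dnbhs_neq.
by split; [apply/cvg_ex; exists (dot v xi)|exact: cvg_lim].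
Unshelve. all: by end_near.
Qed.

(** Polynomial functions as an inductive predicate: an operator identity is checked on constants and
    then carried through one linear factor at a time. *)
Inductive Pol : (vec -> R) -> Prop :=
| Pol_cst c : Pol (fun _ => c)
| Pol_dotM v f : Pol f -> Pol (fun x => dot v x * f x)
| Pol_add f g : Pol f -> Pol g -> Pol (fun x => f x + g x).

Lemma Pol_ext f g : f =1 g -> Pol f -> Pol g.
Proof.
by move=> /funext ->.
Qed.

Lemma PolM f g : Pol f -> Pol g -> Pol (fun x => f x * g x).
Proof.
move=> pf pg; elim: pf => {f} [c|v f _ IH|f1 f2 _ IH1 _ IH2].
- elim: pg => {g} [c'|v g _ IH|g1 g2 _ IH1 _ IH2].
  + by apply: Pol_ext (Pol_cst (c * c')).
  + by apply: Pol_ext (Pol_dotM v IH) => x; rewrite mulrCA.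
  + by apply: Pol_ext (Pol_add IH1 IH2) => x; rewrite mulrDr.
- by apply: Pol_ext (Pol_dotM v IH) => x; rewrite mulrA.
- by apply: Pol_ext (Pol_add IH1 IH2) => x; rewrite mulrDl.
Qed.

Lemma PolZ c f : Pol f -> Pol (fun x => c * f x).
Proof.
exact: PolM (Pol_cst c).
Qed.

Lemma PolB f g : Pol f -> Pol g -> Pol (fun x => f x - g x).
Proof.
by move=> pf /(PolZ (-1)) /(Pol_add pf); apply: Pol_ext => x; rewrite mulN1r.
Qed.

Lemma Pol_dot v : Pol (dot v).
Proof.
by apply: Pol_ext (Pol_dotM v (Pol_cst 1)) => x; rewrite mulr1.
Qed.

Lemma Pol_sum I (l : seq I) (F : I -> vec -> R) : (forall i, Pol (F i)) ->
  Pol (fun x => \sum_(i <- l) F i x).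
Proof.
move=> pF; elim: l => [|i l IH].
  by apply: Pol_ext (Pol_cst 0) => x; rewrite big_nil.
by apply: Pol_ext (Pol_add (pF i) IH) => x; rewrite big_cons.
Qed.

Lemma Pol_refl a f : a != 0 -> Pol f -> Pol (f \o refl a).
Proof.
move=> a0; elim=> {f} [c|v f _ IH|f1 f2 _ IH1 _ IH2].
- exact: Pol_cst.
- by apply: Pol_ext (Pol_dotM (refl a v) IH) => x /=; rewrite dot_reflC.
- exact: Pol_add.
Qed.

Lemma Pol_derivable f : Pol f -> forall x xi, derivable f x xi.
Proof.
elim=> {f} [c|v f _ IH|f1 f2 _ IH1 _ IH2] x xi.
- exact: derivable_cst.
- by apply: derivableM => //; have [] := is_derive_dot v x xi.
- exact: derivableD.
Qed.

Lemma derive_dotM v f x xi : Pol f ->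
  derive (fun x => dot v x * f x) x xi = dot v x * derive f x xi + dot v xi * f x.
Proof.
move=> pf; have [dv ev] := is_derive_dot v x xi.
by rewrite (deriveM dv (@Pol_derivable f pf x xi)) ev /GRing.scale/= (mulrC (f x)).
Qed.

Lemma derive_add f g x xi : Pol f -> Pol g ->
  derive (fun x => f x + g x) x xi = derive f x xi + derive g x xi.
Proof.
by move=> pf pg; rewrite (deriveD (@Pol_derivable f pf x xi) (@Pol_derivable g pg x xi)).
Qed.

Lemma derive_cst0 (c : R) x xi : derive (fun _ : vec => c) x xi = 0.
Proof.
by have := @derive_cst R vec R c x xi.
Qed.

Lemma derive_lin f x xi eta (c : R) : Pol f ->
  derive f x (xi + c *: eta) = derive f x xi + c * derive f x eta.
Proof.
elim=> {f} [c'|v f pf IH|f1 f2 p1 IH1 p2 IH2].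
- by rewrite !derive_cst0 mulr0 addr0.
- by rewrite !derive_dotM// IH dotDr dotZr; ring.
- by rewrite !derive_add// IH1 IH2; ring.
Qed.

Lemma Pol_derive f xi : Pol f -> Pol (fun x => derive f x xi).
Proof.
elim=> {f} [c|v f pf IH|f1 f2 p1 IH1 p2 IH2].
- by apply: Pol_ext (Pol_cst 0) => x; rewrite derive_cst0.
- apply: Pol_ext (Pol_add (Pol_dotM v IH) (PolZ (dot v xi) pf)) => x.
  by rewrite derive_dotM.
- by apply: Pol_ext (Pol_add IH1 IH2) => x; rewrite derive_add.
Qed.

Lemma refl_fix a x : dot a x = 0 -> refl a x = x.
Proof.
by rewrite /refl => ->; rewrite mulr0 mul0r scale0r subr0.
Qed.

(** Off the wall this is [u f - (u f) r = u (f - f r) + (u - u r) (f r)] for [r] the reflection and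
    [u] the form of [v], as [u - u r] is a multiple of [<a,x>]. On the wall [r] fixes [x] and it is
    the product rule for the derivative along [a]. *)
Lemma diffq_dotM a v f x : a != 0 -> Pol f ->
  diffq a (fun x => dot v x * f x) x =
  dot v x * diffq a f x + (2 * dot a v / dot a a) * f (refl a x).
Proof.
rewrite -dot_eq0 => a0 pf; rewrite /diffq; case: ifPn => [ax|].
  rewrite {1}/refl dotDr dotNr dotZr (dotC v a) -/(refl a x); field.
  by apply/andP.
by rewrite negbK => /eqP ax; rewrite derive_dotM// refl_fix// (dotC v a); field.
Qed.

Lemma diffq_add a f g x : Pol f -> Pol g ->
  diffq a (fun x => f x + g x) x = diffq a f x + diffq a g x.
Proof.
move=> pf pg; rewrite /diffq; case: ifP => _; first by rewrite -mulrDl; congr (_ / _); ring.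
by rewrite derive_add// mulrDr.
Qed.

Lemma diffq_cst a (c : R) x : diffq a (fun _ => c) x = 0.
Proof.
by rewrite /diffq derive_cst0 subrr mul0r mulr0 if_same.
Qed.

(** The twisted product rule replaces the division of [f - f r] by a linear form, and it includes
    the values prescribed on the wall. *)
Lemma Pol_diffq a f : a != 0 -> Pol f -> Pol (diffq a f).
Proof.
move=> a0; elim=> {f} [c|v f pf IH|f1 f2 p1 IH1 p2 IH2].
- by apply: Pol_ext (Pol_cst 0) => x; rewrite diffq_cst.
- apply: Pol_ext (Pol_add (Pol_dotM v IH) (PolZ (2 * dot a v / dot a a) (Pol_refl a0 pf))) => x.
  by rewrite diffq_dotM.
- by apply: Pol_ext (Pol_add IH1 IH2) => x; rewrite diffq_add.
Qed.

Lemma dot_diffq a f x : dot a x * diffq a f x = f x - f (refl a x).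
Proof.
rewrite /diffq; case: ifPn => [ax|]; first by rewrite mulrC mulfVK.
by rewrite negbK => /eqP ax; rewrite ax mul0r refl_fix// subrr.
Qed.

(** The graded version of [Pol]. Every degree contains the zero function, by [PolH0]. *)
Inductive PolH : nat -> (vec -> R) -> Prop :=
| PolH_cst c : PolH 0 (fun _ => c)
| PolH_dotM k v f : PolH k f -> PolH k.+1 (fun x => dot v x * f x)
| PolH_add k f g : PolH k f -> PolH k g -> PolH k (fun x => f x + g x).

Lemma PolH_Pol k f : PolH k f -> Pol f.
Proof.
by elim=> *; [exact: Pol_cst|exact: Pol_dotM|exact: Pol_add].
Qed.

Lemma PolH_ext k f g : f =1 g -> PolH k f -> PolH k g.
Proof.
by move=> /funext ->.
Qed.

Lemma PolH0 k : PolH k (fun _ => 0).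
Proof.
elim: k => [|k IH]; first exact: PolH_cst.
by apply: PolH_ext (PolH_dotM 0 IH) => x; rewrite mulr0.
Qed.

Lemma PolHM k m f g : PolH k f -> PolH m g -> PolH (k + m) (fun x => f x * g x).
Proof.
move=> pf pg; elim: pf => {k f} [c|k v f _ IH|k f1 f2 _ IH1 _ IH2].
- elim: pg => {m g} [c'|m v g _ IH|m g1 g2 _ IH1 _ IH2].
  + by apply: PolH_ext (PolH_cst (c * c')).
  + by apply: PolH_ext (PolH_dotM v IH) => x; rewrite mulrCA.
  + by apply: PolH_ext (PolH_add IH1 IH2) => x; rewrite mulrDr.
- by apply: PolH_ext (PolH_dotM v IH) => x; rewrite mulrA.
- by apply: PolH_ext (PolH_add IH1 IH2) => x; rewrite mulrDl.
Qed.

Lemma PolHZ k c f : PolH k f -> PolH k (fun x => c * f x).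
Proof.
exact: PolHM (PolH_cst c).
Qed.

Lemma PolH_sum k I (l : seq I) (F : I -> vec -> R) : (forall i, PolH k (F i)) ->
  PolH k (fun x => \sum_(i <- l) F i x).
Proof.
move=> pF; elim: l => [|i l IH].
  by apply: PolH_ext (PolH0 k) => x; rewrite big_nil.
by apply: PolH_ext (PolH_add (pF i) IH) => x; rewrite big_cons.
Qed.

Lemma PolH_refl k a f : PolH k f -> PolH k (f \o refl a).
Proof.
elim=> {k f} [c|k v f _ IH|k f1 f2 _ IH1 _ IH2].
- exact: PolH_cst.
- by apply: PolH_ext (PolH_dotM (refl a v) IH) => x /=; rewrite dot_reflC.
- exact: PolH_add.
Qed.

Lemma PolH_scale k f (r : R) x : PolH k f -> f (r *: x) = r ^+ k * f x.
Proof.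
elim=> {k f} [c|k v f _ IH|k f1 f2 _ IH1 _ IH2].
- by rewrite expr0 mul1r.
- by rewrite dotZr IH exprS; ring.
- by rewrite IH1 IH2 mulrDr.
Qed.

Lemma PolH0_const f x y : PolH 0 f -> f x = f y.
Proof.
move=> pf; have h z : f z = f 0.
  by rewrite -[in RHS](scale0r z) (PolH_scale 0 z pf) expr0 mul1r.
by rewrite h [RHS]h.
Qed.

(* homogeneous of degree [k - n], and zero when [k < n] *)
Definition PolHz k n f := if (n <= k)%N then PolH (k - n) f else f = fun _ => 0.

Lemma PolHz_ext k n f g : f =1 g -> PolHz k n f -> PolHz k n g.
Proof.
by move=> /funext ->.
Qed.

Lemma PolHz0 k n : PolHz k n (fun _ => 0).
Proof.
by rewrite /PolHz; case: ifP => _ //; exact: PolH0.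
Qed.

Lemma PolHz_add k n f g : PolHz k n f -> PolHz k n g -> PolHz k n (fun x => f x + g x).
Proof.
rewrite /PolHz; case: ifP => _; first exact: PolH_add.
by move=> -> ->; apply/funext => x; rewrite addr0.
Qed.

Lemma PolHzZ k n c f : PolHz k n f -> PolHz k n (fun x => c * f x).
Proof.
rewrite /PolHz; case: ifP => _; first exact: PolHZ.
by move=> ->; apply/funext => x; rewrite mulr0.
Qed.

Lemma PolHz_sum k n I (l : seq I) (F : I -> vec -> R) : (forall i, PolHz k n (F i)) ->
  PolHz k n (fun x => \sum_(i <- l) F i x).
Proof.
move=> pF; elim: l => [|i l IH].
  by rewrite (_ : (fun x => _) = fun _ => 0); [exact: PolHz0|apply/funext => x; rewrite big_nil].
rewrite (_ : (fun x => _) = fun x => F i x + \sum_(j <- l) F j x); first exact: PolHz_add.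
by apply/funext => x; rewrite big_cons.
Qed.

Lemma PolHz1_dotM k v f : PolHz k 1 f -> PolH k (fun x => dot v x * f x).
Proof.
case: k => [|k]; rewrite /PolHz /=; last by rewrite subn1; exact: PolH_dotM.
by move=> ->; apply: PolH_ext (PolH0 0) => x; rewrite mulr0.
Qed.

Lemma PolHz_derive k f xi : PolH k f -> PolHz k 1 (fun x => derive f x xi).
Proof.
elim=> {k f} [c|k v f pf IH|k f1 f2 p1 IH1 p2 IH2].
- by rewrite /PolHz /=; apply/funext => x; exact: derive_cst0.
- rewrite /PolHz /= subn1 /=.
  apply: PolH_ext (PolH_add (PolHz1_dotM v IH) (PolHZ (dot v xi) pf)) => x.
  by rewrite derive_dotM//; exact: PolH_Pol pf.
- apply: PolHz_ext (PolHz_add IH1 IH2) => x.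
  by rewrite derive_add; [|exact: PolH_Pol p1|exact: PolH_Pol p2].
Qed.

Lemma PolHz_diffq k a f : a != 0 -> PolH k f -> PolHz k 1 (diffq a f).
Proof.
move=> a0; elim=> {k f} [c|k v f pf IH|k f1 f2 p1 IH1 p2 IH2].
- by rewrite /PolHz /=; apply/funext => x; rewrite diffq_cst.
- rewrite /PolHz /= subn1 /=.
  apply: PolH_ext (PolH_add (PolHz1_dotM v IH)
    (PolHZ (2 * dot a v / dot a a) (PolH_refl a pf))) => x.
  by rewrite diffq_dotM//; exact: PolH_Pol pf.
- rewrite (_ : diffq a _ = fun x => diffq a f1 x + diffq a f2 x); first exact: PolHz_add.
  by apply/funext => x; rewrite diffq_add; [|exact: PolH_Pol p1|exact: PolH_Pol p2].
Qed.

Lemma euler k f x : PolH k f -> \sum_(j < d) x 0 j * derive f x (ebasis R j) = k%:R * f x.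
Proof.
elim=> {k f} [c|k v f pf IH|k f1 f2 p1 IH1 p2 IH2].
- by rewrite mul0r big1// => j _; rewrite derive_cst0 mulr0.
- under eq_bigr => j _.
    rewrite derive_dotM; last exact: PolH_Pol pf.
    rewrite mulrDr mulrCA dot_ebasis (mulrA _ (v 0 j)).
    over.
  rewrite big_split /= -mulr_sumr IH -mulr_suml.
  under eq_bigr do rewrite mulrC.
  by rewrite -/(dot v x) -natr1; ring.
- under eq_bigr => j _.
    rewrite derive_add; [|exact: PolH_Pol p1|exact: PolH_Pol p2].
    rewrite mulrDr.
    over.
  by rewrite big_split /= IH1 IH2 mulrDr.
Qed.

End algebra.

(** * Root systems and Dunkl operators *)

Section dunkl_algebra.
Variables (R : realType) (d : nat).
Local Notation vec := 'rV[R]_d.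
Implicit Types (f g : vec -> R) (a b u x y xi eta : vec).
Variables (Rs : seq vec) (v0 : vec) (kappa : vec -> R).
Hypotheses (rs : root_system Rs) (rv : regular Rs v0) (km : multiplicity Rs kappa).
Local Notation Rp := (pos_roots Rs v0).
Local Notation D := (dunkl Rp kappa).
Local Notation L := (dunkl_lap Rp kappa).

Lemma root_neq0 a : a \in Rs -> a != 0.
Proof.
by move=> aR; have [_ + _ _] := rs; apply: contraNN => /eqP <-.
Qed.

Lemma pos_root_mem a : a \in Rp -> a \in Rs.
Proof.
by rewrite mem_filter => /andP[].
Qed.

Lemma pos_root_neq0 a : a \in Rp -> a != 0.
Proof.
by move/pos_root_mem/root_neq0.
Qed.

Lemma rootN a : a \in Rs -> - a \in Rs.
Proof.
by move=> aR; have [_ _ _ h] := rs; rewrite -scaleN1r; apply/(h a (-1) aR); right.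
Qed.

Lemma kappa_ge0 a : a \in Rp -> 0 <= kappa a.
Proof.
by move/pos_root_mem; exact: km.1.
Qed.

Lemma refl_self a : a != 0 -> refl a a = - a.
Proof.
rewrite -dot_eq0 => a0; rewrite /refl -mulrA mulfV// mulr1 scaler_nat mulr2n.
by rewrite opprD addNKr.
Qed.

Lemma kappa_refl a b : a \in Rs -> b \in Rs -> kappa (refl b a) = kappa a.
Proof.
move=> aR bR; rewrite -[refl b a]/((refl b \o id) a).
by apply: km.2 => //; apply: refl_group_comp => //; exact: refl_group_id.
Qed.

Lemma kappaN a : a \in Rs -> kappa (- a) = kappa a.
Proof.
by move=> aR; rewrite -refl_self ?root_neq0// kappa_refl.
Qed.

(** Regularity of [v0] makes exactly one of [a] and [-a] positive. Sums and products over [Rp] can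
    thus be compared with those over [Rs], the set that reflections permute. *)
Lemma roots_perm : perm_eq Rs (Rp ++ [seq - a | a <- Rp]).
Proof.
have [uR _ _ _] := rs.
have negE a : (a \in [seq - b | b <- Rp]) = (a \in Rs) && (dot a v0 < 0).
  rewrite -[in LHS](opprK a) mem_map; last exact: oppr_inj.
  rewrite mem_filter dotNl oppr_gt0 andbC; congr (_ && _).
  by apply/idP/idP => /rootN; rewrite ?opprK.
apply: uniq_perm => // [|a].
  rewrite cat_uniq filter_uniq// (map_inj_uniq (@oppr_inj _)) filter_uniq//.
  rewrite andbT /=; apply/hasPn => a; rewrite negE => /andP[_ an].
  by rewrite /= mem_filter (lt_gtF an).
rewrite mem_cat negE mem_filter andbC -andb_orr.
have [aR|//] := boolP (a \in Rs).
by have := rv aR; rewrite neq_lt orbC => ->.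
Qed.

Lemma sum_pos_roots (phi : vec -> R) : (forall a, a \in Rs -> phi (- a) = phi a) ->
  \sum_(a <- Rs) phi a = 2 * \sum_(a <- Rp) phi a.
Proof.
move=> phiN; rewrite (perm_big _ roots_perm) big_cat big_map /= mulr_natl mulr2n; congr (_ + _).
rewrite big_seq [RHS]big_seq; apply: eq_bigr => a /pos_root_mem aR; exact: phiN.
Qed.

Lemma prod_pos_roots (phi : vec -> R) : (forall a, a \in Rs -> phi (- a) = phi a) ->
  \prod_(a <- Rs) phi a = (\prod_(a <- Rp) phi a) ^+ 2.
Proof.
move=> phiN; rewrite (perm_big _ roots_perm) big_cat big_map /= expr2; congr (_ * _).
rewrite big_seq [RHS]big_seq; apply: eq_bigr => a /pos_root_mem aR; exact: phiN.
Qed.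

Lemma refl_roots_perm b : b \in Rs -> perm_eq [seq refl b a | a <- Rs] Rs.
Proof.
move=> bR; have b0 := root_neq0 bR; have [uR _ Rr _] := rs; apply: uniq_perm => //.
  by rewrite map_inj_uniq//; exact: inv_inj (reflK b0).
move=> a; apply/mapP/idP => [[c cR ->]|aR]; first exact: Rr.
by exists (refl b a); rewrite ?Rr ?reflK.
Qed.

(** A reflection does not preserve [Rp], but for an even summand the sum over [Rp] is half the one
    over [Rs], which is merely reindexed. *)
Lemma sum_pos_roots_refl (phi : vec -> R) b : b \in Rs ->
  (forall a, a \in Rs -> phi (- a) = phi a) ->
  \sum_(a <- Rp) phi (refl b a) = \sum_(a <- Rp) phi a.
Proof.
move=> bR phiN; have b0 := root_neq0 bR; have [uR _ Rr _] := rs.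
have two : (2 : R) != 0 by rewrite pnatr_eq0.
apply: (mulfI two); rewrite -!sum_pos_roots//; last first.
  by move=> a aR; rewrite -scaleN1r reflZ scaleN1r phiN// Rr.
by rewrite -(big_map (refl b) xpredT phi); exact/perm_big/refl_roots_perm.
Qed.

(** The pairing of [u] with the coroot [2 a / <a,a>]. *)
Definition coroot a u : R := 2 * dot a u / dot a a.

Lemma reflE a x : refl a x = x - coroot a x *: a.
Proof.
by [].
Qed.

Lemma corootN a u : coroot (- a) u = - coroot a u.
Proof.
by rewrite /coroot !dotNl dotNr opprK mulrN mulNr.
Qed.

Lemma coroot_refl b a u : b != 0 -> coroot (refl b a) u = coroot a (refl b u).
Proof.
by move=> b0; rewrite /coroot dot_refl// dot_reflC.
Qed.

(** Conjugation: the reflection in [refl b a] is the reflection in [a] conjugated by the one in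
    [b]. *)
Lemma refl_refl b a x : b != 0 -> refl (refl b a) (refl b x) = refl b (refl a x).
Proof.
move=> b0; rewrite 2!reflE coroot_refl// reflK// [RHS]reflE {1}/refl.
rewrite !reflE /coroot dotDr dotNr dotZr.
apply/rowP => i; rewrite !mxE; ring.
Qed.

Lemma dunkl_ext xi f g : f =1 g -> D xi f =1 D xi g.
Proof.
by move=> /funext ->.
Qed.

Lemma sum_Rp_ext (F G : vec -> R) : (forall a, a \in Rp -> F a = G a) ->
  \sum_(a <- Rp) F a = \sum_(a <- Rp) G a.
Proof.
by move=> FG; rewrite big_seq [RHS]big_seq; exact: eq_bigr.
Qed.

Lemma Pol_dunkl xi f : Pol f -> Pol (D xi f).
Proof.
move=> pf; apply: Pol_add; first exact: Pol_derive.
(* Extending the family by zero outside [Rp] gives the closure of [Pol] under sums a family defined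
   for all indices, although [diffq] is known to be polynomial only for nonzero [a]. *)
pose F a : vec -> R := if a \in Rp then fun x => kappa a * dot a xi * diffq a f x else fun _ => 0.
apply: (@Pol_ext _ _ (fun x => \sum_(a <- Rp) F a x)).
  by move=> x; apply: sum_Rp_ext => a aR; rewrite /F aR.
apply: Pol_sum => a; rewrite /F; case: ifP => aR; last exact: Pol_cst.
by apply: PolZ; apply: Pol_diffq => //; exact: pos_root_neq0.
Qed.

Lemma PolHz_dunkl k xi f : PolH k f -> PolHz k 1 (D xi f).
Proof.
move=> pf; apply: PolHz_add; first exact: PolHz_derive.
pose F a : vec -> R := if a \in Rp then fun x => kappa a * dot a xi * diffq a f x else fun _ => 0.
apply: (@PolHz_ext _ _ _ _ (fun x => \sum_(a <- Rp) F a x)).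
  by move=> x; apply: sum_Rp_ext => a aR; rewrite /F aR.
apply: PolHz_sum => a; rewrite /F; case: ifP => aR; last exact: PolHz0.
by apply: PolHzZ; apply: PolHz_diffq => //; exact: pos_root_neq0.
Qed.

Lemma dunkl_cst xi (c : R) x : D xi (fun _ => c) x = 0.
Proof.
by rewrite /dunkl derive_cst0 add0r big1// => a _; rewrite diffq_cst mulr0.
Qed.

Lemma dunkl_add xi f g x : Pol f -> Pol g ->
  D xi (fun x => f x + g x) x = D xi f x + D xi g x.
Proof.
move=> pf pg; rewrite /dunkl derive_add//.
under eq_bigr do rewrite diffq_add// mulrDr.
by rewrite big_split /= addrACA.
Qed.

Lemma dunkl_dotM xi u f x : Pol f ->
  D xi (fun x => dot u x * f x) x = dot u x * D xi f x + dot u xi * f x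
    + \sum_(a <- Rp) kappa a * dot a xi * coroot a u * f (refl a x).
Proof.
move=> pf; rewrite /dunkl derive_dotM//.
rewrite (sum_Rp_ext (G := fun a => dot u x * (kappa a * dot a xi * diffq a f x)
   + kappa a * dot a xi * coroot a u * f (refl a x))); last first.
  by move=> a /pos_root_neq0 a0; rewrite diffq_dotM// /coroot; ring.
by rewrite big_split /= -mulr_sumr; ring.
Qed.

Lemma dunkl_scal xi (c : R) f x : Pol f -> D xi (fun x => c * f x) x = c * D xi f x.
Proof.
move=> pf; elim: pf x => {f} [c'|u f pf IH|f1 f2 p1 IH1 p2 IH2] x.
- by rewrite !dunkl_cst mulr0.
- rewrite dunkl_dotM// (@dunkl_ext _ _ (fun x => dot u x * (c * f x))); last by move=> y; ring.
  rewrite dunkl_dotM//; last exact: PolZ.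
  rewrite IH [RHS]mulrDr mulr_sumr; congr (_ + _); first by ring.
  by apply: eq_bigr => a _; ring.
- rewrite dunkl_add// (@dunkl_ext _ _ (fun x => c * f1 x + c * f2 x)); last by move=> y; ring.
  by rewrite dunkl_add ?IH1 ?IH2; [ring|exact: PolZ..].
Qed.

Lemma dunkl_sub xi f g x : Pol f -> Pol g ->
  D xi (fun x => f x - g x) x = D xi f x - D xi g x.
Proof.
move=> pf pg; rewrite (@dunkl_ext _ _ (fun x => f x + (-1) * g x)); last by move=> y; ring.
by rewrite dunkl_add ?dunkl_scal//; [ring|exact: PolZ].
Qed.

Lemma dunkl_sum xi I (l : seq I) (F : I -> vec -> R) x : (forall i, Pol (F i)) ->
  D xi (fun x => \sum_(i <- l) F i x) x = \sum_(i <- l) D xi (F i) x.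
Proof.
move=> pF; elim: l => [|i l IH].
  rewrite big_nil (@dunkl_ext _ _ (fun _ => 0)) ?dunkl_cst// => y; by rewrite big_nil.
rewrite big_cons (@dunkl_ext _ _ (fun x => F i x + \sum_(j <- l) F j x)); last first.
  by move=> y; rewrite big_cons.
by rewrite dunkl_add ?IH//; exact: Pol_sum.
Qed.

Lemma dunkl_lin xi eta (c : R) f x : Pol f ->
  D (xi + c *: eta) f x = D xi f x + c * D eta f x.
Proof.
move=> pf; rewrite /dunkl derive_lin// mulrDr mulr_sumr addrACA -big_split /=; congr (_ + _).
by apply: eq_bigr => a _; rewrite dotDr dotZr; ring.
Qed.

Lemma dunkl0 f x : Pol f -> D 0 f x = 0.
Proof.
move=> pf; have := @dunkl_lin 0 0 1 f x pf; rewrite scaler0 addr0 mul1r => /eqP.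
by rewrite -subr_eq0 opprD addNKr oppr_eq0 => /eqP.
Qed.

Lemma dunkl_ebasis xi f x : Pol f -> \sum_(j < d) xi 0 j * D (ebasis R j) f x = D xi f x.
Proof.
move=> pf; have {2}-> : xi = \sum_(j < d) xi 0 j *: ebasis R j.
  by rewrite [LHS]row_sum_delta.
elim/big_rec2: _ => [|j y1 y2 _ IH]; first by rewrite dunkl0.
by rewrite [in RHS]addrC dunkl_lin// IH addrC.
Qed.

(** Equivariance of the Dunkl operators: reflections permute the roots and preserve [kappa]. *)
Lemma dunkl_refl b xi f x : b \in Rp -> Pol f ->
  D xi f (refl b x) = D (refl b xi) (f \o refl b) x.
Proof.
move=> bRp; have bR := pos_root_mem bRp; have b0 := root_neq0 bR.
elim=> {f} [c|u f pf IH|f1 f2 p1 IH1 p2 IH2].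
- by rewrite dunkl_cst (@dunkl_ext _ _ (fun _ => c)) ?dunkl_cst.
- rewrite dunkl_dotM// [RHS](@dunkl_ext _ _ (fun x => dot (refl b u) x * (f \o refl b) x)); last first.
    by move=> y /=; rewrite dot_reflC.
  rewrite dunkl_dotM; last exact: Pol_refl.
  rewrite -IH dot_refl// dot_reflC; congr (_ + _ + _).
  (* The two correction sums differ by the substitution of [refl b a] for [a], legitimate over [Rp]
     because [phi] is even. *)
  pose phi a := kappa a * dot a xi * coroot a u * f (refl a (refl b x)).
  rewrite -(@sum_pos_roots_refl phi b)//; last first.
    move=> a aR; rewrite /phi kappaN// dotNl corootN.
    have -> : refl (- a) (refl b x) = refl a (refl b x).
      by rewrite !reflE corootN scaleNr scalerN opprK.
    by ring.
  apply: sum_Rp_ext => a /pos_root_mem aR; rewrite /phi (kappa_refl aR bR) (coroot_refl _ _ b0).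
  by rewrite (refl_refl _ _ b0) dot_reflC.
- transitivity (D (refl b xi) (f1 \o refl b) x + D (refl b xi) (f2 \o refl b) x).
    by rewrite -IH1 -IH2; exact: dunkl_add.
  rewrite -(dunkl_add _ _ (Pol_refl b0 p1) (Pol_refl b0 p2)).
  by apply: dunkl_ext => y.
Qed.

Lemma Pol_reflR a f : a \in Rp -> Pol f -> Pol (f \o refl a).
Proof.
by move=> /pos_root_neq0; exact: Pol_refl.
Qed.

Lemma dunkl_refl_lin b xi f x : b \in Rp -> Pol f ->
  D xi f (refl b x) = D xi (f \o refl b) x - coroot b xi * D b (f \o refl b) x.
Proof.
move=> bR pf; rewrite dunkl_refl// reflE -scaleNr dunkl_lin; last exact: Pol_reflR.
by rewrite mulNr.
Qed.

Lemma dunkl_sum_Rp xi (F : vec -> vec -> R) x : (forall a, a \in Rp -> Pol (F a)) ->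
  D xi (fun x => \sum_(a <- Rp) F a x) x = \sum_(a <- Rp) D xi (F a) x.
Proof.
move=> pF; pose G a : vec -> R := if a \in Rp then F a else fun _ => 0.
rewrite (@dunkl_ext _ _ (fun x => \sum_(a <- Rp) G a x)); last first.
  by move=> y; apply: sum_Rp_ext => a aR; rewrite /G aR.
rewrite dunkl_sum; last by move=> a; rewrite /G; case: ifP => [/pF//|_]; exact: Pol_cst.
by apply: sum_Rp_ext => a aR; rewrite /G aR.
Qed.

Lemma Pol_sum_Rp (F : vec -> vec -> R) : (forall a, a \in Rp -> Pol (F a)) ->
  Pol (fun x => \sum_(a <- Rp) F a x).
Proof.
move=> pF; pose G a : vec -> R := if a \in Rp then F a else fun _ => 0.
apply: (@Pol_ext _ _ (fun x => \sum_(a <- Rp) G a x)).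
  by move=> y; apply: sum_Rp_ext => a aR; rewrite /G aR.
by apply: Pol_sum => a; rewrite /G; case: ifP => [/pF//|_]; exact: Pol_cst.
Qed.

Lemma dunkl2_dotM xi eta u f x : Pol f ->
  D xi (D eta (fun x => dot u x * f x)) x =
  dot u x * D xi (D eta f) x + dot u xi * D eta f x + dot u eta * D xi f x
  + \sum_(a <- Rp) kappa a * coroot a u *
      (dot a xi * D eta f (refl a x) + dot a eta * D xi (f \o refl a) x).
Proof.
move=> pf.
have pS a : a \in Rp -> Pol (fun x => kappa a * dot a eta * coroot a u * f (refl a x)).
  by move=> aR; apply: PolZ; exact: Pol_reflR.
rewrite (@dunkl_ext _ _ (fun x => (dot u x * D eta f x + dot u eta * f x)
    + \sum_(a <- Rp) kappa a * dot a eta * coroot a u * f (refl a x))); last first.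
  by move=> y; rewrite dunkl_dotM.
have pD := Pol_dunkl eta pf.
rewrite dunkl_add; first last.
- exact: Pol_sum_Rp.
- by apply: Pol_add; [exact: Pol_dotM|exact: PolZ].
rewrite dunkl_add; [|exact: Pol_dotM|exact: PolZ].
rewrite dunkl_dotM// dunkl_scal// dunkl_sum_Rp//.
rewrite (sum_Rp_ext (F := fun a => D xi _ x) (G := fun a => kappa a * dot a eta * coroot a u * D xi (f \o refl a) x)); last first.
  by move=> a aR; rewrite (dunkl_scal xi _ x (Pol_reflR aR pf)).
set S1 := \sum_(a <- Rp) _ * D eta f _; set S2 := \sum_(a <- Rp) _ * D xi (f \o _) x.
rewrite (_ : \sum_(a <- Rp) _ = S1 + S2); first by ring.
by rewrite /S1 /S2 -big_split /=; apply: eq_bigr => a _; ring.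
Qed.

(* The commutator of two Dunkl operators commutes with multiplication by linear forms *)
Lemma dunklC xi eta f : Pol f -> D xi (D eta f) =1 D eta (D xi f).
Proof.
elim=> {f} [c|u f pf IH|f1 f2 p1 IH1 p2 IH2] x.
- rewrite (@dunkl_ext _ (D eta _) (fun _ => 0)); last by move=> y; exact: dunkl_cst.
  rewrite [RHS](@dunkl_ext _ _ (fun _ => 0)); last by move=> y; exact: dunkl_cst.
  by rewrite !dunkl_cst.
- rewrite (dunkl2_dotM xi)// (dunkl2_dotM eta)// IH [X in X + _ = _]addrAC; congr (_ + _).
  (* With [g = f \o refl a], equivariance turns the summand into [<a,xi> D eta g + <a,eta> D xi g]
     minus a multiple of [<a,xi> <a,eta> D a g], which is symmetric in [xi] and [eta]. *)
  apply: sum_Rp_ext => a aR; rewrite !dunkl_refl_lin// /coroot; ring.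
- rewrite (@dunkl_ext _ _ (fun x => D eta f1 x + D eta f2 x)); last by move=> y; rewrite dunkl_add.
  rewrite [RHS](@dunkl_ext _ _ (fun x => D xi f1 x + D xi f2 x)); last by move=> y; rewrite dunkl_add.
  rewrite dunkl_add; [|exact: Pol_dunkl..].
  by rewrite dunkl_add; [rewrite IH1 IH2|exact: Pol_dunkl..].
Qed.

(** * The Dunkl Laplacian and its commutators *)

Lemma lap_ext f g : f =1 g -> L f =1 L g.
Proof.
by move=> /funext ->.
Qed.

Lemma Pol_lap f : Pol f -> Pol (L f).
Proof.
by move=> pf; apply: Pol_sum => j; do 2 apply: Pol_dunkl.
Qed.

Lemma lap_add f g x : Pol f -> Pol g -> L (fun x => f x + g x) x = L f x + L g x.
Proof.
move=> pf pg; rewrite /dunkl_lap -big_split /=; apply: eq_bigr => j _.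
rewrite /dunklj (@dunkl_ext _ _ (fun x => D (ebasis R j) f x + D (ebasis R j) g x)); last first.
  by move=> y; rewrite dunkl_add.
by rewrite dunkl_add//; exact: Pol_dunkl.
Qed.

Lemma lap_scal (c : R) f x : Pol f -> L (fun x => c * f x) x = c * L f x.
Proof.
move=> pf; rewrite /dunkl_lap mulr_sumr; apply: eq_bigr => j _.
rewrite /dunklj (@dunkl_ext _ _ (fun x => c * D (ebasis R j) f x)); last first.
  by move=> y; rewrite dunkl_scal.
by rewrite dunkl_scal//; exact: Pol_dunkl.
Qed.

Lemma lap0 x : L (fun _ => 0) x = 0.
Proof.
rewrite (@lap_ext _ (fun _ => 0 * 0)); last by move=> y; rewrite mul0r.
by rewrite lap_scal ?mul0r//; exact: Pol_cst.
Qed.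

Lemma lap_dunkl xi f x : Pol f -> L (D xi f) x = D xi (L f) x.
Proof.
move=> pf; rewrite /dunkl_lap /dunklj dunkl_sum; last by move=> j; do 2 apply: Pol_dunkl.
apply: eq_bigr => j _.
rewrite (@dunkl_ext _ _ (D xi (D (ebasis R j) f))); last by move=> y; exact: dunklC.
by rewrite dunklC//; exact: Pol_dunkl.
Qed.

Lemma lap_dotM u f x : Pol f -> L (fun x => dot u x * f x) x = dot u x * L f x + 2 * D u f x.
Proof.
move=> pf; rewrite /dunkl_lap.
transitivity (\sum_(j < d) (dot u x * D (ebasis R j) (D (ebasis R j) f) x
   + dot u (ebasis R j) * D (ebasis R j) f x + dot u (ebasis R j) * D (ebasis R j) f x
   + \sum_(a <- Rp) kappa a * coroot a u *
      (dot a (ebasis R j) * D (ebasis R j) f (refl a x)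
       + dot a (ebasis R j) * D (ebasis R j) (f \o refl a) x))).
  by apply: eq_bigr => j _; exact: dunkl2_dotM.
have E : \sum_(j < d) dot u (ebasis R j) * D (ebasis R j) f x = D u f x.
  by rewrite -(dunkl_ebasis u x pf); apply: eq_bigr => j _; rewrite dot_ebasis.
rewrite 3!big_split /= E -mulr_sumr -2!addrA; congr (_ + _).
move: (D u f x) => B; rewrite addrA -[RHS]addr0; congr (_ + _); first by ring.
rewrite exchange_big /= big_seq; apply: big1 => a aR.
rewrite -mulr_sumr; have pa := Pol_reflR aR pf.
(* For each root, the sum over the orthonormal basis is [2 D a g] minus [<a,a> (2 / <a,a>) D a g],
   with [g = f \o refl a]. *)
suff -> : \sum_(j < d) (dot a (ebasis R j) * D (ebasis R j) f (refl a x)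
       + dot a (ebasis R j) * D (ebasis R j) (f \o refl a) x) = 0 by rewrite mulr0.
transitivity (\sum_(j < d) (2 * (a 0 j * D (ebasis R j) (f \o refl a) x)
   - a 0 j * a 0 j * (2 / dot a a) * D a (f \o refl a) x)).
  apply: eq_bigr => j _; rewrite (dunkl_refl_lin _ _ aR pf) /coroot dot_ebasis.
  by move: (D _ _ _) (D a _ _) => A1 A2; ring.
rewrite sumrB -mulr_sumr (dunkl_ebasis a x pa) -mulr_suml -mulr_suml -/(dot a a).
by rewrite mulrCA mulfV ?mulr1 ?subrr// dot_eq0; exact: pos_root_neq0.
Qed.

Lemma PolHz_dunklS k n xi f : PolHz k n f -> PolHz k n.+1 (D xi f).
Proof.
rewrite {1}/PolHz; case: ifPn => [nk pf|nk ->].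
  have := PolHz_dunkl xi pf; rewrite /PolHz subn_gt0.
  by case: ifP => _ //; rewrite -subnDA addn1.
rewrite (_ : D xi _ = fun _ => 0); first exact: PolHz0.
by apply/funext => x; exact: dunkl_cst.
Qed.

Lemma PolHz_lap k n f : PolHz k n f -> PolHz k n.+2 (L f).
Proof.
by move=> pf; apply: PolHz_sum => j; do 2 apply: PolHz_dunklS.
Qed.

Lemma PolHz_lap_iter k n f : PolH k f -> PolHz k (2 * n) (iter n L f).
Proof.
move=> pf; elim: n => [|n IH]; first by rewrite muln0 /PolHz leq0n subn0.
by rewrite mulnS /=; exact: PolHz_lap.
Qed.

(** * The adjoint action of the Dunkl Laplacian *)

Definition ad (T : (vec -> R) -> vec -> R) f x : R := L (T f) x - T (L f) x.
Definition PolOp (T : (vec -> R) -> vec -> R) := forall f, Pol f -> Pol (T f).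
(** Operators are compared on polynomials only, where derivatives exist and the Dunkl operators are
    linear and commute. *)
Definition eqop (T S : (vec -> R) -> vec -> R) := forall f, Pol f -> T f = S f.

Lemma PolOp_ad k T : PolOp T -> PolOp (iter k ad T).
Proof.
move=> pT; elim: k => [//|k IH] f pf /=; apply: PolB.
- by apply: Pol_lap; exact: IH.
- by apply: IH; exact: Pol_lap.
Qed.

Lemma ad_eqop T S : eqop T S -> eqop (ad T) (ad S).
Proof.
by move=> TS f pf; apply/funext => x; rewrite /ad (TS _ pf) (TS _ (Pol_lap pf)).
Qed.

Lemma iter_ad0 k T : eqop T (fun _ _ => 0) -> eqop (iter k ad T) (fun _ _ => 0).
Proof.
move=> T0; elim: k => [//|k IH] f pf; rewrite iterS (ad_eqop IH pf).
by apply/funext => x; rewrite /ad lap0 subr0.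
Qed.

(** [ad] is a derivation sending multiplication by a linear form to [2 D u], and it kills [D u]; the
    binomial expansion of its [k]-th power therefore has two terms. For [k = 0] the coefficient 0
    makes the truncated [k.-1] harmless. *)
Lemma ad_dotM u T k : PolOp T ->
  eqop (iter k ad (fun f x => dot u x * T f x))
    (fun f x => dot u x * iter k ad T f x + (2 * k)%:R * D u (iter k.-1 ad T f) x).
Proof.
move=> pT; elim: k => [|k IH] f pf.
  by apply/funext => x; rewrite muln0 mul0r addr0.
rewrite iterS (ad_eqop IH pf); apply/funext => x; rewrite /ad.
have pB j : Pol (iter j ad T f) by exact: PolOp_ad.
rewrite lap_add; first last.
- by apply: PolZ; exact: Pol_dunkl.
- exact: Pol_dotM.
rewrite lap_dotM// lap_scal; last exact: Pol_dunkl.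
rewrite lap_dunkl//.
case: k => [|k] in IH *.
  by rewrite muln0 /= muln1 !mul0r !addr0 /ad mulrBr addrAC.
rewrite [k.+1.-1]/= [k.+2.-1]/=.
have -> : D u (iter k.+1 ad T f) x = D u (L (iter k ad T f)) x - D u (iter k ad T (L f)) x.
  by rewrite -dunkl_sub//; [exact: Pol_lap|apply: PolOp_ad => //; exact: Pol_lap].
rewrite (iterS k.+1) {4}/ad !natrM -[k.+2%:R]natr1.
move: (D u _ x) (D u _ x) (L _ x) (iter _ _ _ _ x) => A B C E; ring.
Qed.

(** Monomials are lists of vectors, read as products of linear forms: the degree is the length, and
    induction removes one form at a time. *)
Definition mulmon (l : seq vec) f : vec -> R := foldr (fun u g x => dot u x * g x) f l.
Definition Dmon (l : seq vec) f : vec -> R := foldr (fun u g => D u g) f l.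

Lemma Pol_Dmon l f : Pol f -> Pol (Dmon l f).
Proof.
by move=> pf; elim: l => [//|u l IH]; exact: Pol_dunkl.
Qed.

Lemma PolOp_mulmon l : PolOp (mulmon l).
Proof.
by move=> f pf; elim: l => [//|u l IH]; exact: Pol_dotM.
Qed.

Lemma ad_mulmon l :
  eqop (iter (size l) ad (mulmon l))
    (fun f x => 2 ^+ size l * (size l)`!%:R * Dmon l f x) /\
  forall k, (size l < k)%N -> eqop (iter k ad (mulmon l)) (fun _ _ => 0).
Proof.
elim: l => [|u l [IH1 IH2]].
  split; first by move=> f pf; apply/funext => x; rewrite expr0 fact0 !mul1r.
  case=> [//|k] _; rewrite iterSr; apply: iter_ad0 => f pf.
  by apply/funext => x; rewrite /ad subrr.
have E k : eqop (iter k ad (mulmon (u :: l)))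
    (fun f x => dot u x * iter k ad (mulmon l) f x + (2 * k)%:R * D u (iter k.-1 ad (mulmon l) f) x).
  by apply: ad_dotM; exact: PolOp_mulmon.
split=> [|k lk] f pf; rewrite E//; apply/funext => x.
  rewrite [size _]/= [_.-1]/= (IH2 _ (leqnn _) _ pf) (IH1 _ pf) mulr0 add0r.
  rewrite dunkl_scal; last exact: Pol_Dmon.
  by rewrite factS !natrM exprS -[Dmon (u :: l) f]/(D u (Dmon l f)); ring.
rewrite [size _]/= in lk; rewrite (IH2 _ (ltnW lk) _ pf) mulr0 add0r.
have lk' : (size l < k.-1)%N by case: k lk.
by rewrite (IH2 _ lk' _ pf) dunkl_cst mulr0.
Qed.

Lemma lap_sum I (s : seq I) (F : I -> vec -> R) x : (forall i, Pol (F i)) ->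
  L (fun x => \sum_(i <- s) F i x) x = \sum_(i <- s) L (F i) x.
Proof.
move=> pF; elim: s => [|i s IH].
  rewrite big_nil -[RHS](lap0 x); apply: lap_ext => y; by rewrite big_nil.
rewrite big_cons -IH -(lap_add x (pF i) (Pol_sum s pF)).
by apply: lap_ext => y; rewrite big_cons.
Qed.

Lemma ad_sum k I (s : seq I) (c : I -> R) (T : I -> (vec -> R) -> vec -> R) :
  (forall i, PolOp (T i)) ->
  eqop (iter k ad (fun f x => \sum_(i <- s) c i * T i f x))
    (fun f x => \sum_(i <- s) c i * iter k ad (T i) f x).
Proof.
move=> pT; elim: k => [//|k IH] f pf.
have pB i : Pol (iter k ad (T i) f) by exact: PolOp_ad.
rewrite iterS (ad_eqop IH pf); apply/funext => x; rewrite {1}/ad.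
rewrite lap_sum; last by move=> i; exact: PolZ.
rewrite -sumrB; apply: eq_bigr => i _.
by rewrite lap_scal// -mulrBr.
Qed.

Lemma iter_ad_0 k T : T (fun _ => 0) = (fun _ => 0) -> iter k ad T (fun _ => 0) = fun _ => 0.
Proof.
move=> T0; have L0 : L (fun _ => 0) = fun _ => 0 by apply/funext => x; exact: lap0.
by elim: k => [//|k IH]; rewrite iterS /ad L0 IH L0; apply/funext => x; rewrite subr0.
Qed.

(** [L (T f)] and [T (L f)] both lie two degrees below [T f]. The zero cases are kept by [PolHz],
    which is why [T] must send 0 to 0. *)
Lemma PolHz_ad m T k e f : T (fun _ => 0) = (fun _ => 0) ->
  (forall e f, PolH e f -> PolH (m + e) (T f)) -> PolH e f ->
  PolHz (m + e) (2 * k) (iter k ad T f).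
Proof.
move=> T0 hT; elim: k e f => [|k IH] e f pf.
  by rewrite muln0 /PolHz leq0n subn0; exact: hT.
apply: (@PolHz_ext _ _ _ _ (fun x => L (iter k ad T f) x + (-1) * iter k ad T (L f) x)).
  by move=> x; rewrite mulN1r.
apply: PolHz_add; first by rewrite mulnS; apply: PolHz_lap; exact: IH.
apply: PolHzZ.
have : PolHz e 2 (L f) by apply: PolHz_lap; rewrite /PolHz leq0n subn0.
rewrite {1}/PolHz; case: ifPn => [e2 /IH|_ ->]; last by rewrite iter_ad_0//; exact: PolHz0.
by rewrite /PolHz addnBA// mulnS leq_subRL ?subnDA// (leq_trans e2)// leq_addl.
Qed.

(* A linear functional with the properties of integration over the sphere against [hk ^+ 2] *)
Section functional.
Variables (Lam : (vec -> R) -> R) (lam2 : R).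
Hypotheses
  (Lam_add : forall f g, Pol f -> Pol g -> Lam (fun x => f x + g x) = Lam f + Lam g)
  (Lam_scal : forall c f, Pol f -> Lam (fun x => c * f x) = c * Lam f)
  (Lam_refl : forall a f, a \in Rp -> Pol f -> Lam (f \o refl a) = Lam f)
  (Lam_opp : forall f, Pol f -> Lam (fun x => f (- x)) = Lam f)
  (Lam_dunkl : forall k j f, PolH k f ->
     Lam (D (ebasis R j) f) = (k%:R + 1 + lam2) * Lam (fun x => dot (ebasis R j) x * f x))
  (lam2_ge : -1 <= lam2).

Lemma Lam_ext f g : f =1 g -> Lam f = Lam g.
Proof.
by move=> /funext ->.
Qed.

Lemma Lam0 : Lam (fun _ => 0) = 0.
Proof.
rewrite -[RHS](mul0r (Lam (fun _ => 0))) -Lam_scal; last exact: Pol_cst.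
by apply: Lam_ext => x; rewrite mul0r.
Qed.

Lemma Lam_sub f g : Pol f -> Pol g -> Lam (fun x => f x - g x) = Lam f - Lam g.
Proof.
move=> pf pg; rewrite (@Lam_ext _ (fun x => f x + (-1) * g x)); last by move=> x; rewrite mulN1r.
by rewrite Lam_add ?Lam_scal ?mulN1r//; exact: PolZ.
Qed.

Lemma Lam_sum I (s : seq I) (F : I -> vec -> R) : (forall i, Pol (F i)) ->
  Lam (fun x => \sum_(i <- s) F i x) = \sum_(i <- s) Lam (F i).
Proof.
move=> pF; elim: s => [|i s IH].
  by rewrite big_nil -[RHS]Lam0; apply: Lam_ext => x; rewrite big_nil.
rewrite big_cons -IH -Lam_add//; last exact: Pol_sum.
by apply: Lam_ext => x; rewrite big_cons.
Qed.

Lemma Lam_sum_Rp (F : vec -> vec -> R) : (forall a, a \in Rp -> Pol (F a)) ->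
  Lam (fun x => \sum_(a <- Rp) F a x) = \sum_(a <- Rp) Lam (F a).
Proof.
move=> pF; pose G a : vec -> R := if a \in Rp then F a else fun _ => 0.
rewrite (@Lam_ext _ (fun x => \sum_(a <- Rp) G a x)); last first.
  by move=> y; apply: sum_Rp_ext => a aR; rewrite /G aR.
rewrite Lam_sum; last by move=> a; rewrite /G; case: ifP => [/pF//|_]; exact: Pol_cst.
by apply: sum_Rp_ext => a aR; rewrite /G aR.
Qed.

Lemma diffq_refl a f x : a != 0 -> diffq a f (refl a x) = diffq a f x.
Proof.
move=> a0; rewrite /diffq dot_refl_self// oppr_eq0; case: ifPn => [ax|].
  by rewrite reflK// invrN mulrN -mulNr opprB.
by rewrite negbK => /eqP ax; rewrite refl_fix.
Qed.

Lemma derive_M f g x xi : Pol f -> Pol g ->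
  derive (fun x => f x * g x) x xi = f x * derive g x xi + g x * derive f x xi.
Proof.
by move=> pf pg; rewrite (deriveM (@Pol_derivable _ _ f pf x xi) (@Pol_derivable _ _ g pg x xi)).
Qed.

(** The rule is put in a form symmetric in [f] and [g]. The defect is [dot a], odd under [refl a],
    times two quotients that [refl a] leaves invariant. *)
Lemma diffqM a f g x : Pol f -> Pol g ->
  diffq a (fun x => f x * g x) x = diffq a f x * g x + f x * diffq a g x
   - dot a x * (diffq a f x * diffq a g x).
Proof.
move=> pf pg; rewrite /diffq; case: ifPn => [ax|]; first by field.
by rewrite negbK => /eqP ax; rewrite ax derive_M//; ring.
Qed.

Lemma dunklM xi f g x : Pol f -> Pol g ->
  D xi (fun x => f x * g x) x = D xi f x * g x + f x * D xi g x
   - \sum_(a <- Rp) kappa a * dot a xi * (dot a x * (diffq a f x * diffq a g x)).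
Proof.
move=> pf pg; rewrite /dunkl derive_M//.
rewrite (sum_Rp_ext (G := fun a => kappa a * dot a xi * diffq a f x * g x
   + f x * (kappa a * dot a xi * diffq a g x)
   - kappa a * dot a xi * (dot a x * (diffq a f x * diffq a g x)))); last first.
  by move=> a _; rewrite diffqM//; ring.
by rewrite sumrB big_split /= -mulr_suml -mulr_sumr; ring.
Qed.

(* The defect of the product rule is odd under each reflection, hence integrates to zero *)
Lemma Lam_dunklM k k' j f g : PolH k f -> PolH k' g ->
  Lam (fun x => D (ebasis R j) f x * g x) + Lam (fun x => f x * D (ebasis R j) g x)
  = ((k + k')%:R + 1 + lam2) * Lam (fun x => dot (ebasis R j) x * (f x * g x)).
Proof.
move=> hf hg; have pf := PolH_Pol hf; have pg := PolH_Pol hg.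
rewrite -(Lam_dunkl j (PolHM hf hg)).
have pDf := Pol_dunkl (ebasis R j) pf; have pDg := Pol_dunkl (ebasis R j) pg.
have pT a : a \in Rp -> Pol (fun x => dot a x * (diffq a f x * diffq a g x)).
  by move=> /pos_root_neq0 a0; apply: Pol_dotM; apply: PolM; exact: Pol_diffq.
rewrite (@Lam_ext (D _ (fun x => f x * g x)) (fun x =>
   (D (ebasis R j) f x * g x + f x * D (ebasis R j) g x)
   - \sum_(a <- Rp) kappa a * dot a (ebasis R j) * (dot a x * (diffq a f x * diffq a g x)))); last first.
  by move=> x; rewrite dunklM.
rewrite Lam_sub; first last.
- by apply: Pol_sum_Rp => a aR; apply: PolZ; exact: pT.
- by apply: Pol_add; exact: PolM.
rewrite Lam_add; [|exact: PolM..].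
rewrite Lam_sum_Rp; last by move=> a aR; apply: PolZ; exact: pT.
rewrite big_seq big1 ?subr0// => a aR; have a0 := pos_root_neq0 aR.
rewrite Lam_scal; last exact: pT.
have : Lam (fun x => dot a x * (diffq a f x * diffq a g x)) =
  (-1) * Lam (fun x => dot a x * (diffq a f x * diffq a g x)).
  rewrite -{1}(Lam_refl aR (pT a aR)) -Lam_scal; last exact: pT.
  by apply: Lam_ext => x /=; rewrite !diffq_refl// dot_refl_self//; ring.
by move=> h; rewrite [X in _ * X](_ : _ = 0) ?mulr0//; lra.
Qed.

Lemma dunkl_euler k f x : PolH k f ->
  \sum_(j < d) dot (ebasis R j) x * D (ebasis R j) f x
  = k%:R * f x + \sum_(a <- Rp) kappa a * (f x - f (refl a x)).
Proof.
move=> hf; have pf := PolH_Pol hf.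
rewrite -(euler x hf) /dunkl.
transitivity (\sum_(j < d) (x 0 j * derive f x (ebasis R j)
   + \sum_(a <- Rp) a 0 j * x 0 j * (kappa a * diffq a f x))).
  apply: eq_bigr => j _; rewrite (dotC _ x) dot_ebasis mulrDr; congr (_ + _).
  by rewrite mulr_sumr; apply: eq_bigr => a _; rewrite dot_ebasis; ring.
rewrite big_split /= exchange_big /=; congr (_ + _).
apply: eq_bigr => a _; rewrite -mulr_suml -/(dot a x) mulrCA dot_diffq.
by [].
Qed.

(** [half] evaluates [Lam (f2 * L f1)] plus the Dirichlet form of [f1] and [f2]. The Dirichlet form
    is symmetric, and so is the sum over the roots, reflections being self-adjoint for [Lam].
    Subtracting the two instances leaves the difference of the degrees as the only asymmetry. *)
Lemma Lam_green k m f q : PolH k f -> PolH m q -> (forall x, L q x = 0) ->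
  Lam (fun x => q x * L f x) = (k%:R - m%:R) * (k%:R + m%:R + lam2) * Lam (fun x => q x * f x).
Proof.
move=> hf hq q0; have pf := PolH_Pol hf; have pq := PolH_Pol hq.
pose e j := ebasis R j : vec.
have half k1 k2 f1 f2 : PolH k1 f1 -> PolH k2 f2 ->
    Lam (fun x => f2 x * L f1 x) + \sum_(j < d) Lam (fun x => D (e j) f1 x * D (e j) f2 x)
    = (k1%:R + k2%:R + lam2) * (k1%:R * Lam (fun x => f1 x * f2 x)
      + \sum_(a <- Rp) kappa a * (Lam (fun x => f1 x * f2 x) - Lam (fun x => f1 (refl a x) * f2 x))).
  move=> h1 h2; have p1 := PolH_Pol h1; have p2 := PolH_Pol h2.
  have pD1 j : Pol (D (e j) f1) by exact: Pol_dunkl.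
  have pD2 j : Pol (D (e j) f2) by exact: Pol_dunkl.
  have pDD j : Pol (D (e j) (D (e j) f1)) by exact: Pol_dunkl.
  have -> : Lam (fun x => f2 x * L f1 x) = \sum_(j < d) Lam (fun x => D (e j) (D (e j) f1) x * f2 x).
    rewrite -Lam_sum; last by move=> j; exact: PolM.
    by apply: Lam_ext => x; rewrite mulrC /dunkl_lap mulr_suml.
  rewrite -big_split /=.
  have step j : Lam (fun x => D (e j) (D (e j) f1) x * f2 x) + Lam (fun x => D (e j) f1 x * D (e j) f2 x)
     = (k1%:R + k2%:R + lam2) * Lam (fun x => dot (e j) x * D (e j) f1 x * f2 x).
    (* Where the degree drops to [k1 - 1] the common factor is [(k1 - 1 + k2) + 1 + lam2]; for
       [k1 = 0] the derivative vanishes and both sides are 0. *)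
    have := PolHz_dunkl (e j) h1; rewrite /PolHz; case: ifPn => [k1_gt0 hD|_ hD].
      rewrite (Lam_dunklM j hD h2) natrD natrB// (@Lam_ext _ (fun x => dot (e j) x * D (e j) f1 x * f2 x)).
        by congr (_ * _); ring.
      by move=> x; rewrite mulrA.
    rewrite !(@Lam_ext _ (fun _ => 0)) ?Lam0 ?addr0 ?mulr0// => x; rewrite hD ?mulr0 ?mul0r//.
    by rewrite dunkl_cst mul0r.
  under eq_bigr do rewrite step.
  rewrite -mulr_sumr; congr (_ * _).
  rewrite -Lam_sum; last by move=> j; apply: PolM => //; exact: Pol_dotM.
  rewrite (@Lam_ext _ (fun x => k1%:R * (f1 x * f2 x)
      + \sum_(a <- Rp) kappa a * (f1 x * f2 x - f1 (refl a x) * f2 x))); last first.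
    move=> x; rewrite -mulr_suml (dunkl_euler x h1) mulrDl mulrA mulr_suml; congr (_ + _).
    by apply: eq_bigr => a _; ring.
  have p12 : Pol (fun x => f1 x * f2 x) by exact: PolM.
  have pr a : a \in Rp -> Pol (fun x => f1 (refl a x) * f2 x).
    by move=> aR; apply: PolM => //; exact: Pol_reflR aR p1.
  rewrite Lam_add; first last.
  - by apply: Pol_sum_Rp => a aR; apply: PolZ; apply: PolB => //; exact: pr.
  - exact: PolZ.
  rewrite Lam_scal//; congr (_ + _).
  rewrite Lam_sum_Rp; last by move=> a aR; apply: PolZ; apply: PolB => //; exact: pr.
  apply: sum_Rp_ext => a aR; rewrite Lam_scal; last by apply: PolB => //; exact: pr.
  by rewrite Lam_sub//; exact: pr.
have H1 := half _ _ _ _ hf hq; have H2 := half _ _ _ _ hq hf.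
have Z : Lam (fun x => f x * L q x) = 0.
  by rewrite -[RHS]Lam0; apply: Lam_ext => x; rewrite q0 mulr0.
have C1 : \sum_(j < d) Lam (fun x => D (e j) q x * D (e j) f x) =
    \sum_(j < d) Lam (fun x => D (e j) f x * D (e j) q x).
  by apply: eq_bigr => j _; apply: Lam_ext => x; rewrite mulrC.
have C2 : Lam (fun x => f x * q x) = Lam (fun x => q x * f x).
  by apply: Lam_ext => x; rewrite mulrC.
have C3 : \sum_(a <- Rp) kappa a * (Lam (fun x => f x * q x) - Lam (fun x => f (refl a x) * q x))
  = \sum_(a <- Rp) kappa a * (Lam (fun x => q x * f x) - Lam (fun x => q (refl a x) * f x)).
  apply: sum_Rp_ext => a aR; congr (_ * (_ - _)); first exact: C2.
  rewrite -(Lam_refl aR (PolM (Pol_reflR aR pf) pq)).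
  by apply: Lam_ext => x /=; rewrite reflK ?(pos_root_neq0 aR)// mulrC.
have arith (A S1 S2 P1 P2 T1 T2 W al be : R) :
    A + S1 = (al + be + lam2) * (al * P1 + T1) -> W + S2 = (be + al + lam2) * (be * P2 + T2) ->
    W = 0 -> S2 = S1 -> P1 = P2 -> T1 = T2 -> A = (al - be) * (al + be + lam2) * P2.
  move=> h1 h2 W0 S12 P12 T12; move: h1 h2; rewrite W0 S12 P12 T12 add0r => h1 h2.
  by apply: (addIr S1); rewrite h1 h2; ring.
exact: (arith _ _ _ _ _ _ _ _ _ _ H1 H2 Z C1 C2 C3).
Qed.

Lemma Lam_odd k f : PolH k f -> odd k -> Lam f = 0.
Proof.
move=> hf ok; have pf := PolH_Pol hf.
have : Lam f = (-1) * Lam f.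
  rewrite -{1}(Lam_opp pf) -Lam_scal//; apply: Lam_ext => x.
  by rewrite -scaleN1r (PolH_scale _ _ hf) -signr_odd ok expr1.
by move=> h; lra.
Qed.

(** Green's formula relates the pairing of [q] with [f] to that with [L f], two degrees lower. By
    induction the latter vanishes, and the factor in front is nonzero. *)
Lemma Lam_lowdeg k m f q : PolH k f -> PolH m q -> (forall x, L q x = 0) -> (k < m)%N ->
  Lam (fun x => q x * f x) = 0.
Proof.
move=> hf hq q0; move: f hf; elim/ltn_ind: k => k IH f hf k_lt_m.
have [ok|ek] := boolP (odd (m + k)); first by apply: (Lam_odd (PolHM hq hf)).
have G := Lam_green hf hq q0.
have Z : Lam (fun x => q x * L f x) = 0.
  have : PolHz k 2 (L f) by apply: PolHz_lap; rewrite /PolHz leq0n subn0.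
  rewrite /PolHz; case: ifPn => [k2 h|_ ->].
    apply: IH h _; first by rewrite ltn_subrL (leq_trans _ k2).
    by rewrite (leq_ltn_trans (leq_subr _ _)).
  by rewrite -[RHS]Lam0; apply: Lam_ext => x; rewrite mulr0.
(* Equal parity widens the gap to 2, so [k + m >= 2]. This secures [k + m + lam2 > 0] even for
   [lam2 = -1], where [k = 0], [m = 1] would give 0. *)
have m2 : (k.+2 <= m)%N.
  rewrite ltn_neqAle k_lt_m andbT; apply: contra ek => /eqP <-.
  by rewrite addSn addnn /= odd_double.
have mk : k%:R + 2 <= m%:R :> R by rewrite -natrD ler_nat addn2.
have k0 : 0 <= k%:R :> R by exact: ler0n.
move: G; rewrite Z => /esym/eqP; rewrite !mulf_eq0.
case/orP => [/orP[]|/eqP//].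
  by rewrite subr_eq0 eqr_nat (ltn_eqF k_lt_m).
move=> /eqP h; have lg := lam2_ge.
have pos : 0 < k%:R + m%:R + lam2 by lra.
by rewrite h ltxx in pos.
Qed.

Lemma Lam_lap_iter m n f q : PolH (m + 2 * n) f -> PolH m q -> (forall x, L q x = 0) ->
  Lam (fun x => q x * iter n L f x)
  = (\prod_(i < n) (2 * i.+1%:R * (2 * (m%:R + i.+1%:R) + lam2))) * Lam (fun x => q x * f x).
Proof.
move=> + hq q0; elim: n f => [|n IH] f hf; first by rewrite big_ord0 mul1r.
have hLf : PolH (m + 2 * n) (L f).
  have : PolHz (m + 2 * n.+1) 2 (L f) by apply: PolHz_lap; rewrite /PolHz leq0n subn0.
  by rewrite /PolHz mulnS addnCA leq_addr addKn.
rewrite iterSr (IH _ hLf) (Lam_green hf hq q0) big_ord_recr /= !mulrA; congr (_ * _).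
by rewrite !natrD natrM -[n.+1%:R]natr1; ring.
Qed.

(** Stated for an abstract [T], of which only the vanishing of [Lam (T f)] below degree [m] matters.
    The [i]-th factor is the effect of one outer Laplacian in degree [2 (m - i)]. *)
Lemma Lam_ad m T f : PolH m f -> T (fun _ => 0) = (fun _ => 0) ->
  (forall e f, PolH e f -> PolH (m + e) (T f)) -> PolOp T ->
  (forall e f, (e < m)%N -> PolH e f -> Lam (T f) = 0) ->
  forall k, (k <= m)%N ->
  Lam (iter k ad T f) =
  (\prod_(i < k) (2 * (m - i)%:R * (2 * (m - i)%:R + lam2))) * Lam (T f).
Proof.
move=> hf T0 hT pT Tlow.
have one0 (x : vec) : L (fun _ => 1) x = 0.
  by rewrite /dunkl_lap big1// => j _; rewrite /dunklj (@dunkl_ext _ _ (fun _ => 0)) ?dunkl_cst// => y; rewrite dunkl_cst.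
(* Green's formula against the harmonic constant 1. *)
have Lam_lap k g : PolH k g -> Lam (L g) = k%:R * (k%:R + lam2) * Lam g.
  move=> hg; have := Lam_green hg (PolH_cst _ 1) one0.
  rewrite subr0 addr0 (@Lam_ext _ (L g)) => [->|x]; last by rewrite mul1r.
  by congr (_ * _); apply: Lam_ext => x; rewrite mul1r.
have Lam_lapz k n g : PolHz k n g -> (n <= k)%N ->
    Lam (L g) = (k - n)%:R * ((k - n)%:R + lam2) * Lam g.
  by move=> + nk; rewrite /PolHz nk => /Lam_lap.
(* An outer [L] multiplies a value already known to be 0, and an inner [L] lowers [e] further, so
   vanishing persists under [ad]. *)
have low k e g : (e < m)%N -> PolH e g -> Lam (iter k ad T g) = 0.
  elim: k e g => [|k IH] e g em hg; first exact: Tlow em hg.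
  have pg := PolH_Pol hg.
  rewrite iterS /ad Lam_sub; first last.
  - by apply: PolOp_ad => //; exact: Pol_lap.
  - by apply: Pol_lap; exact: PolOp_ad.
  have hA := PolHz_ad k T0 hT hg.
  have -> : Lam (L (iter k ad T g)) = 0.
    have [ke|ke] := leqP (2 * k) (m + e); first by rewrite (Lam_lapz _ _ _ hA ke) (IH _ _ em hg) mulr0.
    move: hA; rewrite /PolHz leqNgt ke /= => ->.
    by rewrite -[RHS]Lam0; apply: Lam_ext => x; exact: lap0.
  rewrite sub0r; apply/eqP; rewrite oppr_eq0; apply/eqP.
  have : PolHz e 2 (L g) by apply: PolHz_lap; rewrite /PolHz leq0n subn0.
  rewrite /PolHz; case: ifPn => [e2 hLg|_ ->]; last by rewrite iter_ad_0// Lam0.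
  by apply: IH hLg; rewrite (leq_ltn_trans (leq_subr _ _)).
elim=> [|k IH] k_lt_m; first by rewrite big_ord0 mul1r.
have pf := PolH_Pol hf.
rewrite iterS /ad Lam_sub; first last.
- by apply: PolOp_ad => //; exact: Pol_lap.
- by apply: Pol_lap; exact: PolOp_ad.
have -> : Lam (iter k ad T (L f)) = 0.
  have : PolHz m 2 (L f) by apply: PolHz_lap; rewrite /PolHz leq0n subn0.
  rewrite /PolHz; case: ifPn => [e2 hLg|_ ->]; last by rewrite iter_ad_0// Lam0.
  by apply: low hLg; rewrite ltn_subrL (leq_trans _ e2).
have hA := PolHz_ad k T0 hT hf.
have km' : (2 * k <= m + m)%N by rewrite addnn -mul2n leq_mul2l ltnW.
rewrite subr0 (Lam_lapz _ _ _ hA km') (IH (ltnW k_lt_m)) big_ord_recr /= mulrA; congr (_ * _).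
rewrite addnn -mul2n -mulnBr natrM; ring.
Qed.

End functional.

(** * Integration by parts against the weight *)

Definition wt x : R := \prod_(a <- Rs) (`|dot a x| `^ kappa a).
(* [wt] is [hk ^+ 2], by [hk_wt]; [wte e] is a smooth regularization of it. *)
Definition wte (e : R) x : R := \prod_(a <- Rs) ((dot a x ^+ 2 + e) `^ (kappa a / 2)).

Lemma kappaR_ge0 a : a \in Rs -> 0 <= kappa a.
Proof.
exact: km.1.
Qed.

Lemma hk_wt x : hk Rp kappa x ^+ 2 = wt x.
Proof.
rewrite /hk /wt prod_pos_roots// => a aR.
by rewrite dotNl normrN kappaN.
Qed.

(** For [r = 0] the law fails only when [s + t = 0] with [s != 0], which nonnegativity excludes. *)
Lemma powRD_ge0 (r s t : R) : 0 <= s -> 0 <= t -> r `^ (s + t) = r `^ s * r `^ t.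
Proof.
move=> s0 t0; have [r0|r0] := eqVneq r 0; last by rewrite powRD// r0 implybT.
have [st|st] := eqVneq (s + t) 0; last by rewrite powRD// (negbTE st).
have -> : s = 0 by lra.
have -> : t = 0 by lra.
by rewrite addr0 powRr0 mulr1.
Qed.

Lemma wtZ r x : 0 <= r -> wt (r *: x) = r `^ (2 * \sum_(a <- Rp) kappa a) * wt x.
Proof.
move=> r0; rewrite -sum_pos_roots; last by move=> a aR; exact: kappaN.
rewrite /wt; have : forall a, a \in Rs -> 0 <= kappa a by exact: kappaR_ge0.
elim: (Rs) => [|a l IH] k0; first by rewrite !big_nil powRr0 mulr1.
have k0' b : b \in l -> 0 <= kappa b by move=> bl; apply: k0; rewrite inE bl orbT.
rewrite !big_cons (IH k0') powRD_ge0; first last.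
- by rewrite big_seq; apply: sumr_ge0 => b; exact: k0'.
- by apply: k0; rewrite inE eqxx.
by rewrite dotZr normrM (ger0_norm r0) powRM//; ring.
Qed.

(** Since the product runs over all of [Rs], invariance is a reindexing by [refl_roots_perm]. *)
Lemma wt_refl b x : b \in Rp -> wt (refl b x) = wt x.
Proof.
move=> /pos_root_mem bR; rewrite /wt -[RHS](perm_big _ (refl_roots_perm bR)) big_map /=.
rewrite big_seq [RHS]big_seq; apply: eq_bigr => a aR.
by rewrite kappa_refl// dot_reflC.
Qed.

Lemma wte_refl e b x : b \in Rp -> wte e (refl b x) = wte e x.
Proof.
move=> /pos_root_mem bR; rewrite /wte -[RHS](perm_big _ (refl_roots_perm bR)) big_map /=.
rewrite big_seq [RHS]big_seq; apply: eq_bigr => a aR.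
by rewrite kappa_refl// dot_reflC.
Qed.

Lemma wtN x : wt (- x) = wt x.
Proof.
by apply: eq_bigr => a _; rewrite dotNr normrN.
Qed.

Lemma wt_ge0 x : 0 <= wt x.
Proof.
by apply: prodr_ge0 => a _; exact: powR_ge0.
Qed.

Lemma wte_ge0 e x : 0 <= wte e x.
Proof.
by apply: prodr_ge0 => a _; exact: powR_ge0.
Qed.

Lemma ball_bdd_Pol f : Pol f -> ball_bdd f.
Proof.
elim=> *; [exact: ball_bdd_cst|apply: ball_bddM => //; exact: ball_bdd_dot|exact: ball_bddD].
Qed.

Lemma ball_bdd_powR f (s : R) : ball_bdd f -> (forall x, 0 <= f x) -> 0 <= s -> ball_bdd (fun x => f x `^ s).
Proof.
move=> [mf [C fC]] f0 s0; split.
  by apply: (row_meas_comp (f := @powR R ^~ s)) => //; exact: measurable_powR.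
exists (`|C| `^ s) => x x1; rewrite ger0_norm ?powR_ge0//.
apply: (ge0_ler_powR s0); rewrite ?nnegrE//.
by rewrite -[f x]ger0_norm// (le_trans (fC x x1)) ?ler_norm.
Qed.

Lemma ball_bdd_norm f : ball_bdd f -> ball_bdd (fun x => `|f x|).
Proof.
move=> [mf [C fC]]; split; first by apply: (row_meas_comp (f := @Num.Def.normr R R)) => //; exact: normr_measurable.
by exists C => x x1; rewrite normr_id; exact: fC.
Qed.

Lemma ball_bdd_prod_seq (l : seq vec) (F : vec -> vec -> R) : (forall a, a \in l -> ball_bdd (F a)) ->
  ball_bdd (fun x => \prod_(a <- l) F a x).
Proof.
elim: l => [|a l IH] bF.
  by apply: ball_bdd_ext (@ball_bdd_cst R d 1) => x; rewrite big_nil.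
have bl : ball_bdd (fun x => \prod_(b <- l) F b x).
  by apply: IH => b bl; apply: bF; rewrite inE bl orbT.
have ba : ball_bdd (F a) by apply: bF; rewrite inE eqxx.
by apply: ball_bdd_ext (ball_bddM ba bl) => x; rewrite big_cons.
Qed.

Lemma ball_bdd_wt : ball_bdd wt.
Proof.
apply: ball_bdd_prod_seq => a aR; apply: ball_bdd_powR => //; last exact: kappaR_ge0.
by apply: ball_bdd_norm; exact: ball_bdd_dot.
Qed.

Lemma ball_bdd_wte e : 0 < e -> ball_bdd (wte e).
Proof.
move=> e0; apply: ball_bdd_prod_seq => a aR; apply: ball_bdd_powR => //.
- apply: ball_bddD; last exact: ball_bdd_cst.
  by apply: (ball_bdd_ext (F := fun x => dot a x * dot a x)) => [x|]; [rewrite expr2|apply: ball_bddM; exact: ball_bdd_dot].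
- by move=> x; rewrite addr_ge0 ?sqr_ge0// ltW.
- by rewrite divr_ge0// kappaR_ge0.
Qed.

Lemma ball_bdd_inv a (e : R) : 0 < e -> ball_bdd (fun x => (dot a x ^+ 2 + e)^-1).
Proof.
move=> e0; have p x : 0 < dot a x ^+ 2 + e by rewrite ltr_wpDl ?sqr_ge0.
split.
  rewrite (_ : (fun x => _) = (@powR R ^~ (-1)) \o (fun x => dot a x ^+ 2 + e)); last first.
    by apply/funext => x /=; rewrite powR_inv1// ltW.
  apply: row_meas_comp; first exact: measurable_powR.
  apply: row_measD; last exact: row_meas_cst.
  by apply: measurable_funX; exact: row_meas_dot.
exists e^-1 => x _; rewrite ger0_norm ?invr_ge0; last exact: (ltW (p x)).
by rewrite lef_pV2 ?posrE// lerDr sqr_ge0.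
Qed.

(** Vanishes on the unit sphere, so that integration along a chord of the ball leaves no boundary
    terms. *)
Definition onem2 x : R := 1 - dot x x.

Lemma Pol_onem2 : Pol onem2.
Proof.
suff : Pol (fun x => 1 - dot x x) by [].
apply: PolB; first exact: Pol_cst.
apply: Pol_sum => i.
by apply: (Pol_ext (f := fun x => dot (ebasis R i) x * dot (ebasis R i) x)) =>
  [x|]; [rewrite dotC dot_ebasis|apply: PolM; exact: Pol_dot].
Qed.

Lemma is_derive_congr (F G : R -> R) (z dF dG : R) : is_derive z (1 : R) F dF ->
  F =1 G -> dF = dG -> is_derive z (1 : R) G dG.
Proof.
by move=> h /funext <- <-.
Qed.

Lemma sqrDe_gt0 a (e : R) x : 0 < e -> 0 < dot a x ^+ 2 + e.
Proof.
by move=> e0; rewrite ltr_wpDl ?sqr_ge0.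
Qed.

Section line.
Variables (t : d.-tuple R) (j : 'I_d).
Local Notation X := (fun z : R => @row_of_tuple R d (upd t j z)).

Lemma lineD (h z : R) : X (h *: 1 + z) = h *: ebasis R j + X z.
Proof.
apply/rowP => i; rewrite !mxE !tnth_mktuple /=.
by case: (i == j); rewrite ?mulr1 ?mulr0 ?add0r// /GRing.scale/= mulr1.
Qed.

Lemma is_derive_line f z : derivable f (X z) (ebasis R j) ->
  is_derive z (1 : R) (f \o X) (derive f (X z) (ebasis R j)).
Proof.
move=> df; have E : (fun h : R => h^-1 *: (((f \o X) \o shift z) (h *: 1) - (f \o X) z)) =
    (fun h : R => h^-1 *: ((f \o shift (X z)) (h *: ebasis R j) - f (X z))).
  by apply/funext => h /=; rewrite lineD.
by split; rewrite /derivable /derive E.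
Qed.

Lemma is_derive_line_dot a z : is_derive z (1 : R) (dot a \o X) (a 0 j).
Proof.
have [dv ev] := is_derive_dot a (X z) (ebasis R j).
by have := is_derive_line dv; rewrite ev dot_ebasis.
Qed.

Lemma is_derive_line_Pol f z : Pol f -> is_derive z (1 : R) (f \o X) (derive f (X z) (ebasis R j)).
Proof.
by move=> pf; apply: is_derive_line; exact: Pol_derivable.
Qed.

(** The derivative is written as the function times its logarithmic derivative; for products of such
    factors the logarithmic derivatives simply add. *)
Lemma is_derive_line_factor a (e k z : R) : 0 < e ->
  is_derive z (1 : R) (fun z => (dot a (X z) ^+ 2 + e) `^ k)
   ((dot a (X z) ^+ 2 + e) `^ k * (k * (2 * dot a (X z) * a 0 j) / (dot a (X z) ^+ 2 + e))).
Proof.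
move=> e0; have y0 := sqrDe_gt0 a (X z) e0.
have D1 := is_derive_line_dot a z.
have D2 : is_derive z (1 : R) (fun z => dot a (X z) ^+ 2 + e) (2 * dot a (X z) * a 0 j).
  apply: (is_derive_congr (is_deriveD (is_deriveM D1 D1) (is_derive_cst e z 1))).
    by move=> y; rewrite expr2.
  by rewrite /= /GRing.scale/=; ring.
have D3 := is_derive1_powR k y0.
have D4 : is_derive z (1 : R) ((@powR R ^~ k) \o (fun z : R => dot a (X z) ^+ 2 + e))
    (k * (dot a (X z) ^+ 2 + e) `^ (k - 1) * (2 * dot a (X z) * a 0 j)).
  by apply: is_derive1_comp.
apply: (is_derive_congr D4) => //.
rewrite powRB; last by rewrite (gt_eqF y0) implybT.
by rewrite powRr1 ?ltW//; field; exact: lt0r_neq0.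
Qed.

Lemma is_derive_line_prod (l : seq vec) (k : vec -> R) (e z : R) : 0 < e ->
  is_derive z (1 : R) (fun z => \prod_(a <- l) (dot a (X z) ^+ 2 + e) `^ k a)
   ((\prod_(a <- l) (dot a (X z) ^+ 2 + e) `^ k a) *
    \sum_(a <- l) k a * (2 * dot a (X z) * a 0 j) / (dot a (X z) ^+ 2 + e)).
Proof.
move=> e0; elim: l => [|a l IH].
  apply: (is_derive_congr (is_derive_cst (1 : R) z 1)); last by rewrite !big_nil mulr0.
  by move=> y; rewrite big_nil.
apply: (is_derive_congr (is_deriveM (is_derive_line_factor a (k a) z e0) IH)).
  by move=> y; rewrite big_cons.
by rewrite !big_cons /GRing.scale/=; ring.
Qed.

Lemma is_derive_continuous (F : R -> R) (z dF : R) : is_derive z (1 : R) F dF -> {for z, continuous F}.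
Proof.
by move=> [dFz _]; apply: differentiable_continuous; apply/derivable1_diffP.
Qed.

Lemma continuous_line_Pol f : Pol f -> continuous (f \o X).
Proof.
by move=> pf z; apply: is_derive_continuous; exact: is_derive_line_Pol.
Qed.

Lemma continuous_line_sum (l : seq vec) (k : vec -> R) (e : R) : 0 < e ->
  continuous (fun z => \sum_(a <- l) k a * (2 * dot a (X z) * a 0 j) / (dot a (X z) ^+ 2 + e)).
Proof.
move=> e0; elim: l => [|a l IH] z.
  by rewrite (_ : (fun z => _) = cst 0); [exact: cvg_cst|apply/funext => y; rewrite big_nil].
rewrite (_ : (fun z => _) = (fun z => k a * (2 * dot a (X z) * a 0 j) / (dot a (X z) ^+ 2 + e)
    + \sum_(a <- l) k a * (2 * dot a (X z) * a 0 j) / (dot a (X z) ^+ 2 + e))); last first.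
  by apply/funext => y; rewrite big_cons.
have ca := continuous_line_Pol (Pol_dot a) (x := z).
apply: cvgD; last exact: IH.
apply: cvgM.
  apply: cvgM; first exact: cvg_cst.
  apply: cvgM; last exact: cvg_cst.
  by apply: cvgM; [exact: cvg_cst|exact: ca].
apply: cvgV; first by rewrite gt_eqF// sqrDe_gt0.
apply: cvgD; last exact: cvg_cst.
by rewrite expr2; apply: cvgM; exact: ca.
Qed.

(** The partial derivative of [f * wte e * onem2] in direction [j], with that of the weight in
    logarithmic form. *)
Definition ibp_integrand f (e : R) x : R :=
  wte e x * ((derive f x (ebasis R j) * onem2 x - 2 * x 0 j * f x)
   + f x * onem2 x * \sum_(a <- Rs) (kappa a / 2) * (2 * dot a x * a 0 j) / (dot a x ^+ 2 + e)).

Lemma dot_line z : dot (X z) (X z) = z ^+ 2 + \sum_(i < d | i != j) tnth t i ^+ 2.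
Proof.
rewrite /dot (bigD1 j)//= mxE tnth_mktuple eqxx expr2; congr (_ + _).
by apply: eq_bigr => i ij; rewrite mxE tnth_mktuple (negbTE ij) expr2.
Qed.

Lemma integral_ibp f (e : R) : 0 < e -> Pol f ->
  (\int[@lebesgue_measure R]_z (cut (ibp_integrand f e) (X z))%:E = 0)%E.
Proof.
move=> e0 pf; pose rho := \sum_(i < d | i != j) tnth t i ^+ 2.
have ballE z : (enorm (X z) <= 1) = (z ^+ 2 <= 1 - rho).
  by rewrite -(expr_le1 (n := 2)) ?enorm_ge0// sqr_enorm dot_line lerBrDr.
have [rho1|rho1] := ltP (1 - rho) 0.
  apply: integral0_eq => z _; rewrite /cut ballE leNgt (lt_le_trans rho1) ?sqr_ge0//.
pose c := Num.sqrt (1 - rho).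
have c2 : c ^+ 2 = 1 - rho by rewrite sqr_sqrtr.
have c0 : 0 <= c by exact: sqrtr_ge0.
rewrite (_ : (fun z : R => _) = (fun z : R => (ibp_integrand f e (X z))%:E) \_ `[-c, c]); last first.
  apply/funext => z; rewrite patchE /cut ballE -c2.
  have -> : (z ^+ 2 <= c ^+ 2) = (z \in `[-c, c]).
    by rewrite in_itv/= -ler_norml -[z ^+ 2]real_normK ?num_real// ler_sqr ?nnegrE.
  by rewrite mem_setE; case: ifP.
rewrite -integral_mkcond.
move: c0; rewrite le_eqVlt => /predU1P[c_eq0|c0].
  by rewrite -c_eq0 oppr0 set_itv1 integral_set1.
pose W z := f (X z) * (wte e (X z) * onem2 (X z)).
have dW z : is_derive z (1 : R) W (ibp_integrand f e (X z)).
  have D1 := is_derive_line_Pol z pf.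
  have D2 := is_derive_line_prod Rs (fun a => kappa a / 2) z e0.
  have D3 := is_derive_line_Pol z Pol_onem2.
  apply: (is_derive_congr (is_deriveM D1 (is_deriveM D2 D3))) => //.
  have -> : derive onem2 (X z) (ebasis R j) = - (2 * X z 0 j).
    have [_ <-] := D3.
    have : is_derive z (1 : R) (fun z : R => 1 - (z ^+ 2 + rho)) (- (2 * z)).
      apply: (is_derive_congr (is_deriveB (is_derive_cst (1 : R) z 1)
        (is_deriveD (is_deriveM (is_derive_id z (1 : R)) (is_derive_id z (1 : R))) (is_derive_cst rho z 1)))).
        by move=> y; rewrite expr2.
      by rewrite /= /GRing.scale/=; ring.
    have -> : onem2 \o X = fun z : R => 1 - (z ^+ 2 + rho).
      by apply/funext => y /=; rewrite /onem2 dot_line.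
    by move=> [_ ->]; rewrite mxE tnth_mktuple eqxx.
  rewrite /ibp_integrand; set S := \sum_(a <- Rs) _.
  transitivity (f (X z) * (wte e (X z) * - (2 * X z 0 j) + onem2 (X z) * (wte e (X z) * S))
    + wte e (X z) * onem2 (X z) * derive f (X z) (ebasis R j)); first by [].
  by ring.
rewrite (@integral_is_derive _ W (fun z => ibp_integrand f e (X z)))//.
- have onem0 z : z ^+ 2 = c ^+ 2 -> onem2 (X z) = 0.
    by rewrite /onem2 dot_line -/rho c2 => ->; rewrite subrK subrr.
  by rewrite /W (onem0 c)// (onem0 (- c)) ?sqrrN// !mulr0 subrr.
- by lra.
- apply: continuous_subspaceT => z; exact: is_derive_continuous (dW z).
apply: continuous_subspaceT => z.
have cD := continuous_line_Pol (Pol_derive (ebasis R j) pf) (x := z).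
have co := continuous_line_Pol Pol_onem2 (x := z).
have cf := continuous_line_Pol pf (x := z).
have cj : {for z, continuous (fun y : R => X y 0 j)}.
  have E : dot (ebasis R j) \o X = (fun y : R => X y 0 j).
    by apply/funext => y /=; rewrite dotC dot_ebasis.
  by rewrite -E; exact: continuous_line_Pol (Pol_dot _) z.
have cw := is_derive_continuous (is_derive_line_prod Rs (fun a => kappa a / 2) z e0).
have cS := @continuous_line_sum Rs (fun a => kappa a / 2) e e0 z.
apply: (cvgM cw); apply: cvgD; last by apply: cvgM => //; exact: cvgM.
apply: cvgB; first exact: cvgM.
apply: cvgM => //; apply: cvgM; [exact: cvg_cst|exact: cj].
Qed.

End line.

Lemma ball_int_sum_Rp (F : vec -> vec -> R) : (forall a, a \in Rp -> ball_bdd (F a)) ->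
  ball_int (fun x => \sum_(a <- Rp) F a x) = \sum_(a <- Rp) ball_int (F a).
Proof.
move=> bF; pose G a : vec -> R := if a \in Rp then F a else fun _ => 0.
rewrite (@ball_int_ext _ _ _ (fun x => \sum_(a <- Rp) G a x)); last first.
  by move=> y _; apply: sum_Rp_ext => a aR; rewrite /G aR.
rewrite ball_int_sum; last by move=> a; rewrite /G; case: ifP => [/bF//|_]; exact: ball_bdd_cst.
by apply: sum_Rp_ext => a aR; rewrite /G aR.
Qed.

Lemma ball_bdd_sum_Rp (F : vec -> vec -> R) : (forall a, a \in Rp -> ball_bdd (F a)) ->
  ball_bdd (fun x => \sum_(a <- Rp) F a x).
Proof.
move=> bF; pose G a : vec -> R := if a \in Rp then F a else fun _ => 0.
apply: (@ball_bdd_ext _ _ (fun x => \sum_(a <- Rp) G a x)).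
  by move=> y; apply: sum_Rp_ext => a aR; rewrite /G aR.
by apply: ball_bdd_sum => a; rewrite /G; case: ifP => [/bF//|_]; exact: ball_bdd_cst.
Qed.

Definition ibp_main (j : 'I_d) f x : R := derive f x (ebasis R j) * onem2 x - 2 * x 0 j * f x.

Lemma ball_bdd_ibp_main j f : Pol f -> ball_bdd (ibp_main j f).
Proof.
move=> pf; apply: ball_bddD.
  by apply: ball_bddM; apply: ball_bdd_Pol; [exact: Pol_derive|exact: Pol_onem2].
apply: ball_bddN; apply: ball_bddM; last exact: ball_bdd_Pol.
by apply: ball_bddM; [exact: ball_bdd_cst|exact: ball_bdd_coord].
Qed.

(** One factor [<a,x>] comes from [f - f \o refl a], the other from the derivative of the
    regularized weight. Off the wall the quotient tends to 1 as [e -> 0]. *)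
Definition ibp_root (e : R) a x : R := dot a x ^+ 2 / (dot a x ^+ 2 + e).

Lemma ball_bdd_ibp_root e a : 0 < e -> ball_bdd (ibp_root e a).
Proof.
move=> e0; apply: ball_bddM; last exact: ball_bdd_inv.
by apply: (ball_bdd_ext (F := fun x => dot a x * dot a x)) => [x|]; [rewrite expr2|apply: ball_bddM; exact: ball_bdd_dot].
Qed.

(* Averaging over [refl a] replaces [f] by [f - f \o refl a], a multiple of [dot a], in the term
   coming from the derivative of the regularized weight *)
Lemma ball_int_ibp_sym j f (e : R) : 0 < e -> Pol f ->
  ball_int (fun x => wte e x * ibp_main j f x + \sum_(a <- Rp) (kappa a * a 0 j) *
     (wte e x * onem2 x * (diffq a f x * ibp_root e a x))) = 0.
Proof.
move=> e0 pf.
have bA : ball_bdd (fun x => wte e x * ibp_main j f x) by apply: ball_bddM; [exact: ball_bdd_wte|exact: ball_bdd_ibp_main].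
pose H a x := wte e x * onem2 x * (f x * (dot a x * (dot a x ^+ 2 + e)^-1)).
have bWO : ball_bdd (fun x => wte e x * onem2 x).
  by apply: ball_bddM; [exact: ball_bdd_wte|apply: ball_bdd_Pol; exact: Pol_onem2].
have bH a : ball_bdd (H a).
  apply: ball_bddM => //; apply: ball_bddM; first exact: ball_bdd_Pol.
  by apply: ball_bddM; [exact: ball_bdd_dot|exact: ball_bdd_inv].
have bK a : a \in Rp -> ball_bdd (fun x => wte e x * onem2 x * (diffq a f x * ibp_root e a x)).
  move=> /pos_root_neq0 a0; apply: ball_bddM => //; apply: ball_bddM; last exact: ball_bdd_ibp_root.
  by apply: ball_bdd_Pol; exact: Pol_diffq.
have ibpE x : ibp_integrand j f e x =
    wte e x * ibp_main j f x + \sum_(a <- Rp) (2 * (kappa a * a 0 j)) * H a x.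
  rewrite /ibp_integrand mulrDr -/(ibp_main j f x); congr (_ + _).
  rewrite sum_pos_roots; last first.
    by move=> a aR; rewrite kappaN// dotNl mxE sqrrN; congr (_ / _); ring.
  rewrite !mulr_sumr; apply: eq_bigr => a _; rewrite /H; field.
  by rewrite gt_eqF// sqrDe_gt0.
have zero : ball_int (ibp_integrand j f e) = 0.
  apply: (@ball_int_line0 _ _ _ j); last by move=> t; exact: integral_ibp.
  apply: (ball_bdd_ext (fun x => esym (ibpE x))).
  by apply: ball_bddD => //; apply: ball_bdd_sum => a; exact: ball_bddZ.
rewrite -[RHS]zero (ball_int_ext (fun x _ => ibpE x)).
rewrite ball_intD//; last by apply: ball_bdd_sum_Rp => a aR; apply: ball_bddZ; exact: bK.
rewrite [RHS]ball_intD//; last by apply: ball_bdd_sum => a; exact: ball_bddZ.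
congr (_ + _); rewrite ball_int_sum_Rp; last by move=> a aR; apply: ball_bddZ; exact: bK.
rewrite ball_int_sum; last by move=> a; exact: ball_bddZ.
apply: sum_Rp_ext => a aR; have a0 := pos_root_neq0 aR.
rewrite ball_intZ; last exact: bK.
rewrite ball_intZ// [in RHS](mulrC 2) -[in RHS]mulrA; congr (_ * _).
rewrite mulr_natl mulr2n -{2}(ball_int_refl a0 (bH a)) -ball_intD//; last exact: ball_bdd_refl.
apply: ball_int_ext => x _; rewrite /H /= wte_refl// dot_refl_self// /ibp_root.
rewrite /onem2 dot_refl// sqrrN.
rewrite (_ : diffq a f x * (dot a x ^+ 2 / (dot a x ^+ 2 + e)) =
   dot a x * diffq a f x * (dot a x / (dot a x ^+ 2 + e))); last by ring.
by rewrite dot_diffq; ring.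
Qed.

Lemma cvg_harmonic_right : (n.+1%:R^-1 : R) @[n --> \oo] --> 0^'+.
Proof.
move=> A hA; have [N _ hN] := @cvg_harmonic R _ hA.
exists N => // n Nn; have p : 0 < n.+1%:R^-1 :> R by rewrite invr_gt0.
exact: (hN n Nn p).
Qed.

(** The exponent [kappa a / 2] matches [|t|^kappa = (t^2)^(kappa/2)]. On the wall the limit is
    one-sided for [kappa a > 0], while for [kappa a = 0] all terms equal 1. *)
Lemma cvg_factor a x : 0 <= kappa a ->
  ((dot a x ^+ 2 + n.+1%:R^-1) `^ (kappa a / 2)) @[n --> \oo] --> `|dot a x| `^ kappa a.
Proof.
move=> k0; have [ax|ax] := eqVneq (dot a x) 0.
  rewrite ax normr0 expr0n /=; have [ka|ka] := eqVneq (kappa a) 0.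
    rewrite ka mul0r powRr0; under eq_fun do rewrite powRr0; exact: cvg_cst.
  rewrite powR0//; under eq_fun do rewrite add0r.
  apply: (cvg_comp _ (@powR R ^~ (kappa a / 2)) cvg_harmonic_right).
  by apply: powR_cvg0; rewrite divr_gt0// lt_neqAle eq_sym ka.
have ax2 : 0 < dot a x ^+ 2 by rewrite exprn_even_gt0.
have -> : `|dot a x| `^ kappa a = (dot a x ^+ 2) `^ (kappa a / 2).
  rewrite -[dot a x ^+ 2]real_normK ?num_real// -powR_mulrn// -powRrM; congr (_ `^ _).
  by field.
apply: (continuous_cvg _ (@continuous_powR R (kappa a / 2) _ ax2)).
rewrite -[X in _ --> X]addr0; apply: cvgD; first exact: cvg_cst.
exact: cvg_harmonic.
Qed.

Lemma cvg_wte x : wte n.+1%:R^-1 x @[n --> \oo] --> wt x.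
Proof.
rewrite /wt /wte; have : forall a, a \in Rs -> 0 <= kappa a by exact: kappaR_ge0.
elim: (Rs) => [|a l IH] k0.
  by rewrite big_nil; under eq_fun do rewrite big_nil; exact: cvg_cst.
rewrite big_cons; under eq_fun do rewrite big_cons.
apply: cvgM; first by apply: cvg_factor; apply: k0; rewrite inE eqxx.
by apply: IH => b bl; apply: k0; rewrite inE bl orbT.
Qed.

Lemma wt_eq0 a x : a \in Rs -> kappa a != 0 -> dot a x = 0 -> wt x = 0.
Proof.
move=> aR ka ax; apply/eqP; rewrite /wt prodf_seq_eq0; apply/hasP; exists a => //=.
by rewrite powR_eq0 normr_eq0 ax eqxx.
Qed.

(** On the wall [ibp_root] is 0 and does not tend to 1. The limit survives because there either
    [kappa a = 0] or the weight itself vanishes, hence the factor [kappa a] inside the statement. *)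
Lemma cvg_root a x : a \in Rp ->
  (wte n.+1%:R^-1 x * (kappa a * ibp_root n.+1%:R^-1 a x)) @[n --> \oo] --> wt x * kappa a.
Proof.
move=> /pos_root_mem aR; have [ka|ka] := eqVneq (kappa a) 0.
  rewrite ka mulr0; under eq_fun do rewrite mul0r mulr0; exact: cvg_cst.
have [ax|ax] := eqVneq (dot a x) 0.
  rewrite (wt_eq0 aR ka ax) mul0r; under eq_fun do rewrite /ibp_root ax expr0n /= mul0r !mulr0.
  exact: cvg_cst.
apply: cvgM; first exact: cvg_wte.
rewrite -[X in _ --> X]mulr1; apply: cvgM; first exact: cvg_cst.
have ax2 : dot a x ^+ 2 != 0 by rewrite expf_neq0.
rewrite -[X in _ --> X](mulfV ax2); apply: cvgM; first exact: cvg_cst.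
apply: cvgV => //; rewrite -[X in _ --> X]addr0; apply: cvgD; first exact: cvg_cst.
exact: cvg_harmonic.
Qed.

Lemma wte_le e x : 0 < e -> e <= 1 -> wte e x <= wte 1 x.
Proof.
move=> e0 e1; rewrite /wte big_seq [leRHS]big_seq; apply: ler_prod => a aR.
rewrite powR_ge0 /=; apply: ge0_ler_powR; rewrite ?nnegrE ?addr_ge0 ?sqr_ge0// ?(ltW e0)//.
- by rewrite divr_ge0// kappaR_ge0.
- by rewrite lerD2l.
Qed.

Lemma ibp_root_le e a x : 0 < e -> `|ibp_root e a x| <= 1.
Proof.
move=> e0; have p := sqrDe_gt0 a x e0.
rewrite ger0_norm; last by rewrite divr_ge0 ?sqr_ge0// ltW.
by rewrite ler_pdivrMr// mul1r lerDl ltW.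
Qed.

(** The limit of [ball_int_ibp_sym] along [e = 1/(n+1)]: with [ibp_root] replaced by 1, the
    derivative and the root terms combine into the Dunkl operator. *)
Lemma ball_int_dunkl_onem2 j f : Pol f ->
  ball_int (fun x => wt x * (D (ebasis R j) f x * onem2 x)) =
  2 * ball_int (fun x => wt x * (dot (ebasis R j) x * f x)).
Proof.
move=> pf.
pose Fn (n : nat) x := wte n.+1%:R^-1 x * ibp_main j f x + \sum_(a <- Rp) (kappa a * a 0 j) *
     (wte n.+1%:R^-1 x * onem2 x * (diffq a f x * ibp_root n.+1%:R^-1 a x)).
pose F x := wt x * ibp_main j f x + \sum_(a <- Rp) (kappa a * a 0 j) * (wt x * onem2 x * diffq a f x).
have bon : ball_bdd onem2 by apply: ball_bdd_Pol; exact: Pol_onem2.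
have bdq a : a \in Rp -> ball_bdd (diffq a f).
  by move=> /pos_root_neq0 a0; apply: ball_bdd_Pol; exact: Pol_diffq.
have bM := ball_bdd_ibp_main j pf.
have e0 n : 0 < n.+1%:R^-1 :> R by rewrite invr_gt0.
have e1 n : n.+1%:R^-1 <= 1 :> R by rewrite invf_le1// ler1n.
have bFn n : ball_bdd (Fn n).
  apply: ball_bddD; first by apply: ball_bddM => //; exact: ball_bdd_wte.
  apply: ball_bdd_sum_Rp => a aR; apply: ball_bddZ; apply: ball_bddM; last by apply: ball_bddM; [exact: bdq|exact: ball_bdd_ibp_root].
  by apply: ball_bddM => //; exact: ball_bdd_wte.
have bF : ball_bdd F.
  apply: ball_bddD; first by apply: ball_bddM => //; exact: ball_bdd_wt.
  apply: ball_bdd_sum_Rp => a aR; apply: ball_bddZ; apply: ball_bddM; last exact: bdq.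
  by apply: ball_bddM => //; exact: ball_bdd_wt.
(* A bound independent of [n]: [wte] increases with [e], here at most 1, and [ibp_root] lies between
   0 and 1. *)
pose B x := wte 1 x * `|ibp_main j f x| + \sum_(a <- Rp) `|kappa a * a 0 j| * (wte 1 x * `|onem2 x| * `|diffq a f x|).
have [_ [C BC]] : ball_bdd B.
  apply: ball_bddD; first by apply: ball_bddM; [exact: ball_bdd_wte|exact: ball_bdd_norm].
  apply: ball_bdd_sum_Rp => a aR; apply: ball_bddZ; apply: ball_bddM; last by apply: ball_bdd_norm; exact: bdq.
  by apply: ball_bddM; [exact: ball_bdd_wte|exact: ball_bdd_norm].
have F0 : ball_int F = 0.
  apply: (@ball_int_lim0 _ _ Fn F C) => //; last by move=> n; exact: ball_int_ibp_sym.
  - move=> n x x1; apply: le_trans (le_trans (ler_norm _) (BC x x1)).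
    have wn : `|wte n.+1%:R^-1 x| <= wte 1 x by rewrite ger0_norm ?wte_ge0// wte_le.
    apply: (le_trans (ler_normD _ _)); apply: lerD; first by rewrite normrM ler_wpM2r.
    apply: (le_trans (ler_norm_sum _ _ _)); apply: ler_sum => a _.
    rewrite normrM ler_wpM2l// normrM; apply: ler_pM => //; first by rewrite normrM ler_wpM2r.
    by rewrite normrM -[leRHS]mulr1 ler_wpM2l// ibp_root_le.
  - move=> x _; apply: cvgD; first by apply: cvgM; [exact: cvg_wte|exact: cvg_cst].
    (* The induction runs over sublists of [Rp], remembering that their members are positive roots,
       as [cvg_root] demands. *)
    have : {subset Rp <= Rp} by [].
    elim: {1 3 4}Rp => [|a l IH] sub.
      by rewrite big_nil; under eq_fun do rewrite big_nil; exact: cvg_cst.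
    rewrite big_cons; under eq_fun do rewrite big_cons.
    apply: cvgD; last by apply: IH => b bl; apply: sub; rewrite inE bl orbT.
    have aR : a \in Rp by apply: sub; rewrite inE eqxx.
    rewrite [X in _ --> X](_ : _ = wt x * kappa a * (a 0 j * onem2 x * diffq a f x)); last by ring.
    rewrite (_ : (fun n : nat => _) = (fun n : nat => wte n.+1%:R^-1 x * (kappa a * ibp_root n.+1%:R^-1 a x)
        * (a 0 j * onem2 x * diffq a f x))); last by apply/funext => n; ring.
    by apply: cvgM; [exact: cvg_root|exact: cvg_cst].
have bW g : Pol g -> ball_bdd (fun x => wt x * g x).
  by move=> pg; apply: ball_bddM; [exact: ball_bdd_wt|exact: ball_bdd_Pol].
have pe : Pol (fun x => dot (ebasis R j) x * f x) by exact: Pol_dotM.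
have pD : Pol (fun x => D (ebasis R j) f x * onem2 x).
  by apply: PolM; [exact: Pol_dunkl|exact: Pol_onem2].
apply/eqP; rewrite -subr_eq0 -(ball_intZ 2 (bW _ pe)) -ball_intB; [|exact: bW|by apply: ball_bddZ; exact: bW].
apply/eqP; rewrite -[RHS]F0; apply: ball_int_ext => x _.
rewrite /F /ibp_main /dunkl (dotC _ x) dot_ebasis.
rewrite [in RHS](eq_bigr (fun a => wt x * onem2 x * (kappa a * dot a (ebasis R j) * diffq a f x))); last first.
  by move=> a _; rewrite dot_ebasis; ring.
by rewrite -mulr_sumr; ring.
Qed.

(** * The weighted sphere integral *)

(** The weighted sphere integral up to the factor [d], which cancels in the quotient by [omega]. *)
Definition Lsph f : R := ball_int ((fun x => wt x * f x) \o @unitv R d).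
Definition lam2 : R := d%:R - 2 + 2 * \sum_(a <- Rp) kappa a.

Lemma sum_kappa_ge0 : 0 <= \sum_(a <- Rp) kappa a.
Proof.
by rewrite big_seq; apply: sumr_ge0 => a; exact: kappa_ge0.
Qed.

Lemma ball_bdd_wtM f : Pol f -> ball_bdd (fun x => wt x * f x).
Proof.
by move=> pf; apply: ball_bddM; [exact: ball_bdd_wt|exact: ball_bdd_Pol].
Qed.

(** The integrand is [|x|] to the power [n + k + 2 K], with [K] the sum of [kappa] over [Rp], times
    a function constant along rays; [ball_int_moment] adds [d] to that exponent, and
    [2 K + d = 2 + lam2]. *)
Lemma ball_int_Lsph k n g : (0 < d)%N -> PolH k g ->
  (n%:R + k%:R + 2 + lam2) * ball_int (fun x => enorm x ^+ n * (wt x * g x)) = d%:R * Lsph g.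
Proof.
move=> d0 hg; have pg := PolH_Pol hg; pose K := \sum_(a <- Rp) kappa a.
have K0 : 0 <= 2 * K by rewrite mulr_ge0// sum_kappa_ge0.
have nk0 : 0 <= n%:R + k%:R :> R by rewrite addr_ge0.
have := @ball_int_moment R d ((fun x => wt x * g x) \o @unitv R d) (n%:R + k%:R + 2 * K) d0
  (addr_ge0 nk0 K0) (ball_bdd_unitv (ball_bdd_wtM pg)).
rewrite -/(Lsph g) => <-; last by move=> r x r0 /=; rewrite unitvZ.
congr (_ * _); first by rewrite /lam2 -/K; ring.
apply: ball_int_ext => x _ /=.
rewrite -{2 3}(unitvK x) (PolH_scale _ _ hg) wtZ ?enorm_ge0// -/K.
rewrite powRD_ge0// powRD_ge0 ?ler0n// !powR_mulrn ?enorm_ge0//; ring.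
Qed.

(** By [main], the ball integral of [D f] minus that of [|x|^2 D f] is twice that of [x_j f].
    Converted to the sphere, these have denominators [k + 1 + lam2], [k + 3 + lam2] and
    [k + 3 + lam2], and clearing them leaves the factor [k + 1 + lam2]. *)
Lemma Lsph_dunkl k j f : (0 < d)%N -> PolH k f ->
  Lsph (D (ebasis R j) f) = (k%:R + 1 + lam2) * Lsph (fun x => dot (ebasis R j) x * f x).
Proof.
move=> d0 hf; have pf := PolH_Pol hf.
have d1 : 1 <= d%:R :> R by rewrite ler1n.
have K0 := sum_kappa_ge0; have k0 : 0 <= k%:R :> R by exact: ler0n.
have lam2_ge : -1 <= lam2 by rewrite /lam2; lra.
have dd0 : d%:R != 0 :> R by rewrite pnatr_eq0 -lt0n.
have pD := Pol_dunkl (ebasis R j) pf.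
have main := ball_int_dunkl_onem2 j pf.
have hx := PolH_dotM (ebasis R j) hf.
have V := ball_int_Lsph 0 d0 hx.
have bD := ball_bdd_wtM pD.
have split : ball_int (fun x => wt x * (D (ebasis R j) f x * onem2 x)) =
   ball_int (fun x => enorm x ^+ 0 * (wt x * D (ebasis R j) f x)) -
   ball_int (fun x => enorm x ^+ 2 * (wt x * D (ebasis R j) f x)).
  rewrite -ball_intB.
  - by apply: ball_int_ext => x _; rewrite sqr_enorm /onem2 expr0; ring.
  - by apply: ball_bdd_ext bD => x; rewrite expr0 mul1r.
  - apply: ball_bddM => //.
    by apply: (ball_bdd_ext (F := fun x => enorm x * enorm x)) => [x|]; [rewrite expr2|apply: ball_bddM; exact: ball_bdd_enorm].
have V' : ball_int (fun x => enorm x ^+ 0 * (wt x * (dot (ebasis R j) x * f x))) =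
   ball_int (fun x => wt x * (dot (ebasis R j) x * f x)).
  by apply: ball_int_ext => x _; rewrite expr0 mul1r.
move: V; rewrite V' -natr1 => V.
(* For [k = 0] the function [D f] is zero, and [main] forces the other integral to vanish as
   well. *)
have := PolHz_dunkl (ebasis R j) hf; rewrite /PolHz; case: ifPn => [k1 hD|_ hD].
  have U0 := ball_int_Lsph 0 d0 hD; have U2 := ball_int_Lsph 2 d0 hD.
  rewrite split in main; rewrite natrB// in U0 U2.
  set LD := Lsph (D _ f) in U0 U2 *; set LX := Lsph _ in V *.
  set u0 := ball_int (fun x => enorm x ^+ 0 * _) in U0 main; set u2 := ball_int (fun x => enorm x ^+ 2 * _) in U2 main.
  set w := ball_int _ in V main.
  have k1' : 1 <= k%:R :> R by rewrite ler1n.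
  have s0 : k%:R + 3 + lam2 != 0 by apply: lt0r_neq0; lra.
  apply: (mulfI (mulf_neq0 s0 dd0)).
  have E0 : (k%:R + 1 + lam2) * u0 = d%:R * LD by rewrite -U0; congr (_ * _); ring.
  have E2 : (k%:R + 3 + lam2) * u2 = d%:R * LD by rewrite -U2; congr (_ * _); ring.
  have E1 : (k%:R + 3 + lam2) * w = d%:R * LX by rewrite -V; congr (_ * _); ring.
  have T : (k%:R + 1 + lam2) * ((k%:R + 3 + lam2) * (u0 - u2)) = (k%:R + 1 + lam2) * (2 * ((k%:R + 3 + lam2) * w)).
    by rewrite main; ring.
  have T' : (k%:R + 3 + lam2) * ((k%:R + 1 + lam2) * u0) - (k%:R + 1 + lam2) * ((k%:R + 3 + lam2) * u2)
     = (k%:R + 1 + lam2) * (2 * ((k%:R + 3 + lam2) * w)) by rewrite -T; ring.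
  move: T'; rewrite E0 E1 E2 => T'.
  have two : (2 : R) != 0 by rewrite pnatr_eq0.
  have T2 : d%:R * LD = (k%:R + 1 + lam2) * (d%:R * LX).
    by apply: (mulfI two); rewrite [RHS]mulrCA -T'; ring.
  by rewrite -mulrA T2; ring.
have main0 : ball_int (fun x => wt x * (D (ebasis R j) f x * onem2 x)) = 0.
  by rewrite -[RHS](@ball_int0 R d); apply: ball_int_ext => x _; rewrite hD mul0r mulr0.
have w0 : ball_int (fun x => wt x * (dot (ebasis R j) x * f x)) = 0 by lra.
have LX0 : Lsph (fun x => dot (ebasis R j) x * f x) = 0.
  by apply: (mulfI dd0); rewrite -V w0 !mulr0.
rewrite LX0 mulr0 -[RHS](@ball_int0 R d); apply: ball_int_ext => x _ /=.
by rewrite hD mulr0.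
Qed.

Lemma Lsph_ext f g : f =1 g -> Lsph f = Lsph g.
Proof.
by move=> /funext ->.
Qed.

Lemma sphere_int_wt f : Pol f -> sphere_int (fun x => f x * hk Rp kappa x ^+ 2) = d%:R * Lsph f.
Proof.
move=> pf; rewrite (_ : (fun x => _) = fun x => wt x * f x).
  by rewrite sphere_intE//; exact: ball_bdd_wtM.
by apply/funext => x; rewrite hk_wt mulrC.
Qed.

(** The weight vanishes only on root hyperplanes. This positivity permits the division by
    [omega]. *)
Lemma Lsph1_gt0 : 0 < Lsph (fun _ => 1).
Proof.
apply: (@ball_int_gt0 _ _ _ Rs) => [|x|a|x].
- by apply: ball_bdd_unitv; apply: ball_bdd_wtM; exact: Pol_cst.
- by rewrite /= mulr1 wt_ge0.
- exact: root_neq0.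
rewrite /= mulr1 => /eqP; rewrite /wt prodf_seq_eq0 => /hasP[a aR].
rewrite /= powR_eq0 normr_eq0 => /andP[/eqP ax _]; exists a => //.
by rewrite -(unitvK x) dotZr ax mulr0.
Qed.

Lemma Lsph_add f g : Pol f -> Pol g -> Lsph (fun x => f x + g x) = Lsph f + Lsph g.
Proof.
move=> pf pg; rewrite /Lsph -ball_intD; [|by apply: ball_bdd_unitv; exact: ball_bdd_wtM..].
by apply: ball_int_ext => x _ /=; rewrite mulrDr.
Qed.

Lemma Lsph_scal (c : R) f : Pol f -> Lsph (fun x => c * f x) = c * Lsph f.
Proof.
move=> pf; rewrite /Lsph -ball_intZ; last by apply: ball_bdd_unitv; exact: ball_bdd_wtM.
by apply: ball_int_ext => x _ /=; rewrite mulrCA.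
Qed.

Lemma Lsph_refl a f : a \in Rp -> Pol f -> Lsph (f \o refl a) = Lsph f.
Proof.
move=> aR pf; have a0 := pos_root_neq0 aR.
rewrite /Lsph -[RHS](ball_int_refl a0); last by apply: ball_bdd_unitv; exact: ball_bdd_wtM.
by apply: ball_int_ext => x _ /=; rewrite unitv_refl// wt_refl.
Qed.

Lemma Lsph_opp f : Pol f -> Lsph (fun x => f (- x)) = Lsph f.
Proof.
move=> pf; rewrite /Lsph -[RHS]ball_int_opp; last by apply: ball_bdd_unitv; exact: ball_bdd_wtM.
by apply: ball_int_ext => x _ /=; rewrite unitvN wtN.
Qed.

Lemma lam2_ge : (0 < d)%N -> -1 <= lam2.
Proof.
move=> d0; have d1 : 1 <= d%:R :> R by rewrite ler1n.
by have K0 := sum_kappa_ge0; rewrite /lam2; lra.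
Qed.

Lemma lam2E : lam2 = 2 * lambda_k Rp kappa.
Proof.
by rewrite /lam2 /lambda_k; field.
Qed.

(** * From multi-indices to lists of basis vectors, and the final constants *)

Definition mon_roots (m : mpoly.multinom d) : seq vec :=
  flatten [seq nseq (mpoly.fun_of_multinom m i) (ebasis R i) | i <- enum 'I_d].

Lemma mulmon_cat (l1 l2 : seq vec) f : mulmon (l1 ++ l2) f = mulmon l1 (mulmon l2 f).
Proof.
by rewrite /mulmon foldr_cat.
Qed.

Lemma mulmon_roots m f x :
  mulmon (mon_roots m) f x = (\prod_(i < d) x 0 i ^+ mpoly.fun_of_multinom m i) * f x.
Proof.
rewrite -big_enum /= /mon_roots; elim: (enum 'I_d) f => [|i l IH] f.
  by rewrite big_nil mul1r.
rewrite [flatten _]/= mulmon_cat big_cons -mulrA -IH.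
elim: (mpoly.fun_of_multinom m i) => [|n IHn]; first by rewrite expr0 mul1r.
by rewrite exprS -mulrA -IHn /= dotC dot_ebasis.
Qed.

(** Each basis vector occurs as often as its exponent, in the order of [enum 'I_d], so both sides
    are literally the same composition of operators. *)
Lemma Dmon_roots m f : Dmon (mon_roots m) f = dunkl_mon Rp kappa m f.
Proof.
rewrite /dunkl_mon /mon_roots; elim: (enum 'I_d) => [//|i l IH].
rewrite [flatten _]/= /Dmon foldr_cat -/(Dmon _ f) IH /=.
by elim: (mpoly.fun_of_multinom m i) => [//|n IHn]; rewrite /= IHn.
Qed.

Lemma size_mon_roots m : size (mon_roots m) = mpoly.mdeg m.
Proof.
rewrite /mon_roots size_flatten /shape -map_comp sumnE big_map mpoly.mdegE -big_enum /=.
by apply: eq_bigr => i _; rewrite /= size_nseq.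
Qed.

Lemma pevalE (q : mpoly.mpoly d R) f x :
  peval q x * f x = \sum_(m <- mpoly.msupp q) mpoly.mcoeff m q * mulmon (mon_roots m) f x.
Proof.
rewrite /peval mpoly.mevalE mulr_suml; apply: eq_bigr => m _.
by rewrite mulmon_roots mulrA.
Qed.

Lemma PolH_mulmon k (l : seq vec) f : PolH k f -> PolH (size l + k) (mulmon l f).
Proof.
by move=> hf; elim: l => [//|u l IH]; exact: PolH_dotM.
Qed.

Lemma PolH_peval l (p : mpoly.mpoly d R) : homog_deg l p -> PolH l (peval p).
Proof.
move=> hp; pose F m : vec -> R := if m \in mpoly.msupp p then
  (fun x => mpoly.mcoeff m p * mulmon (mon_roots m) (fun _ => 1) x) else fun _ => 0.
apply: (@PolH_ext _ _ _ (fun x => \sum_(m <- mpoly.msupp p) F m x)).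
  move=> x; rewrite -[RHS]mulr1 (pevalE p (fun _ => 1)) big_seq [RHS]big_seq.
  by apply: eq_bigr => m mp; rewrite /F mp.
apply: PolH_sum => m; rewrite /F; case: ifP => [mp|_]; last exact: PolH0.
apply: PolHZ; rewrite -(hp m mp) -size_mon_roots -[size _]addn0.
by apply: PolH_mulmon; exact: PolH_cst.
Qed.

(** Homogeneity gives all monomials of [q] the same length [m], hence one common constant. *)
Lemma ad_peval m (q : mpoly.mpoly d R) f : homog_deg m q -> Pol f ->
  iter m ad (fun f x => peval q x * f x) f =
  fun x => 2 ^+ m * m`!%:R * dunkl_poly Rp kappa q f x.
Proof.
move=> hq pf.
have -> : (fun f x => peval q x * f x) =
    (fun f x => \sum_(m <- mpoly.msupp q) mpoly.mcoeff m q * mulmon (mon_roots m) f x).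
  by apply/funext => g; apply/funext => x; exact: pevalE.
rewrite ad_sum//; last by move=> i; exact: PolOp_mulmon.
apply/funext => x; rewrite /dunkl_poly mulr_sumr big_seq [RHS]big_seq.
apply: eq_bigr => k kq; have [E _] := ad_mulmon (mon_roots k).
have sk : size (mon_roots k) = m by rewrite size_mon_roots hq.
by move: E; rewrite sk => /(_ f pf) ->; rewrite Dmon_roots; ring.
Qed.

Lemma prod_low m : \prod_(i < m) (2 * (m - i)%:R * (2 * (m - i)%:R + lam2)) =
  2 ^+ m * m`!%:R * (2 ^+ m * pochhammer (lambda_k Rp kappa + 1) m).
Proof.
rewrite (reindex_inj rev_ord_inj) /=.
transitivity (\prod_(i < m) ((2 * i.+1%:R) * (2 * (lambda_k Rp kappa + 1 + i%:R)))).
  by apply: eq_bigr => i _; rewrite subKn// lam2E -natr1; ring.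
rewrite big_split /= !big_split /= !prodr_const card_ord -/(pochhammer _ _); congr (_ * _ * _).
elim: m => [|m IH]; first by rewrite big_ord0 fact0.
by rewrite big_ord_recr /= IH factS natrM mulrC.
Qed.

Lemma prod_high m n : \prod_(i < n) (2 * i.+1%:R * (2 * (m%:R + i.+1%:R) + lam2)) =
  2 ^+ n * n`!%:R * (2 ^+ n * \prod_(i < n) (lambda_k Rp kappa + 1 + (m + i)%:R)).
Proof.
transitivity (\prod_(i < n) ((2 * i.+1%:R) * (2 * (lambda_k Rp kappa + 1 + (m + i)%:R)))).
  by apply: eq_bigr => i _; rewrite lam2E natrD -natr1; ring.
rewrite big_split /= !big_split /= !prodr_const card_ord; congr (_ * _ * _).
elim: n => [|n IH]; first by rewrite big_ord0 fact0.
by rewrite big_ord_recr /= IH factS natrM mulrC.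
Qed.

Lemma pochhammerD (a : R) m n : pochhammer a (m + n) =
  pochhammer a m * \prod_(i < n) (a + (m + i)%:R).
Proof.
by rewrite /pochhammer big_split_ord.
Qed.

Lemma pochhammer_gt0 n : (0 < d)%N -> 0 < pochhammer (lambda_k Rp kappa + 1) n.
Proof.
move=> d0; have := lam2_ge d0; rewrite lam2E => h.
by apply: prodr_gt0 => i _; have i0 : 0 <= i%:R :> R := ler0n _ _; lra.
Qed.

(** The function [ad^m] of multiplication by [q], applied to [g], has degree 0, so its integral is
    its value times that of 1. [Lam_ad] and [Lam_lap_iter] evaluate the same integral from [Lsph] of
    [q f]; the Pochhammer symbols of lengths [m] and [n] join by [pochhammerD]. *)
Lemma Lsph_main m n f q : (0 < d)%N -> homog_deg m q -> (forall x, L (peval q) x = 0) ->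
  PolH (m + 2 * n) f -> forall x,
  dunkl_poly Rp kappa q (iter n L f) x * Lsph (fun _ => 1) =
  2 ^+ (m + 2 * n) * n`!%:R * pochhammer (lambda_k Rp kappa + 1) (m + n)
  * Lsph (fun x => peval q x * f x).
Proof.
move=> d0 hq q0 hf x.
have hQ := PolH_peval hq.
have hg : PolH m (iter n L f).
  by have := PolHz_lap_iter n hf; rewrite /PolHz leq_addl addnK.
set g := iter n L f in hg *; have pg := PolH_Pol hg.
pose T := (fun (f : vec -> R) x => peval q x * f x).
have T0 : T (fun _ => 0) = (fun _ => 0) by apply/funext => y; rewrite /T mulr0.
have hT e h : PolH e h -> PolH (m + e) (T h) by exact: PolHM.
have pT : PolOp T by move=> h ph; apply: PolM => //; exact: PolH_Pol hQ.
have Ldk := fun k j h (hh : PolH k h) => Lsph_dunkl j d0 hh.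
have Tlow e h : (e < m)%N -> PolH e h -> Lsph (T h) = 0.
  move=> em hh.
  exact: (Lam_lowdeg Lsph_add Lsph_scal Lsph_refl Lsph_opp Ldk (lam2_ge d0) hh hQ q0 em).
have A := Lam_ad Lsph_add Lsph_scal Lsph_refl Ldk hg T0 hT pT Tlow (leqnn m).
have B := Lam_lap_iter Lsph_add Lsph_scal Lsph_refl Ldk hf hQ q0.
have hc : PolH 0 (iter m ad T g).
  by have := PolHz_ad m T0 hT hg; rewrite /PolHz mul2n -addnn leqnn subnn.
have C : Lsph (iter m ad T g) = iter m ad T g x * Lsph (fun _ => 1).
  rewrite -Lsph_scal; last exact: Pol_cst.
  by apply: Lsph_ext => y; rewrite mulr1; exact: PolH0_const.
move: C; rewrite A prod_low {1}/T /g B prod_high -/g.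
rewrite (ad_peval hq pg) pochhammerD => C.
have z : 2 ^+ m * m`!%:R != 0 :> R.
  by rewrite mulf_neq0 ?expf_neq0 ?pnatr_eq0// -lt0n fact_gt0.
apply: (mulfI z); rewrite [LHS]mulrA; apply: (eq_trans (esym C)).
by rewrite mul2n -addnn !exprD; ring.
Qed.

Lemma sphere_int_formula l m (p q : mpoly.mpoly d R) : (0 < d)%N ->
  homog_deg l p -> homog_deg m q -> (forall x, L (peval q) x = 0) ->
  let omega := sphere_int (fun y => hk Rp kappa y ^+ 2) in
  let I := sphere_int (fun y => peval q y * peval p y * hk Rp kappa y ^+ 2) in
  (forall n : nat, l = (m + 2 * n)%N -> forall x,
     I / omega = (2 ^+ (m + 2 * n) * n`!%:R * pochhammer (lambda_k Rp kappa + 1) (m + n))^-1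
       * dunkl_poly Rp kappa q (iter n L (peval p)) x)
  /\ ((l < m)%N \/ odd (l - m) -> I = 0).
Proof.
move=> d0 hp hq q0 omega I.
have hP := PolH_peval hp; have hQ := PolH_peval hq.
have pqp := PolH_Pol (PolHM hQ hP).
have IE : I = d%:R * Lsph (fun x => peval q x * peval p x) := sphere_int_wt pqp.
have oE : omega = d%:R * Lsph (fun _ => 1).
  rewrite -sphere_int_wt; last exact: Pol_cst.
  by rewrite /omega; congr sphere_int; apply/funext => x; rewrite mul1r.
have L1 := Lsph1_gt0.
have dd0 : d%:R != 0 :> R by rewrite pnatr_eq0 -lt0n.
split=> [n ln x|].
  rewrite IE oE -mulf_div mulfV// mul1r.
  have hP' : PolH (m + 2 * n) (peval p) by rewrite -ln.
  have E := Lsph_main d0 hq q0 hP' x.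
  have c0 : 2 ^+ (m + 2 * n) * n`!%:R * pochhammer (lambda_k Rp kappa + 1) (m + n) != 0.
    by rewrite !mulf_neq0 ?expf_neq0 ?pnatr_eq0 -?lt0n ?fact_gt0// gt_eqF// pochhammer_gt0.
  by apply: (mulfI c0); rewrite [RHS]mulrA mulfV// mul1r mulrA -E mulfK// gt_eqF.
case=> [lm|olm]; rewrite IE.
  by rewrite (Lam_lowdeg Lsph_add Lsph_scal Lsph_refl Lsph_opp
    (fun k j h hh => Lsph_dunkl j d0 hh) (lam2_ge d0) hP hQ q0 lm) mulr0.
rewrite (Lam_odd Lsph_scal Lsph_opp (PolHM hQ hP)) ?mulr0//.
(* Subtraction is truncated: an odd [l - m] is nonzero, so [m <= l], and the parity of [m + l]
   follows. *)
case: (leqP m l) => [ml|/ltnW]; last by rewrite -subn_eq0 => /eqP lm; rewrite lm in olm.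
by move: olm; rewrite oddB// oddD addbC.
Qed.

End dunkl_algebra.

Theorem theorem3p1 (R : realType) (d : nat) (Rs : seq 'rV[R]_d) (v : 'rV[R]_d)
  (kappa : 'rV[R]_d -> R) (l m : nat) (p q : mpoly.mpoly d R) :
  (1 <= d)%N ->
  root_system Rs -> regular Rs v -> multiplicity Rs kappa ->
  homog_deg l p ->
  homog_deg m q ->
  (forall x, dunkl_lap (pos_roots Rs v) kappa (peval q) x = 0) ->
  let Rp := pos_roots Rs v in
  let omega := sphere_int (fun y => hk Rp kappa y ^+ 2) in
  let I := sphere_int (fun y => peval q y * peval p y * hk Rp kappa y ^+ 2) in
  (forall n : nat, l = (m + 2 * n)%N ->
     forall x : 'rV[R]_d,
       I / omega =
       (2 ^+ (m + 2 * n) * n`!%:R * pochhammer (lambda_k Rp kappa + 1) (m + n))^-1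
       * dunkl_poly Rp kappa q (iter n (dunkl_lap Rp kappa) (peval p)) x)
  /\ ((l < m)%N \/ odd (l - m) -> I = 0).
Proof.
move=> d0 rs rv km hp hq q0.
exact: (sphere_int_formula rs rv km d0 hp hq q0).
Qed.
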